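(* Let $(X_n)_{n\ge 0}$ be a (tenable) Pólya urn process with $s$ colours and real replacement matrix $R=(r_{ij})_{i,j=1}^s$, and suppose that the urn is balanced (with all row sums of $R$ equal to $m>0$), irreducible and strictly small. Let $\lambda_1=m$ be the largest real eigenvalue of $R$ and let $v_1$ be the positive left eigenvector of $R$ with eigenvalue $\lambda_1$, normalized by $|v_1|=1$. Then there is a covariance matrix $\Sigma$, determined by $R$, such that, as $n\to\infty$, $$\frac{X_n-n\lambda_1 v_1}{\sqrt{n}}\ \overset{\mathrm d}{\longrightarrow}\ N(0,\Sigma),$$ with convergence of all (mixed) moments: for every multi-index $\alpha\in\mathbb Z_{\ge0}^s$, $\mathbb E\prod_{i=1}^s\big((X_{n}-n\lambda_1v_{1})_i/\sqrt n\big)^{\alpha_i}$ converges to the corresponding moment $\mathbb E\prod_i Z_i^{\alpha_i}$ of $Z\sim N(0,\Sigma)$. In particular, $\mathbb E X_n=n\lambda_1v_1+o(n^{1/2})$ and the covariance matrix satisfies $\operatorname{Var}(X_n)=n\Sigma+o(n)$.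
   Context: Pólya urn process (real version): $R=(r_{ij})_{i,j=1}^s$ is a real $s\times s$ matrix and $X_0\in[0,\infty)^s\setminus\{0\}$ is a deterministic vector. Given $X_n=(X_{n1},\dots,X_{ns})\in[0,\infty)^s\setminus\{0\}$, put $X_{n+1}=X_n+(r_{K1},\dots,r_{Ks})$, where the random index $K\in\{1,\dots,s\}$ has conditional distribution (given the past) $\mathbb P(K=k\mid X_n)=X_{nk}/\sum_{j=1}^sX_{nj}$. So $(X_n)$ is a Markov process. Tenability: the process is tenable if always $X_n\in[0,\infty)^s\setminus\{0\}$. Throughout it is assumed that for all $j,k\in\{1,\dots,s\}$: $r_{kj}\ge0$ if $j\ne k$; and either $r_{kk}\ge 0$, or $X_{0k}\mathbb Z+\sum_{i=1}^s r_{ik}\mathbb Z=r_{kk}\mathbb Z$. Balanced: all row sums of $R$ equal a constant $m$; it is assumed that $m>0$. Irreducible: the matrix $R$ is irreducible. Then $\lambda_1:=m$ is a simple eigenvalue of $R$, all other eigenvalues $\lambda$ satisfy $\operatorname{Re}\lambda<\lambda_1$, and there is a unique positive left eigenvector $v_1$ of $R$ with eigenvalue $\lambda_1$ and $|v_1|=1$, where $|(x_1,\dots,x_s)|:=\sum_i|x_i|$. Strictly small: $\lambda_1$ is a simple eigenvalue and every other eigenvalue $\lambda$ of $R$ satisfies $\operatorname{Re}\lambda<\frac12\lambda_1$. *)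

(* Defs.v *)
From HB Require Import structures.
From mathcomp Require Import all_boot all_order all_algebra.
From mathcomp Require Import complex.
From mathcomp Require Import all_classical all_reals all_analysis.

Set Implicit Arguments.
Unset Strict Implicit.
Unset Printing Implicit Defensive.

Import Order.TTheory GRing.Theory Num.Theory.
Import numFieldNormedType.Exports.

Local Open Scope classical_set_scope.
Local Open Scope ring_scope.

(* With X0 >= 0, X0 != 0 and a balance m > 0, this keeps the urn almost surely
   in [0, oo)^s \ {0}. *)
Definition tenability_cond (R : realType) (s : nat) (A : 'M[R]_s) (X0 : 'rV[R]_s) : Prop :=
  (forall j k : 'I_s, j != k -> 0 <= A k j) /\
  (forall k : 'I_s, 0 <= A k k \/
     [set x : R | exists (a : int) (c : 'I_s -> int),
        x = X0 0 k *~ a + \sum_(i < s) A i k *~ c i]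
     = [set x : R | exists b : int, x = A k k *~ b]).

Definition balanced (R : realType) (s : nat) (A : 'M[R]_s) (m : R) : Prop :=
  forall i : 'I_s, \sum_(j < s) A i j = m.

(* No simultaneous permutation of rows and columns makes the matrix block
   triangular: no nonempty proper set of indices B has A i j = 0 for all
   i in B and j outside B. *)
Definition irreducible_mx (R : realType) (s : nat) (A : 'M[R]_s) : Prop :=
  forall B : {set 'I_s}, (exists i, i \in B) -> (exists j, j \notin B) ->
    exists i j : 'I_s, [/\ i \in B, j \notin B & A i j != 0].

(* Simplicity is algebraic; the other eigenvalues are taken in R[i]. *)
Definition strictly_small (R : realType) (s : nat) (A : 'M[R]_s) (l1 : R) : Prop :=
  mup l1 (char_poly A) = 1%N /\
  forall z : R[i], eigenvalue (map_mx (real_complex R) A) z ->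
    z != l1%:C%C -> complex.Re z < l1 / 2.

(* X_{n+1} = X_n + (row K_n of A).  Since X_0, ..., X_n take finitely many
   values, the conditional law of K_n given the past is expressed on the
   elementary events {X_0 = x_0, ..., X_n = x_n}. *)
Definition polya_urn (d : measure_display) (T : measurableType d) (R : realType)
    (P : probability T R) (s : nat) (A : 'M[R]_s) (X0 : 'rV[R]_s)
    (X : nat -> T -> 'rV[R]_s) : Prop :=
  exists K : nat -> T -> 'I_s,
  [/\ forall n k, measurable (K n @^-1` [set k]),
      forall w, X 0%N w = X0,
      forall n w, X n.+1 w = X n w + row (K n w) A
    & forall (n : nat) (x : nat -> 'rV[R]_s) (k : 'I_s),
        let past := [set w | forall i, (i <= n)%N -> X i w = x i] in
        P (past `&` K n @^-1` [set k])
        = (P past * (x n 0 k / \sum_(j < s) x n 0 j)%:E)%E].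

Definition covariance_mx (R : realType) (s : nat) (S : 'M[R]_s) : Prop :=
  S^T = S /\ forall t : 'rV[R]_s, 0 <= (t *m S *m t^T) 0 0.

(* N(0, v) on R for v >= 0; the library's normal_prob 0 0 is a junk value
   rather than the Dirac mass at 0. *)
Definition centered_normal (R : realType) (v : R) (B : set R) : \bar R :=
  if v == 0 then \d_(0 : R) B else normal_prob 0 (Num.sqrt v) B.

(* Z ~ N(0, S): every linear combination t . Z has law N(0, t S t^T). *)
Definition normal_vector (d : measure_display) (T : measurableType d)
    (R : realType) (P : probability T R) (s : nat) (S : 'M[R]_s)
    (Z : T -> 'rV[R]_s) : Prop :=
  (forall i : 'I_s, measurable_fun [set: T] (fun w => Z w 0 i)) /\
  forall (t : 'rV[R]_s) (B : set R), measurable B ->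
    P [set w | B (\sum_(i < s) t 0 i * Z w 0 i)]
    = centered_normal ((t *m S *m t^T) 0 0) B.

(* Y_n and Z may live on different probability spaces. *)
Definition cvg_in_distribution (d : measure_display) (T : measurableType d)
    (d' : measure_display) (T' : measurableType d') (R : realType)
    (P : probability T R) (P' : probability T' R) (s : nat)
    (Y : nat -> T -> 'rV[R]_s) (Z : T' -> 'rV[R]_s) : Prop :=
  forall f : 'rV[R]_s -> R,
    continuous f -> (exists M : R, forall x, `|f x| <= M) ->
    ('E_P[fun w => (f (Y n w))%R] @[n --> \oo] --> 'E_P'[fun w => (f (Z w))%R])%E.

Definition cvg_moments (d : measure_display) (T : measurableType d)
    (d' : measure_display) (T' : measurableType d') (R : realType)
    (P : probability T R) (P' : probability T' R) (s : nat)
    (Y : nat -> T -> 'rV[R]_s) (Z : T' -> 'rV[R]_s) : Prop :=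
  forall alpha : 'I_s -> nat,
    ('E_P[fun w => (\prod_(i < s) Y n w 0 i ^+ alpha i)%R] @[n --> \oo]
     --> 'E_P'[fun w => (\prod_(i < s) Z w 0 i ^+ alpha i)%R])%E.

(* Main.v *)
Require Import Defs.
From HB Require Import structures.
From mathcomp Require Import all_boot all_order all_algebra.
From mathcomp Require Import complex.
From mathcomp Require Import all_classical all_reals all_analysis.
From mathcomp Require Import measurable_realfun.
From mathcomp Require Import ring lra.

Set Implicit Arguments.
Unset Strict Implicit.
Unset Printing Implicit Defensive.

Import Order.TTheory GRing.Theory Num.Theory.
Import numFieldNormedType.Exports.

Local Open Scope classical_set_scope.
Local Open Scope ring_scope.

(** Let w_n = |X_0| + n m be the total content of the urn and D_n = X_n - w_n v1.
    Then D_(n+1) = D_n + a_K, where a_k is the k-th row of M = A - m 1 v1 and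
    K = k has conditional probability v1_k + D_nk / w_n.  As v1 M = 0, the mean
    increment is D_n M / w_n: D is a walk with a linear drift that weakens like
    1 / n.  Removing the rank one matrix m 1 v1 sends the eigenvalue m of A to 0
    and keeps the others, so that strict smallness puts the whole spectrum of M
    to the left of m / 2 ([deflated_eigenvalue]), which is the rate at which
    sqrt w_n grows.  Hence D_n has size sqrt n and forgets its initial value.

    Two estimates make this precise.  In a Euclidean norm adapted to M
    ([lyapunov_norm]) the drift is slower than the growth of w_n, which gives
    E |D_n|^(2 r) = O(n^r) by induction on r ([chain_moment_bound]).  For the
    law, a Taylor expansion of one step expresses E cos (t . D_n / sqrt w_n + th)
    at time n + 1 and frequency t by its value at time n and a frequency t' that
    is shorter by a factor 1 - c / w_n in a norm adapted to M^T, up to an error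
    of order w_n^(-3/2).  Let B be the covariance of a_K for K distributed as
    v1, and S the solution of the Lyapunov equation M^T S + S M = m S - B
    ([lyapunov_solve]).  The function cos th exp (- t S t^T / 2) obeys the same
    recursion, and the contraction of the frequencies makes the difference of
    the two tend to 0 ([chain_cf_cvg]).  Since w_n / n tends to m, the limiting
    covariance is m S.

    A Gaussian vector with this covariance is built from a factorization of
    m S into rank one matrices, one independent coordinate at a time
    ([psd_factor], [gauss_cos_exists]).  Convergence of the characteristic
    functions extends to bounded continuous functions because these are
    approximated by trigonometric polynomials up to e (1 + |x|^2), an error
    controlled by second moments ([trigpoly_approx], [cvg_bounded_continuous]),
    and to all monomials by truncation ([cvg_poly_growth]).  The expansions of
    the mean and of the covariance are the moments of order one and two. *)

(** * Euclidean scalar product *)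

Section Dot.
Context {R : realType}.

Definition dot n (u v : 'rV[R]_n) : R := \sum_i u 0 i * v 0 i.

Lemma dotE n (u v : 'rV[R]_n) : dot u v = (u *m v^T) 0 0.
Proof. by rewrite mxE; apply: eq_bigr => i _; rewrite mxE. Qed.

Lemma dotC n (u v : 'rV[R]_n) : dot u v = dot v u.
Proof. by apply: eq_bigr => i _; rewrite mulrC. Qed.

Lemma dotDl n (u v w : 'rV[R]_n) : dot (u + v) w = dot u w + dot v w.
Proof. by rewrite !dotE mulmxDl mxE. Qed.

Lemma dotZl n a (u w : 'rV[R]_n) : dot (a *: u) w = a * dot u w.
Proof. by rewrite !dotE -scalemxAl mxE. Qed.

Lemma dotDr n (u v w : 'rV[R]_n) : dot w (u + v) = dot w u + dot w v.
Proof. by rewrite dotC dotDl !(dotC _ w). Qed.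

Lemma dotZr n a (u w : 'rV[R]_n) : dot w (a *: u) = a * dot w u.
Proof. by rewrite dotC dotZl (dotC u). Qed.

Lemma dotNl n (u w : 'rV[R]_n) : dot (- u) w = - dot u w.
Proof. by rewrite -scaleN1r dotZl mulN1r. Qed.

Lemma dotNr n (u w : 'rV[R]_n) : dot w (- u) = - dot w u.
Proof. by rewrite -scaleN1r dotZr mulN1r. Qed.

Lemma dot0l n (w : 'rV[R]_n) : dot 0 w = 0.
Proof. by rewrite -(scale0r (0 : 'rV[R]_n)) dotZl mul0r. Qed.

Lemma dot0r n (w : 'rV[R]_n) : dot w 0 = 0.
Proof. by rewrite dotC dot0l. Qed.

Lemma dot_sumr n (I : finType) (F : I -> 'rV[R]_n) (w : 'rV[R]_n) :
  dot w (\sum_i F i) = \sum_i dot w (F i).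
Proof.
apply: (big_ind2 (fun u a => dot w u = a)) => //; first exact: dot0r.
by move=> u a v b <- <-; rewrite dotDr.
Qed.

Lemma dot_mulmx n k (u : 'rV[R]_n) (v : 'rV[R]_k) (M : 'M[R]_(n, k)) :
  dot (u *m M) v = dot u (v *m M^T).
Proof. by rewrite !dotE trmx_mul trmxK mulmxA. Qed.

Lemma dot_ge0 n (u : 'rV[R]_n) : 0 <= dot u u.
Proof. by apply: sumr_ge0 => i _; rewrite -expr2 sqr_ge0. Qed.

Lemma dot_eq0 n (u : 'rV[R]_n) : (dot u u == 0) = (u == 0).
Proof.
apply/eqP/eqP => [|->]; last exact: dot0l.
move=> /eqP; rewrite psumr_eq0 => [/allP h|i _]; last by rewrite -expr2 sqr_ge0.
apply/rowP => i; rewrite mxE; apply/eqP.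
by have := h i (mem_index_enum i); rewrite -expr2 sqrf_eq0.
Qed.

Lemma dot_delta n (u : 'rV[R]_n) i : dot (delta_mx 0 i) u = u 0 i.
Proof.
rewrite /dot (bigD1 i)//= big1 ?addr0 ?mxE ?eqxx ?mul1r// => j ji.
by rewrite mxE (negbTE ji) andbF mul0r.
Qed.

Lemma dot_sqr_le n (x y : 'rV[R]_n) : dot x y ^+ 2 <= dot x x * dot y y.
Proof.
have [->|y0] := eqVneq y 0; first by rewrite !dot0r expr0n mulr0.
have yy : 0 < dot y y by rewrite lt_neqAle eq_sym dot_eq0 y0 dot_ge0.
have := dot_ge0 (dot y y *: x - dot x y *: y).
rewrite !dotDl !dotDr !dotNl !dotNr !dotZl !dotZr (dotC y x).
rewrite (_ : _ + _ = dot y y * (dot x x * dot y y - dot x y ^+ 2)); last by ring.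
by rewrite pmulr_rge0// subr_ge0.
Qed.

Lemma dot_shift_le n (y v : 'rV[R]_n) (a : R) :
  dot (y + a *: v) (y + a *: v) <= (2 + 2 * a ^+ 2 * dot v v) * (1 + dot y y).
Proof.
have := dot_ge0 (y - a *: v); have h1 := dot_ge0 y; have h2 := dot_ge0 v.
have := mulr_ge0 (mulr_ge0 (sqr_ge0 a) h2) h1.
rewrite !dotDl !dotDr !dotNl !dotNr !dotZl !dotZr (dotC v).
move: (dot v v) (dot y y) (dot y v) h1 h2 => b c e *; nra.
Qed.

Lemma coord_mul_le n (y : 'rV[R]_n) i j : `|y 0 i * y 0 j| <= dot y y.
Proof.
have h k : y 0 k ^+ 2 <= dot y y.
  by rewrite /dot (bigD1 k)//= -expr2 lerDl sumr_ge0// => l _; rewrite -expr2 sqr_ge0.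
have := h i; have := h j.
have := sqr_ge0 (y 0 i - y 0 j); have := sqr_ge0 (y 0 i + y 0 j).
move: (y 0 i) (y 0 j) (dot y y) => a b c; rewrite ler_norml => *; apply/andP; split; nra.
Qed.

Lemma lt_family_ub (I : finType) (f : I -> R) (a : R) :
  (forall i, f i < a) -> exists2 b, b < a & forall i, f i <= b.
Proof.
move=> fa; exists (\big[Order.max/(a - 1)]_i f i).
  by apply/bigmax_ltP; split => //; rewrite ltrBlDr ltrDl.
by move=> i; exact: le_bigmax.
Qed.

End Dot.

(** * Norms adapted to a matrix *)

Section LyapunovNorm.
Context {R : realType}.
Local Notation toC := (real_complex R).

Lemma Re_sum (I : finType) (F : I -> R[i]) :
  complex.Re (\sum_i F i) = \sum_i complex.Re (F i).
Proof. by apply: (big_ind2 (fun u a => complex.Re u = a)) => // -[? ?] ? [? ?] ? <- <-. Qed.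

Lemma Im_sum (I : finType) (F : I -> R[i]) :
  complex.Im (\sum_i F i) = \sum_i complex.Im (F i).
Proof. by apply: (big_ind2 (fun u a => complex.Im u = a)) => // -[? ?] ? [? ?] ? <- <-. Qed.

(** The squared modulus, as an element of R rather than of R[i]. *)
Definition sqn (z : R[i]) := complex.Re z ^+ 2 + complex.Im z ^+ 2.

Lemma sqn_ge0 z : 0 <= sqn z.
Proof. by rewrite addr_ge0// sqr_ge0. Qed.

Lemma sqnM z w : sqn (z * w) = sqn z * sqn w.
Proof. by case: z => a b; case: w => c d; rewrite /sqn /=; ring. Qed.

Lemma sqnR (a : R) : sqn a%:C%C = a ^+ 2.
Proof. by rewrite /sqn /=; ring. Qed.

Lemma Re_mul_conj_le (eta : R) (a l b : R[i]) : 0 < eta -> sqn l <= eta ^+ 2 ->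
  2 * complex.Re (a * l * b^*%C) <= eta * (sqn a + sqn b).
Proof.
move=> eta0 hl.
have hc : sqn (a * l) <= eta ^+ 2 * sqn a.
  by rewrite sqnM mulrC ler_wpM2r// sqn_ge0.
have h : 2 * complex.Re (a * l * b^*%C) <= sqn (a * l) / eta + eta * sqn b.
  set c := a * l; rewrite -(ler_pM2l eta0) mulrDr (mulrC eta (_ / _)) mulfVK ?gt_eqF//.
  rewrite -subr_ge0.
  case: c b {hc} => c1 c2 [b1 b2]; rewrite /sqn /=.
  have -> : c1 ^+ 2 + c2 ^+ 2 + eta * (eta * (b1 ^+ 2 + b2 ^+ 2)) -
     eta * (2 * (c1 * b1 - c2 * - b2)) = (c1 - eta * b1) ^+ 2 + (c2 - eta * b2) ^+ 2.
    by ring.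
  by rewrite addr_ge0// sqr_ge0.
apply: (le_trans h); rewrite [leRHS]mulrDr lerD2r ler_pdivrMr//.
by have -> : eta * sqn a * eta = eta ^+ 2 * sqn a by ring.
Qed.

(** Conjugating a triangular form by diag (1, eps, eps^2, ...) multiplies the
    entry (i, j) by eps^(i - j), which shrinks everything below the diagonal.
    *)
Lemma small_triangularization n (M : 'M[R[i]]_n) (eta : R) : 0 < eta ->
  exists P L : 'M[R[i]]_n,
    [/\ P \in unitmx, P *m M = L *m P,
        forall j, eigenvalue M (L j j)
      & forall i j, i != j -> sqn (L i j) <= eta ^+ 2].
Proof.
case: n M => [M _|n M eta0].
  exists 1%:M, 0; split; rewrite ?unitmx1//; first by apply/matrixP => -[].
  - by case.
  - by case.
have [P Pu] := @Schur R[i] n.+1 M isT.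
have Pun := unitarymx_unit Pu.
rewrite /similar_to => trig.
set L := conjmx P M in trig.
have LP : P *m M = L *m P by rewrite /L conjumx// mulmxKV.
have eigL j : eigenvalue M (L j j).
  have : eigenvalue L (L j j).
    rewrite eigenvalue_root_char char_poly_trig// /root horner_prod.
    by apply/eqP/eqP; rewrite prodf_seq_eq0; apply/hasP; exists j;
      rewrite ?mem_index_enum// !hornerE subrr.
  by apply: eigenvalue_conjmx; rewrite ?stablemx_unit ?row_free_unit.
clearbody L.
pose S := \sum_i \sum_j sqn (L i j).
have S0 : 0 <= S by do 2!(apply: sumr_ge0 => ? _); exact: sqn_ge0.
have LS i j : sqn (L i j) <= S.
  rewrite /S (bigD1 i)//= (bigD1 j)//= -addrA lerDl addr_ge0 ?sumr_ge0// => *.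
    exact: sqn_ge0.
  by apply: sumr_ge0 => ? _; exact: sqn_ge0.
pose eps := eta / (eta + S + 1).
have den0 : 0 < eta + S + 1 by lra.
have eps0 : 0 < eps by rewrite divr_gt0.
have eps1 : eps <= 1 by rewrite ler_pdivrMr// mul1r; lra.
have epsS : eps ^+ 2 * S <= eta ^+ 2.
  rewrite /eps expr_div_n mulrAC ler_pdivrMr ?exprn_gt0//.
  rewrite ler_wpM2l ?sqr_ge0// expr2.
  apply: (@le_trans _ _ (1 * (eta + S + 1))); first by lra.
  by rewrite ler_wpM2r; lra.
pose d : 'rV[R[i]]_n.+1 := \row_i ((eps ^+ i)%:C)%C.
have epsn0 i : ((eps ^+ i)%:C)%C != 0 :> R[i].
  by rewrite -(rmorph0 toC) (inj_eq (@complexI _)) expf_neq0// gt_eqF.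
pose d' : 'rV[R[i]]_n.+1 := \row_i ((eps ^+ i)%:C)%C^-1.
have d'd : diag_mx d' *m diag_mx d = 1%:M.
  rewrite mulmx_diag; apply/matrixP => i j; rewrite !mxE.
  by case: eqP => //= _; rewrite mulVf.
have du : diag_mx d \in unitmx by apply: (mulmx1_unit d'd).2.
exists (diag_mx d *m P), (diag_mx d *m L *m diag_mx d'); split.
- by rewrite unitmx_mul du.
- by rewrite -mulmxA LP !mulmxA -(mulmxA _ (diag_mx d')) d'd mulmx1.
- move=> j; suff -> : (diag_mx d *m L *m diag_mx d') j j = L j j by [].
  by rewrite mul_diag_mx mul_mx_diag !mxE mulrAC divff ?mul1r.
- move=> i j ij; rewrite mul_diag_mx mul_mx_diag !mxE.
  case: (ltngtP i j) => [ltij|ltji|/val_inj eij].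
  + rewrite (is_trig_mxP trig)// mulr0 mul0r /sqn /=.
    by rewrite expr0n /= addr0 sqr_ge0.
  + rewrite mulrAC -[X in X * L i j]/(toC _ / toC _) -fmorphV -rmorphM/=.
    rewrite sqnM sqnR -exprB ?unitfE ?gt_eqF// 1?ltnW//.
    apply: le_trans epsS; rewrite ler_pM ?sqr_ge0 ?sqn_ge0//.
    rewrite lerXn2r ?nnegrE ?exprn_ge0 ?(ltW eps0)//.
    by rewrite -[leRHS]expr1 ler_wiXn2l ?subn_gt0// ltW.
  + by rewrite eij eqxx in ij.
Qed.

(** When all the eigenvalues of M have real part less than a, the flow of M
    grows slower than exp (a t) in a suitable Euclidean norm |x Q|. Q
    consists of the real and imaginary parts of a basis in which M is nearly
    diagonal; the right inverse Q' says that |x Q| is a norm. *)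
Lemma lyapunov_norm n (M : 'M[R]_n) (a : R) :
  (forall z, eigenvalue (map_mx toC M) z -> complex.Re z < a) ->
  exists k (Q : 'M[R]_(n, k)) (Q' : 'M[R]_(k, n)) (b : R),
    [/\ b < a, Q *m Q' = 1%:M &
    forall x : 'rV[R]_n,
      dot (x *m M *m Q) (x *m Q) <= b * dot (x *m Q) (x *m Q)].
Proof.
move=> eig.
case: n M eig => [M eig|n M eig].
  exists 0%N, 0, 0, (a - 1); split; first by lra.
    by apply/matrixP => -[].
  by move=> x; rewrite !mulmx0 dot0l mulr0.
have [b0 b0a eigb0] : exists2 b, b < a &
    forall z, eigenvalue (map_mx toC M) z -> complex.Re z <= b.
  have [rs Ers] := closed_field_poly_normal (char_poly (map_mx toC M)).
  pose f (i : 'I_(size rs)) :=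
    if eigenvalue (map_mx toC M) rs`_i then complex.Re rs`_i else a - 1.
  have fa i : f i < a by rewrite /f; case: ifP => [/eig//|_]; lra.
  have [b ba hb] := lt_family_ub fa.
  exists b => // z zeig; have := zeig; rewrite eigenvalue_root_char Ers.
  rewrite rootZ; last first.
    by rewrite lead_coef_eq0 monic_neq0// char_poly_monic.
  rewrite root_prod_XsubC => /(nthP 0)[k krs kz].
  by have := hb (Ordinal krs); rewrite /f /= kz zeig.
pose eta := (a - b0) / (2 * n.+1%:R).
have n0 : 0 < n.+1%:R :> R by rewrite ltr0n.
have eta0 : 0 < eta by rewrite divr_gt0 ?mulr_gt0// subr_gt0.
have [P [L [Pu PM Leig Lsmall]]] := small_triangularization (map_mx toC M) eta0.
pose U := invmx P.
have MU : map_mx toC M *m U = U *m L.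
  rewrite -[LHS](mulKmx Pu) -/U; congr (_ *m _).
  by rewrite mulmxA PM -mulmxA mulmxV// mulmx1.
pose Q := row_mx (map_mx (@complex.Re R) U) (map_mx (@complex.Im R) U).
pose Q' := col_mx (map_mx (@complex.Re R) P) (- map_mx (@complex.Im R) P).
exists (n.+1 + n.+1)%N, Q, Q', ((a + b0) / 2); split; first by lra.
  rewrite mul_row_col; apply/matrixP => i j; rewrite !mxE -big_split/=.
  have := congr1 (fun X : 'M[R[i]]_n.+1 => complex.Re (X i j)) (mulVmx Pu).
  rewrite -/U !mxE Re_sum => h.
  rewrite -[RHS]/(complex.Re ((i == j)%:R +i* 0)%C).
  have -> : ((i == j)%:R +i* 0)%C = (i == j)%:R :> R[i].
    by case: (i == j).
  rewrite -h; apply: eq_bigr => k _; rewrite !mxE.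
  by case: (U i k) => ? ?; case: (P k j) => ? ? /=; rewrite mulrN.
move=> x; pose xC := map_mx toC x; pose y := xC *m U.
have ReIm (v : 'rV[R]_n.+1) : v *m Q =
    row_mx (map_mx (@complex.Re R) (map_mx toC v *m U))
           (map_mx (@complex.Im R) (map_mx toC v *m U)).
  rewrite mul_mx_row; congr row_mx; apply/rowP => j; rewrite !mxE ?Re_sum ?Im_sum;
    apply: eq_bigr => k _; rewrite !mxE; case: (U k j) => ? ? /=; ring.
have dotQ (u v : 'rV[R]_n.+1) : dot (u *m Q) (v *m Q) =
    \sum_j complex.Re ((map_mx toC u *m U) 0 j * ((map_mx toC v *m U) 0 j)^*%C).
  rewrite !ReIm dotE tr_row_mx mul_row_col !mxE -big_split/=.
  apply: eq_bigr => j _; rewrite !mxE.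
  by case: (\sum_(_ < _) _) => ? ?; case: (\sum_(_ < _) _) => ? ? /=; rewrite mulrN opprK.
rewrite !dotQ -/xC -/y.
have -> : map_mx toC (x *m M) *m U = y *m L.
  by rewrite map_mxM -mulmxA MU mulmxA.
have -> : \sum_j complex.Re (y 0 j * (y 0 j)^*%C) = \sum_j sqn (y 0 j).
  by apply: eq_bigr => j _; case: (y 0 j) => ? ?; rewrite /sqn /=; ring.
set S := \sum_j sqn (y 0 j).
have S0 : 0 <= S by apply: sumr_ge0 => ? _; exact: sqn_ge0.
have term i j : complex.Re (y 0 i * L i j * (y 0 j)^*%C) <=
    (if i == j then b0 * sqn (y 0 j) else 0)
    + eta / 2 * (sqn (y 0 i) + sqn (y 0 j)).
  have [->|ij] := eqVneq i j.
    apply: (@le_trans _ _ (b0 * sqn (y 0 j))).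
      have -> : complex.Re (y 0 j * L j j * (y 0 j)^*%C) =
                complex.Re (L j j) * sqn (y 0 j).
        by case: (y 0 j) => ? ?; case: (L j j) => ? ?; rewrite /sqn /=; ring.
      by rewrite ler_wpM2r ?sqn_ge0// eigb0.
    rewrite lerDl; apply: mulr_ge0; first by rewrite divr_ge0 ?(ltW eta0).
    by apply: addr_ge0; exact: sqn_ge0.
  have := Re_mul_conj_le (y 0 i) (y 0 j) eta0 (Lsmall _ _ ij).
  by rewrite add0r; move: (complex.Re _) (sqn _ + _) => u v; lra.
apply: (@le_trans _ _ (\sum_j \sum_i
    ((if i == j then b0 * sqn (y 0 j) else 0)
    + eta / 2 * (sqn (y 0 i) + sqn (y 0 j))))).
  apply: ler_sum => j _; rewrite mxE mulr_suml Re_sum.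
  by apply: ler_sum => i _; exact: term.
have -> : \sum_j \sum_i
    ((if i == j then b0 * sqn (y 0 j) else 0)
    + eta / 2 * (sqn (y 0 i) + sqn (y 0 j))) = b0 * S + eta / 2 * (n.+1%:R * S *+ 2).
  under eq_bigr do rewrite big_split/= -big_mkcond/= big_pred1_eq -mulr_sumr.
  rewrite big_split/= -mulr_sumr -/S; congr (_ + _).
  rewrite -mulr_sumr; congr (_ * _).
  under eq_bigr do rewrite big_split/= -/S sumr_const card_ord.
  by rewrite big_split/= sumr_const card_ord sumrMnl -/S -mulr2n mulr_natl.
have -> : eta / 2 * (n.+1%:R * S *+ 2) = (a - b0) / 2 * S.
  by rewrite /eta; field; rewrite gt_eqF.
by lra.
Qed.

End LyapunovNorm.

(** * Lyapunov equations and positive semidefinite forms *)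

Section QuadraticForms.
Context {R : realType}.

Lemma form_bound n (G : 'M[R]_n) : exists2 K : R, 0 <= K &
  forall y : 'rV[R]_n, `|dot (y *m G) y| <= K * dot y y.
Proof.
exists (\sum_j \sum_i `|G i j|) => [|y]; first by do 2!apply: sumr_ge0 => ? _.
rewrite /dot (le_trans (ler_norm_sum _ _ _))// mulr_suml.
apply: ler_sum => j _; rewrite mxE mulr_suml (le_trans (ler_norm_sum _ _ _))//.
rewrite mulr_suml; apply: ler_sum => i _.
by rewrite mulrAC normrM mulrC ler_wpM2l// coord_mul_le.
Qed.

Lemma form_sym n (S : 'M[R]_n) (x y : 'rV[R]_n) : S^T = S ->
  dot (x *m S) y = dot (y *m S) x.
Proof. by move=> Ss; rewrite dot_mulmx Ss dotC. Qed.

Lemma form_delta n (S : 'M[R]_n) i j :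
  dot (delta_mx 0 i *m S) (delta_mx 0 j) = S i j.
Proof. by rewrite dotC dot_delta -rowE mxE. Qed.

Lemma form_eq0 n (S : 'M[R]_n) : S^T = S ->
  (forall t : 'rV[R]_n, dot (t *m S) t = 0) -> S = 0.
Proof.
move=> Ss h; apply/matrixP => i j.
have := h (delta_mx 0 i + delta_mx 0 j).
rewrite mulmxDl !dotDl !dotDr !h (form_sym (delta_mx 0 j) _ Ss) !form_delta mxE.
by move=> ?; lra.
Qed.

Lemma mx_double_inj n (X Y : 'M[R]_n) : X + X = Y + Y -> X = Y.
Proof.
move=> h; apply/matrixP => i j.
by have := congr1 (fun Z : 'M[R]_n => Z i j) h; rewrite !mxE => ?; lra.
Qed.

Definition psd n (S : 'M[R]_n) := forall t : 'rV[R]_n, 0 <= dot (t *m S) t.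

(** Along the contracting flow t' = t N the form decreases, and it tends to
    0, so that it cannot start negative. The discrete version: let nu be the
    least constant with t S t^T >= - nu |t Q|^2; a short Euler step of the
    flow would improve nu if it were positive. *)
Lemma psd_of_lyapunov n k (N S : 'M[R]_n) (Q : 'M[R]_(n, k)) (Q' : 'M[R]_(k, n)) (b : R) :
  b < 0 -> Q *m Q' = 1%:M ->
  (forall x : 'rV[R]_n, dot (x *m N *m Q) (x *m Q) <= b * dot (x *m Q) (x *m Q)) ->
  (forall t : 'rV[R]_n, dot (t *m (N *m S + S *m N^T)) t <= 0) ->
  psd S.
Proof.
move=> b0 QQ' stab decr.
pose q (x : 'rV[R]_n) := dot (x *m Q) (x *m Q).
have q0 x : 0 <= q x by exact: dot_ge0.
have xQ x : x *m Q *m Q' = x by rewrite -mulmxA QQ' mulmx1.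
have [K K0 hK] : exists2 K : R, 0 <= K & forall x, `|dot (x *m S) x| <= K * q x.
  have [K K0 hK] := form_bound (Q' *m S *m Q'^T).
  exists K => // x; have := hK (x *m Q).
  by rewrite !mulmxA xQ dot_mulmx trmxK xQ.
have [C C0 hC] : exists2 C : R, 0 <= C & forall x, q (x *m N) <= C * q x.
  have [C C0 hC] := form_bound ((Q' *m N *m Q) *m (Q' *m N *m Q)^T).
  exists C => // x; have := hC (x *m Q).
  rewrite mulmxA dot_mulmx trmxK !mulmxA xQ => /(le_trans _); apply.
  exact: ler_norm.
pose nus := [set nu | 0 <= nu /\ forall x, - (nu * q x) <= dot (x *m S) x].
have nusK : nus K.
  by split=> // x; rewrite lerNl (le_trans _ (hK x))// -normrN ler_norm.
have nus_inf : has_inf nus by split; [exists K|exists 0 => x []].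
pose nu := inf nus.
have nu0 : 0 <= nu by apply: lb_le_inf; [exists K|move=> x []].
have nuP x : - (nu * q x) <= dot (x *m S) x.
  apply/ler_addgt0Pl => e e0.
  have q1 : 0 < q x + 1 by rewrite ltr_wpDl.
  have [e' [e'0 he'] e'nu] := inf_adherent (divr_gt0 e0 q1) nus_inf.
  have h1 : e' * q x <= (nu + e / (q x + 1)) * q x by rewrite ler_wpM2r// ltW.
  have h2 : e / (q x + 1) * q x <= e.
    by rewrite mulrAC ler_pdivrMr// ler_wpM2l ?lerDl ?ltW.
  have := he' x; rewrite mulrDl in h1; lra.
have step h : 0 < h -> 0 <= 1 + 2 * h * b ->
    nu <= nu * (1 + 2 * h * b + h ^+ 2 * C) + h ^+ 2 * (K * C).
  move=> h0 hb; apply: ge_inf; first by exists 0 => x [].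
  have hC0 : 0 <= h ^+ 2 * C by rewrite mulr_ge0// sqr_ge0.
  have hKC0 : 0 <= h ^+ 2 * (K * C) by rewrite mulr_ge0 ?sqr_ge0// mulr_ge0.
  split=> [|t]; first by rewrite addr_ge0// mulr_ge0// addr_ge0.
  pose t' := t + h *: (t *m N).
  have ft' : dot (t' *m S) t' = dot (t *m S) t
      + h * dot (t *m (N *m S + S *m N^T)) t
      + h ^+ 2 * dot (t *m N *m S) (t *m N).
    rewrite /t' mulmxDr !mulmxDl !dotDl !dotDr -!scalemxAl !dotZl !dotZr !mulmxA.
    by rewrite [dot (t *m S *m N^T) t]dot_mulmx trmxK; ring.
  have qt' : q t' <= q t * (1 + 2 * h * b + h ^+ 2 * C).
    rewrite {1}/q /t' !mulmxDl !dotDl !dotDr -!scalemxAl !dotZl !dotZr.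
    rewrite (dotC (t *m Q)) -/(q t) -/(q (t *m N)).
    have h1 := stab t; have h2 := hC t.
    rewrite -/(q t) in h1.
    have : h * dot (t *m N *m Q) (t *m Q) <= h * (b * q t) by rewrite ler_pM2l.
    have : h ^+ 2 * q (t *m N) <= h ^+ 2 * (C * q t) by rewrite ler_wpM2l// sqr_ge0.
    rewrite expr2; move: (q t) (q _) (dot _ _) => *; nra.
  have h1 := nuP t'; rewrite ft' in h1.
  have h2 : nu * q t' <= nu * (q t * (1 + 2 * h * b + h ^+ 2 * C)) by rewrite ler_wpM2l.
  have h3 : h * dot (t *m (N *m S + S *m N^T)) t <= 0 by rewrite pmulr_rle0.
  have h4 : h ^+ 2 * dot (t *m N *m S) (t *m N) <= h ^+ 2 * (K * (C * q t)).
    rewrite ler_wpM2l ?sqr_ge0// (le_trans (ler_norm _))// (le_trans (hK _))//.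
    by rewrite ler_wpM2l.
  move: h1 h2 h3 h4; move: (q t) (q t') (dot _ _) (dot _ _) (dot _ _) => *; nra.
have nu_le0 : nu <= 0.
  rewrite leNgt; apply/negP => nu_gt0.
  (* the step must beat the quadratic errors C and K C of one Euler step *)
  pose h := Num.min (- b / (C + 1)) (Num.min (1 / (- 2 * b)) (nu * - b / (2 * (K * C + 1)))).
  have C1 : 0 < C + 1 by lra.
  have KC0 : 0 <= K * C by rewrite mulr_ge0.
  have KC1 : 0 < 2 * (K * C + 1) by lra.
  have h0 : 0 < h.
    rewrite /h !lt_min !divr_gt0//=; [|lra|lra].
    by rewrite mulr_gt0//; lra.
  have hC1 : h * (C + 1) <= - b by rewrite -ler_pdivlMr// /h ge_min lexx.
  have hb1 : h * (- 2 * b) <= 1.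
    by rewrite -ler_pdivlMr ?/h ?ge_min ?lexx ?orbT//; lra.
  have hKC1 : h * (2 * (K * C + 1)) <= nu * - b.
    by rewrite -ler_pdivlMr// /h !ge_min lexx !orbT.
  have hb0 : 0 <= 1 + 2 * h * b by lra.
  have hs := step h h0 hb0.
  have : nu * (- 2 * b - h * C) <= h * (K * C).
    rewrite -(ler_pM2l h0); move: hs; rewrite expr2; lra.
  have : nu * (- b) <= nu * (- 2 * b - h * C) by rewrite ler_pM2l//; lra.
  have : 0 < nu * (- b) by rewrite mulr_gt0//; lra.
  by lra.
move=> t; apply: le_trans (nuP t).
by rewrite oppr_ge0 mulr_le0_ge0.
Qed.

(** The operator S |-> N S + S N^T is injective on symmetric matrices by
    [psd_of_lyapunov] applied to S and - S, hence surjective onto them. *)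
Lemma lyapunov_solve n k (N B : 'M[R]_n) (Q : 'M[R]_(n, k)) (Q' : 'M[R]_(k, n)) (b : R) :
  b < 0 -> Q *m Q' = 1%:M ->
  (forall x : 'rV[R]_n, dot (x *m N *m Q) (x *m Q) <= b * dot (x *m Q) (x *m Q)) ->
  B^T = B -> psd B ->
  exists S : 'M[R]_n, [/\ S^T = S, N *m S + S *m N^T = - B & psd S].
Proof.
move=> b0 QQ' stab Bs Bpsd.
have uniq0 T : T^T = T -> N *m T + T *m N^T = 0 -> T = 0.
  move=> Ts NT; apply: form_eq0 => // t; apply/eqP; rewrite eq_le; apply/andP; split.
    rewrite -oppr_ge0 -dotNl -mulmxN.
    apply: (psd_of_lyapunov b0 QQ' stab) => u.
    by rewrite mulmxN mulNmx -opprD NT oppr0 mulmx0 dot0l.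
  by apply: (psd_of_lyapunov b0 QQ' stab) => u; rewrite NT mulmx0 dot0l.
pose Phi (S : 'M[R]_n) := N *m (S + S^T) + (S + S^T) *m N^T + (S - S^T).
have Phi_lin : linear Phi.
  move=> a U V; rewrite /Phi [(a *: U + V)^T]linearP/=.
  have -> : a *: U + V + (a *: U^T + V^T) = a *: (U + U^T) + (V + V^T).
    by rewrite scalerDr addrACA.
  rewrite mulmxDr mulmxDl -scalemxAr -scalemxAl.
  rewrite !scalerDr !scalerN; apply/matrixP => i j; rewrite !mxE; ring.
pose PhiL : {linear 'M[R]_n -> 'M[R]_n} :=
  HB.pack Phi (GRing.isLinear.Build _ _ _ _ Phi Phi_lin).
have PhiL_inj S : Phi S = 0 -> S = 0.
  move=> h; have := congr1 trmx h.
  rewrite /Phi !linearD/= !trmx_mul !linearD/= linearN/= !trmxK trmx0 (addrC S^T) => hT.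
  have h2 : N *m (S + S^T) + (S + S^T) *m N^T = 0.
    apply: mx_double_inj; rewrite -[RHS](congr2 +%R h hT) /Phi !mulmxDr !mulmxDl.
    move: (N *m S) (N *m S^T) (S *m N^T) (S^T *m N^T) => X1 X2 X3 X4.
    by apply/matrixP => i j; rewrite !mxE; ring.
  have h3 : S + S^T = 0 by apply: uniq0 => //; rewrite linearD/= trmxK addrC.
  move: h; rewrite /Phi h2 add0r => h4.
  apply: mx_double_inj; rewrite -[RHS](congr2 +%R h3 h4).
  by apply/matrixP => i j; rewrite !mxE; ring.
have Lu : lin_mx PhiL \in unitmx.
  rewrite -row_free_unit; apply: inj_row_free => v hv.
  rewrite -(vec_mxK v) in hv *; rewrite mul_vec_lin in hv.
  have /PhiL_inj -> : Phi (vec_mx v) = 0 by apply: (can_inj mxvecK); rewrite hv linear0.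
  by rewrite linear0.
have [S PhiS] : exists S, Phi S = - B.
  exists (vec_mx (mxvec (- B) *m invmx (lin_mx PhiL))).
  by apply: (can_inj mxvecK); rewrite -(mul_vec_lin PhiL) vec_mxK mulmxKV.
have T : N *m (S + S^T) + (S + S^T) *m N^T = - B.
  have := congr1 trmx PhiS.
  rewrite /Phi !linearD/= !trmx_mul !linearD/= linearN/= !trmxK linearN/= Bs (addrC S^T) => hT.
  apply: mx_double_inj; rewrite -[RHS](congr2 +%R PhiS hT) /Phi !mulmxDr !mulmxDl.
  move: (N *m S) (N *m S^T) (S *m N^T) (S^T *m N^T) => X1 X2 X3 X4.
  by apply/matrixP => i j; rewrite !mxE; ring.
exists (S + S^T); split => //; first by rewrite linearD/= trmxK addrC.
apply: (psd_of_lyapunov b0 QQ' stab) => t.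
by rewrite T mulmxN dotNl oppr_le0.
Qed.

(** Symmetric Gaussian elimination: removing the rank one part of a row with
    nonzero diagonal entry keeps the form positive and creates a new zero on
    the diagonal. A positive form with zero diagonal vanishes. *)
Lemma psd_factor n (S : 'M[R]_n) : S^T = S -> psd S ->
  exists qs : seq 'rV[R]_n, S = \sum_(q <- qs) q^T *m q.
Proof.
have [k] := ubnP #|[pred i | S i i != 0]|; elim: k S => // k IH S Sk Ss Sp.
have [[i Sii]|h] := pselect (exists i, S i i != 0); last first.
  exists [::]; rewrite big_nil; apply: form_eq0 => // t.
  have d0 i : S i i = 0 by apply/eqP; apply: contrapT => /negP hi; apply: h; exists i.
  suff -> : S = 0 by rewrite mulmx0 dot0l.
  apply/matrixP => i j; rewrite mxE.
  have := Sp (delta_mx 0 i + delta_mx 0 j).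
  have := Sp (delta_mx 0 i - delta_mx 0 j).
  rewrite mulmxBl mulmxDl !dotDl !dotDr !dotNl !dotNr.
  rewrite (form_sym (delta_mx 0 j) (delta_mx 0 i) Ss) !form_delta !d0 => *; lra.
have Sii0 : 0 < S i i.
  by rewrite lt_neqAle eq_sym Sii/= -form_delta Sp.
pose r := row i S.
pose S' := S - (S i i)^-1 *: (r^T *m r).
have S's : S'^T = S' by rewrite linearB/= linearZ/= trmx_mul trmxK Ss.
have rt (t : 'rV[R]_n) : dot (t *m S) (delta_mx 0 i) = dot r t.
  by rewrite (form_sym _ _ Ss) -rowE.
have fS' (t : 'rV[R]_n) : dot (t *m S') t = dot (t *m S) t - (S i i)^-1 * dot r t ^+ 2.
  rewrite /S' mulmxBr dotDl dotNl -scalemxAr dotZl mulmxA; congr (_ - _ * _).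
  by rewrite dot_mulmx /dot big_ord1 -expr2 -!dotE dotC.
have S'p : psd S'.
  move=> t; rewrite fS'; set c := (S i i)^-1 * dot r t.
  have := Sp (t - c *: delta_mx 0 i).
  rewrite mulmxBl !dotDl !dotDr -scalemxAl !dotNl !dotNr !dotZl !dotZr rt.
  rewrite form_delta -rowE -/r.
  have -> : (S i i)^-1 * dot r t ^+ 2 = c * dot r t by rewrite /c expr2 mulrA.
  have cS : c * (c * S i i) = c * dot r t.
    by congr (_ * _); rewrite /c mulrAC mulVf// mul1r.
  by lra.
have S'd j : S' j j = S j j - (S i i)^-1 * S i j ^+ 2.
  by rewrite !mxE big_ord1 !mxE expr2.
have [|//|//|qs qsE] := IH S'.
  rewrite -ltnS; apply: leq_trans Sk; apply: proper_card; apply/properP; split.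
    apply/fintype.subsetP => j; rewrite !inE; apply: contraNN => /eqP Sjj.
    rewrite eq_le -{2}(form_delta S') S'p andbT S'd Sjj sub0r oppr_le0.
    by rewrite mulr_ge0 ?sqr_ge0// invr_ge0 ltW.
  exists i; first by rewrite inE.
  by rewrite inE /= negbK S'd expr2 mulrA mulVf// mul1r subrr.
exists ((Num.sqrt (S i i))^-1 *: r :: qs); rewrite big_cons -qsE.
rewrite [(_ *: r)^T]linearZ/= -scalemxAl -scalemxAr scalerA -expr2 exprVn sqr_sqrtr ?ltW//.
by rewrite /S' addrC subrK.
Qed.

End QuadraticForms.

(** * The spectrum of the deflated replacement matrix *)

Section Deflation.
Context {R : realType}.
Local Notation toC := (real_complex R).

Definition deflated n (A : 'M[R]_n) (m : R) (v : 'rV[R]_n) : 'M[R]_n :=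
  A - m *: (const_mx 1 *m v).

Lemma deflated_row n (A : 'M[R]_n) m v k :
  row k (deflated A m v) = row k A - m *: v.
Proof. by apply/rowP => j; rewrite !mxE big_ord1 !mxE mul1r. Qed.

Variables (n : nat) (A : 'M[R]_n) (m : R) (v : 'rV[R]_n).
Hypotheses (A_bal : balanced A m) (vA : v *m A = m *: v) (v1 : \sum_i v 0 i = 1).

Let u : 'cV[R]_n := const_mx 1.

Let Au : A *m u = m *: u.
Proof.
apply/colP => i; rewrite !mxE mulr1 -[RHS](A_bal i).
by apply: eq_bigr => j _; rewrite mxE mulr1.
Qed.

Let vu : v *m u = 1%:M.
Proof.
apply/matrixP => i j; rewrite !ord1 !mxE -v1.
by apply: eq_bigr => k _; rewrite mxE mulr1.
Qed.

Lemma deflated_ones : deflated A m v *m u = 0.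
Proof. by rewrite mulmxBl Au -scalemxAl -mulmxA vu mulmx1 subrr. Qed.

Lemma mul_deflated : v *m deflated A m v = 0.
Proof. by rewrite mulmxBr vA -scalemxAr mulmxA vu mul1mx subrr. Qed.

(** With E = m u v, the products (X - D)(X - E) and X (X - A) agree because D
    E = 0 and A = D + E. *)
Lemma char_poly_deflated :
  char_poly (deflated A m v) * char_poly (m *: (u *m v)) = 'X^n * char_poly A.
Proof.
rewrite /char_poly -det_mulmx /char_poly_mx.
rewrite -(det_scalar n) -det_mulmx; congr (\det _).
set D := deflated A m v; set E := m *: (u *m v).
have AE : A = D + E by rewrite /D /deflated subrK.
have DE : D *m E = 0 by rewrite /E -scalemxAr mulmxA deflated_ones mul0mx scaler0.
rewrite mulmxBl !mulmxBr -map_mxM/= DE map_mx0 subr0.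
have -> : map_mx polyC A = map_mx polyC D + map_mx polyC E by rewrite -map_mxD -AE.
rewrite mulmxDr opprD addrA [in RHS]addrAC; congr (_ - _).
exact: scalar_mxC.
Qed.

Hypotheses (m0 : 0 < m) (A_small : strictly_small A m).

(** E = m u v has eigenvalue m as well, so m would be a double root of X^n
    times the characteristic polynomial of A. *)
Let m_not_eig : ~~ root (char_poly (deflated A m v)) m.
Proof.
apply/negP => rD.
have rE : root (char_poly (m *: (u *m v))) m.
  rewrite -eigenvalue_root_char; apply/eigenvalueP; exists v.
    by rewrite -scalemxAr mulmxA vu mul1mx.
  apply/eqP => v0; have := v1; rewrite v0 big1 => [|i _]; last by rewrite mxE.
    by move=> /esym/eqP; rewrite oner_eq0.
have cn (B : 'M[R]_n) : char_poly B != 0 by rewrite monic_neq0// char_poly_monic.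
have := congr1 (mup m) char_poly_deflated.
rewrite mupM// mupMr; last by rewrite /root hornerXn expf_neq0// gt_eqF.
rewrite (proj1 A_small) => h.
have := XsubC_dvd m (cn (deflated A m v)); rewrite -root_factor_theorem ?dvdp_XsubCl rD.
have := XsubC_dvd m (cn (m *: (u *m v))); rewrite ?dvdp_XsubCl rE.
by move: h; case: mup => [|?]//; case: mup => [|?]//; rewrite addnS addSn.
Qed.

(** A left eigenvector x of the deflated matrix with nonzero eigenvalue
    satisfies x u = 0, hence is an eigenvector of A. *)
Lemma deflated_eigenvalue z :
  eigenvalue (map_mx toC (deflated A m v)) z -> complex.Re z < m / 2.
Proof.
move=> ez; have [->|z0] := eqVneq z 0; first by rewrite /= divr_gt0.
have zm : z != (m%:C)%C.
  apply: contra m_not_eig => /eqP zE.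
  by move: ez; rewrite eigenvalue_root_char -map_char_poly zE fmorph_root.
apply: (proj2 A_small z _ zm).
have [x xD x0] := eigenvalueP ez.
have xu : x *m map_mx toC u = 0.
  have : z *: (x *m map_mx toC u) = 0.
    by rewrite scalemxAl -xD -mulmxA -map_mxM deflated_ones map_mx0 mulmx0.
  by move/eqP; rewrite scaler_eq0 (negbTE z0) /= => /eqP.
apply/eigenvalueP; exists x => //.
have -> : A = deflated A m v + m *: (u *m v) by rewrite /deflated subrK.
by rewrite map_mxD mulmxDr xD map_mxZ map_mxM -scalemxAr mulmxA xu mul0mx scaler0 addr0.
Qed.

Lemma deflated_tr_eigenvalue z :
  eigenvalue (map_mx toC (deflated A m v)^T) z -> complex.Re z < m / 2.
Proof.
move=> ez; apply: deflated_eigenvalue; move: ez.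
rewrite !eigenvalue_root_char; suff -> : char_poly (map_mx toC (deflated A m v)^T) =
  char_poly (map_mx toC (deflated A m v)) by [].
by rewrite /char_poly -det_tr; congr (\det _);
  rewrite /char_poly_mx linearB/= tr_scalar_mx -!map_trmx trmxK.
Qed.

End Deflation.

(** * Taylor bounds for sine and cosine *)

Section TrigInequalities.
Context {R : realType}.
Implicit Types a b x y : R.

Lemma cvg_of_dist_le (u b : nat -> R) (l : R) : (forall n, `|u n - l| <= b n) ->
  b n @[n --> \oo] --> (0 : R) -> u n @[n --> \oo] --> l.
Proof.
move=> ub b0; apply/cvgrPdist_le => e e0; near=> n.
rewrite distrC (le_trans (ub n))// (le_trans (ler_norm _))//.
by near: n; move/cvgr0Pnorm_le : b0; exact.
Unshelve. all: by end_near. Qed.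

(** Integrates a bound on the derivative, by the mean value theorem; each
    Taylor bound below follows from the previous one in this way. *)
Lemma le_norm_of_derive (f g : R -> R) k :
  f 0 = 0 -> (forall x, is_derive x 1 f (g x)) -> (forall x, `|g x| <= `|x| ^+ k) ->
  forall x, `|f x| <= `|x| ^+ k.+1.
Proof.
move=> f0 df gk x.
have cf : continuous f by move=> y; apply/differentiable_continuous/derivable1_diffP; case: (df y).
have key c : `|c| <= `|x| -> `|f x| = `|g c * x| -> `|f x| <= `|x| ^+ k.+1.
  move=> cx ->; rewrite normrM exprSr ler_wpM2r//.
  by rewrite (le_trans (gk c))// lerXn2r ?nnegrE.
have [x0|x0|x0] := ltgtP 0 x; last by rewrite -x0 f0 normr0 exprS mul0r.
- have [c cI] := MVT x0 (fun y _ => df y) (continuous_subspaceT cf).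
  rewrite f0 !subr0 => fE; apply: (key c); last by rewrite fE.
  by move: cI; rewrite in_itv/= => /andP[? ?]; rewrite !gtr0_norm// ltW.
- have [c cI] := MVT x0 (fun y _ => df y) (continuous_subspaceT cf).
  rewrite f0 !sub0r => fE; apply: (key c); last by rewrite -normrN fE mulrN normrN.
  by move: cI; rewrite in_itv/= => /andP[? ?]; rewrite !ltr0_norm// lerN2 ltW.
Qed.

Lemma is_derive_cos_shift a x : is_derive x 1 (fun b => cos (a + b)) (- sin (a + x)).
Proof.
have h : is_derive x 1 (fun b : R => a + b) 1.
  by rewrite -[X in is_derive _ _ _ X]add0r; apply: is_deriveD.
have := @is_derive1_comp _ (@cos R) (fun b => a + b) x _ _ _ h.
by move=> /(_ _ (is_derive_cos _)); rewrite mulr1.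
Qed.

Lemma cos_taylor1 a b : `|cos (a + b) - cos a| <= `|b|.
Proof.
rewrite -[leRHS]expr1; move: b; apply: (@le_norm_of_derive _ (fun b => - sin (a + b))).
- by rewrite addr0 subrr.
- move=> x; rewrite -[X in is_derive _ _ _ X]subr0.
  by apply: is_deriveB; exact: is_derive_cos_shift.
- by move=> x; rewrite normrN expr0 sin_max.
Qed.

Lemma sin_taylor1 a b : `|sin (a + b) - sin a| <= `|b|.
Proof. by rewrite -!cosBpihalf addrAC cos_taylor1. Qed.

Lemma cos_taylor2 a b : `|cos (a + b) - cos a + b * sin a| <= `|b| ^+ 2.
Proof.
move: b; apply: (@le_norm_of_derive _ (fun b => - sin (a + b) + sin a)).
- by rewrite addr0 subrr mul0r addr0.
- move=> x; rewrite -{1}[- sin (a + x)]subr0.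
  apply: is_deriveD; first by apply: is_deriveB; exact: is_derive_cos_shift.
  rewrite -[X in is_derive _ _ _ X](_ : x *: (0 : R) + sin a *: (1 : R) = _).
    by apply: is_deriveM.
  by rewrite scaler0 add0r /GRing.scale/= mulr1.
- move=> x; rewrite expr1 addrC -normrN opprB; exact: sin_taylor1.
Qed.

Lemma sin_taylor2 a b : `|sin (a + b) - sin a - b * cos a| <= `|b| ^+ 2.
Proof. by have := cos_taylor2 (a - pi / 2) b; rewrite (addrAC a) !cosBpihalf sinBpihalf mulrN. Qed.

Lemma cos_taylor3 a b :
  `|cos (a + b) - cos a + b * sin a + b ^+ 2 / 2 * cos a| <= `|b| ^+ 3.
Proof.
move: b; apply: (@le_norm_of_derive _ (fun b => - (sin (a + b) - sin a - b * cos a))).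
- by rewrite addr0 subrr mul0r addr0 add0r expr0n/= !mul0r.
- move=> x; have -> : - (sin (a + x) - sin a - x * cos a) =
     (- sin (a + x) + sin a) + x * cos a by ring.
  apply: is_deriveD.
    rewrite -{1}[- sin (a + x)]subr0.
    apply: is_deriveD; first by apply: is_deriveB; exact: is_derive_cos_shift.
    rewrite -[X in is_derive _ _ _ X](_ : x *: (0 : R) + sin a *: (1 : R) = _).
      by apply: is_deriveM.
    by rewrite scaler0 add0r /GRing.scale/= mulr1.
  have -> : (fun b : R => b ^+ 2 / 2 * cos a) = (fun b => b * (b * (cos a / 2))).
    by apply/funext => b; field.
  rewrite -[X in is_derive _ _ _ X](_ :
      x *: (x *: (0 : R) + (cos a / 2) *: (1 : R)) + (x * (cos a / 2)) *: (1 : R) = _).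
    have h1 : is_derive x 1 (fun b => b * (cos a / 2))
      (x *: (0 : R) + (cos a / 2) *: (1 : R)) by apply: is_deriveM.
    by apply: is_deriveM.
  by rewrite /GRing.scale/=; field.
- by move=> x; rewrite normrN; exact: sin_taylor2.
Qed.

(** In sin y - sin z = 2 cos ((y + z) / 2) sin ((y - z) / 2) both half angles
    are bounded by W < pi / 2, since y stays away from the critical points of
    the sine. *)
Lemma sin_inv_lipschitz : exists2 C : R, 0 <= C &
  forall y z, `|y| <= 1 / 2 -> `|z| <= pi / 2 -> (y - z) ^+ 2 <= C * (sin y - sin z) ^+ 2.
Proof.
pose W : R := (1 / 2 + pi / 2) / 2.
have p1 := @pihalf_ge1 R; have pp := @pi_gt0 R.
have W0 : 0 < W by rewrite /W; lra.
have WP : W < pi / 2 by rewrite /W; lra.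
have c0 : 0 < cos W by apply: cos_gt0_pihalf; rewrite WP andbT; lra.
have cos_ge s : `|s| <= W -> cos W <= cos s.
  move=> sW; rewrite -(cos_norm s) leNgt ltr_cos ?in_itv/= ?normr_ge0/=; [|lra|lra].
  by rewrite -leNgt.
have sin_ge w : `|w| <= W -> cos W * `|w| <= `|sin w|.
  move=> wW; have -> : `|sin w| = `|sin `|w| |.
    by have [w0|w0] := lerP 0 w; rewrite ?(ger0_norm w0)// (ltr0_norm w0) sinN normrN.
  have [c cI] := @MVT_segment _ (@sin R) (@cos R) 0 `|w| (normr_ge0 _)
     (fun y _ => is_derive_sin y) (continuous_subspaceT (@continuous_sin R)).
  rewrite sin0 !subr0 => ->.
  move: cI; rewrite in_itv/= => /andP[c1 c2].
  rewrite normrM normr_id ler_wpM2r// (le_trans _ (ler_norm _))//.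
  by rewrite cos_ge// ger0_norm// (le_trans c2).
exists ((cos W ^+ 2)^-1 ^+ 2); first exact: sqr_ge0.
move=> y z y1 zp; pose w := (y - z) / 2; pose s := (y + z) / 2.
have wW : `|w| <= W.
  rewrite /w /W normrM (ger0_norm (x := 2^-1))// ler_pM2r//.
  by rewrite (le_trans (ler_normB _ _))// lerD.
have sW : `|s| <= W.
  rewrite /s /W normrM (ger0_norm (x := 2^-1))// ler_pM2r//.
  by rewrite (le_trans (ler_normD _ _))// lerD.
have -> : sin y - sin z = 2 * (cos s * sin w).
  have -> : y = s + w by rewrite /s /w; field.
  have -> : z = s - w by rewrite /s /w; field.
  by rewrite sinD sinB; ring.
have h : cos W * (cos W * `|w|) <= `|cos s * sin w|.
  rewrite [leRHS]normrM; apply: ler_pM; rewrite ?mulr_ge0 ?(ltW c0)//.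
    by rewrite (le_trans _ (ler_norm _))// cos_ge.
  exact: sin_ge.
rewrite -exprMn -[leLHS](real_normK (num_real _)) -[leRHS](real_normK (num_real _)).
rewrite lerXn2r ?nnegrE//.
rewrite [leRHS]normrM (ger0_norm (x := cos W ^- 2)) ?invr_ge0 ?sqr_ge0//.
rewrite ler_pdivlMl ?exprn_gt0//.
rewrite [leRHS]normrM (ger0_norm (x := 2))//.
have -> : `|y - z| = 2 * `|w|.
  by rewrite /w normrM (ger0_norm (x := 2^-1))//; field.
by move: h; rewrite expr2; move: (cos W) `|w| `|_| => u v t; lra.
Qed.

End TrigInequalities.

(** * Approximation by trigonometric polynomials *)

Section TrigPolynomials.
Context {R : realType} (n : nat).
Implicit Types (f g : 'rV[R]_n -> R).

Inductive trigpoly : ('rV[R]_n -> R) -> Prop :=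
| trigpoly_cos t th : trigpoly (fun x => cos (dot t x + th))
| trigpoly_add f g : trigpoly f -> trigpoly g -> trigpoly (fun x => f x + g x)
| trigpoly_scale a f : trigpoly f -> trigpoly (fun x => a * f x).

Lemma trigpoly_ext f g : trigpoly f -> f =1 g -> trigpoly g.
Proof. by move=> tf /funext <-. Qed.

Lemma trigpoly_cst a : trigpoly (fun=> a).
Proof.
apply: trigpoly_ext (trigpoly_scale a (trigpoly_cos 0 0)) _ => x.
by rewrite dot0l addr0 cos0 mulr1.
Qed.

Lemma trigpoly_mul f g : trigpoly f -> trigpoly g -> trigpoly (fun x => f x * g x).
Proof.
move=> tf; elim: tf g => {f} [t th|f1 f2 _ ih1 _ ih2|a f _ ih] g tg.
- elim: tg => {g} [t' th'|g1 g2 _ ih1 _ ih2|a g _ ih].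
  + apply: trigpoly_ext (trigpoly_scale (1 / 2)
      (trigpoly_add (trigpoly_cos (t + t') (th + th')) (trigpoly_cos (t - t') (th - th')))) _ => x.
    rewrite !dotDl dotNl.
    have -> : dot t x + dot t' x + (th + th') = (dot t x + th) + (dot t' x + th') by ring.
    have -> : dot t x - dot t' x + (th - th') = (dot t x + th) - (dot t' x + th') by ring.
    by rewrite cosD cosB; field.
  + by apply: trigpoly_ext (trigpoly_add ih1 ih2) _ => x; rewrite mulrDr.
  + by apply: trigpoly_ext (trigpoly_scale a ih) _ => x; rewrite mulrCA.
- by apply: trigpoly_ext (trigpoly_add (ih1 _ tg) (ih2 _ tg)) _ => x; rewrite mulrDl.
- by apply: trigpoly_ext (trigpoly_scale a (ih _ tg)) _ => x; rewrite mulrA.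
Qed.

Lemma trigpoly_sin_coord a i : trigpoly (fun x => sin (a * x 0 i)).
Proof.
apply: trigpoly_ext (trigpoly_cos (a *: delta_mx 0 i) (- (pi / 2))) _ => x.
by rewrite dotZl dot_delta cosBpihalf.
Qed.

(** A walk with independent Bernoulli steps: for each i listed in l, the i-th
    counter is incremented with probability u i; [walk u l h k] is the mean
    of h at the end of the walk started from k. It stands for the
    multivariate Bernstein operator and makes variances computable by
    induction on l. *)
Fixpoint walk (u : 'I_n -> R) (l : seq 'I_n) (h : ('I_n -> nat) -> R) (k : 'I_n -> nat) : R :=
  if l is i :: l' then
    u i * walk u l' h (fun j => k j + (j == i))%N + (1 - u i) * walk u l' h k
  else h k.

Lemma walkD u l h1 h2 k :
  walk u l (fun j => h1 j + h2 j) k = walk u l h1 k + walk u l h2 k.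
Proof. by elim: l k => //= i l ih k; rewrite !ih; ring. Qed.

Lemma walkB u l h1 h2 k :
  walk u l (fun j => h1 j - h2 j) k = walk u l h1 k - walk u l h2 k.
Proof. by elim: l k => //= i l ih k; rewrite !ih; ring. Qed.

Lemma walkZ u l a h k : walk u l (fun j => a * h j) k = a * walk u l h k.
Proof. by elim: l k => //= i l ih k; rewrite !ih; ring. Qed.

Lemma walk_cst u l a k : walk u l (fun=> a) k = a.
Proof. by elim: l k => //= i l ih k; rewrite !ih; ring. Qed.

Lemma walk_sum u l (I : finType) (h : I -> ('I_n -> nat) -> R) k :
  walk u l (fun j => \sum_i h i j) k = \sum_i walk u l (h i) k.
Proof.
elim: l k => //= i l ih k.
by rewrite !ih !mulr_sumr -big_split.
Qed.

Lemma walk_mono u l h1 h2 k : (forall i, 0 <= u i <= 1) -> (forall j, h1 j <= h2 j) ->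
  walk u l h1 k <= walk u l h2 k.
Proof.
move=> u01 h12; elim: l k => //= i l ih k.
have /andP[u0 u1] := u01 i.
by rewrite lerD// ler_wpM2l// subr_ge0.
Qed.

Lemma walk_sq u l i c k :
  walk u l (fun j => ((j i)%:R - c) ^+ 2) k =
  (count_mem i l)%:R * (u i * (1 - u i)) + ((k i)%:R + (count_mem i l)%:R * u i - c) ^+ 2.
Proof.
elim: l k => [k|j l ih k] /=; first by rewrite !mul0r addr0 add0r.
rewrite !ih; have [->|ji] := eqVneq j i.
  change (nat_of_bool true) with 1%N.
  by rewrite addn1 add1n -!natr1; ring.
by rewrite addn0 add0n; ring.
Qed.

Lemma trigpoly_walk (u : 'I_n -> 'rV[R]_n -> R) l h k :
  (forall i, trigpoly (u i)) -> trigpoly (fun x => walk (u ^~ x) l h k).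
Proof.
move=> tu; elim: l k => [|i l ih] k /=; first exact: trigpoly_cst.
apply: trigpoly_add; apply: trigpoly_mul => //.
apply: trigpoly_add; first exact: trigpoly_cst.
by apply: trigpoly_ext (trigpoly_scale (-1) (tu i)) _ => x; rewrite mulN1r.
Qed.

Lemma continuous_unif_cube f (L e : R) : continuous f -> 0 < e ->
  exists2 d : R, 0 < d & forall x y : 'rV[R]_n,
    (forall i, `|x 0 i| <= L) -> (forall i, `|x 0 i - y 0 i| < d) -> `|f x - f y| <= e.
Proof.
move=> cf e0.
have K := @rV_compact R n (fun=> `[- L, L]%classic) (fun=> @segment_compact _ _ _).
have e2 : 0 < e / 2 by rewrite divr_gt0.
have cov : near_covering [set v : 'rV[R]_n | forall i, `[- L, L]%classic (v ord0 i)].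
  exact/compact_near_coveringP.
have H : \forall d \near (0 : R)^'+, forall x : 'rV[R]_n,
    (forall i, `[- L, L]%classic (x ord0 i)) -> forall y : 'rV[R]_n,
    (forall i, `|x 0 i - y 0 i| < d) -> `|f x - f y| <= e.
  apply: cov.
  move=> x _.
  have /cvgrPdist_le/(_ _ e2) := cf x.
  move=> /nbhs_ballP[r /= r0 hr].
  have r2 : 0 < r / 2 by rewrite divr_gt0.
  exists (ball x (r / 2), [set d | d < r / 2]).
    by split => /=; [exact: nbhsx_ballx|exact: nbhs_right_lt].
  move=> [x' d] [/= xx' dr] y x'y.
  have h1 : `|f x - f x'| <= e / 2.
    by apply: hr; apply: le_ball xx'; rewrite ler_pdivrMr// ler_peMr ?(ltW r0)// ler1n.
  have h2 : `|f x - f y| <= e / 2.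
    apply: hr; rewrite [r]splitr; apply: ball_triangle xx' _.
    split=> // i j; rewrite !ord1 /ball/= /ball_ /=.
    by rewrite (lt_trans (x'y j)).
  rewrite [e]splitr -[f x'](subrK (f x)) -addrA (le_trans (ler_normD _ _))// lerD//.
  by rewrite distrC.
have [d [d0 Hd]] := @filter_ex _ _ (@at_right_proper_filter R 0) _ (filterI (nbhs_right_gt 0) H).
exists d => // x y xL xy; apply: Hd => // i.
by rewrite /= in_itv/= -ler_norml.
Qed.

(** Bernstein approximation in the variables (1 + sin (x i / (2 L))) / 2,
    which range over [0, 1] for every x: the approximant obeys the same bound
    M as f on the whole space, and is close to f on the cube of half side L.
    Outside the cube, |x|^2 >= L pays for the error 2 M. *)
Lemma trigpoly_approx f (M e : R) : continuous f -> (forall x, `|f x| <= M) -> 0 < e ->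
  exists2 g, trigpoly g & forall x, `|f x - g x| <= e * (1 + dot x x).
Proof.
move=> cf fM e0.
have M0 : 0 <= M by apply: le_trans (fM 0).
pose L := 1 + 2 * M / e.
have L1 : 1 <= L by rewrite lerDl !mulr_ge0 ?invr_ge0 ?(ltW e0).
have L0 : 0 < L by lra.
have e2 : 0 < e / 2 by lra.
have [d d0 hd] := continuous_unif_cube L cf e2.
have [C C0 hC] := @sin_inv_lipschitz R.
have dV0 : 0 <= (d ^+ 2)^-1 by rewrite invr_ge0 sqr_ge0.
pose K' := 2 * M / d ^+ 2 * (4 * L ^+ 2 * (C * 4)).
have K'0 : 0 <= K' by rewrite !mulr_ge0// ltW.
pose N := (Num.truncn (2 * K' * n%:R / e)).+1.
have N0 : 0 < N%:R :> R by rewrite ltr0n.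
have NK : 2 * K' * n%:R / e <= N%:R by rewrite ltW// truncnS_gt.
pose l := flatten (nseq N (enum 'I_n)).
have cl i : count_mem i l = N.
  rewrite /l; elim: (N) => //= k ih.
  by rewrite count_cat ih count_uniq_mem ?enum_uniq// mem_enum add1n.
pose u i (x : 'rV[R]_n) := 1 / 2 + 1 / 2 * sin ((2 * L)^-1 * x 0 i).
have u01 x i : 0 <= u i x <= 1.
  by rewrite /u; have := sin_geN1 ((2 * L)^-1 * x 0 i);
    have := sin_le1 ((2 * L)^-1 * x 0 i) => *; apply/andP; split; lra.
pose z (k : nat) : R := Num.min (2 * (k%:R / N%:R) - 1) 1.
have z1 k : -1 <= z k <= 1.
  have q0 : 0 <= k%:R / N%:R :> R by rewrite divr_ge0.
  rewrite /z; apply/andP; split; last by rewrite ge_min lexx orbT.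
  by rewrite le_min; apply/andP; split; lra.
pose y (k : 'I_n -> nat) : 'rV[R]_n := \row_i (2 * L * asin (z (k i))).
pose g x := walk (u ^~ x) l (fun k => f (y k)) (fun=> 0%N).
exists g.
  apply: trigpoly_walk => i; apply: trigpoly_add; first exact: trigpoly_cst.
  by apply: trigpoly_scale; exact: trigpoly_sin_coord.
have gM x : `|g x| <= M.
  rewrite ler_norml; apply/andP; split.
    rewrite -(walk_cst (u ^~ x) l (- M) (fun=> 0%N)); apply: walk_mono => // k.
    by have := fM (y k); rewrite ler_norml => /andP[].
  rewrite -[leRHS](walk_cst (u ^~ x) l M (fun=> 0%N)); apply: walk_mono => // k.
  by have := fM (y k); rewrite ler_norml => /andP[].
move=> x; have xx0 := dot_ge0 x.
have [xL|xL] := pselect (forall i, `|x 0 i| <= L); last first.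
  have [i xi] : exists i, L < `|x 0 i|.
    apply: contrapT => h; apply: xL => i; rewrite leNgt; apply/negP => hi.
    by apply: h; exists i.
  have Lx : L <= dot x x.
    apply: le_trans (coord_mul_le x i i); rewrite normrM.
    by move: (`|x 0 i|) xi => a xi; nra.
  apply: (@le_trans _ _ (M + M)).
    by rewrite (le_trans (ler_normB _ _))// lerD.
  apply: (@le_trans _ _ (e * L)); first by rewrite /L mulrDr mulrCA mulfV ?gt_eqF//; lra.
  by rewrite ler_pM2l//; lra.
pose Kd := 2 * M / d ^+ 2.
have Kd0 : 0 <= Kd by rewrite !mulr_ge0.
(* Chebyshev: either the node is close to x, or the squared distance exceeds
   d^2 *)
have near_or_far k : `|f x - f (y k)| <= e / 2 + Kd * \sum_i (x 0 i - y k 0 i) ^+ 2.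
  have S0 : 0 <= \sum_i (x 0 i - y k 0 i) ^+ 2 by apply: sumr_ge0 => *; exact: sqr_ge0.
  have [h|h] := pselect (forall i, `|x 0 i - y k 0 i| < d).
    by apply: (le_trans (hd _ _ xL h)); rewrite lerDl mulr_ge0.
  have [i hi] : exists i, d <= `|x 0 i - y k 0 i|.
    apply: contrapT => h'; apply: h => i; rewrite ltNge; apply/negP => hi.
    by apply: h'; exists i.
  have dS : d ^+ 2 <= \sum_i (x 0 i - y k 0 i) ^+ 2.
    rewrite (bigD1 i)//= (@le_trans _ _ ((x 0 i - y k 0 i) ^+ 2))//.
      by rewrite -[leRHS](real_normK (num_real _)) lerXn2r ?nnegrE ?(ltW d0).
    by rewrite lerDl sumr_ge0// => *; exact: sqr_ge0.
  apply: (@le_trans _ _ (Kd * d ^+ 2)).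
    rewrite /Kd mulfVK ?expf_neq0 ?gt_eqF//.
    by rewrite (le_trans (ler_normB _ _))// mulr_natl mulr2n lerD.
  by apply: ler_wpDl; [exact: ltW|rewrite ler_wpM2l].
have coordk k i : (x 0 i - y k 0 i) ^+ 2 <=
    4 * L ^+ 2 * (C * 4) / N%:R ^+ 2 * ((k i)%:R - N%:R * u i x) ^+ 2.
  set t := (2 * L)^-1 * x 0 i; set a := asin (z (k i)).
  have tx : x 0 i = 2 * L * t by rewrite /t mulVKf// mulf_neq0 ?gt_eqF.
  rewrite mxE tx -mulrBr exprMn exprMn.
  have t1 : `|t| <= 1 / 2.
    rewrite /t normrM gtr0_norm ?invr_gt0 ?mulr_gt0// ler_pdivrMl ?mulr_gt0//.
    by apply: (le_trans (xL i)); lra.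
  have ap : `|a| <= pi / 2 by rewrite ler_norml asin_geNpi2 ?asin_lepi2.
  have h1 := hC t a t1 ap.
  have h2 : (sin t - sin a) ^+ 2 <= 4 / N%:R ^+ 2 * ((k i)%:R - N%:R * u i x) ^+ 2.
    have -> : 4 / N%:R ^+ 2 * ((k i)%:R - N%:R * u i x) ^+ 2 =
        (sin t - (2 * ((k i)%:R / N%:R) - 1)) ^+ 2.
      by rewrite /u -/t; field; rewrite gt_eqF.
    rewrite /a asinK ?in_itv/= ?z1// /z; have s1 := sin_le1 t.
    rewrite minEle; case: ifP => // /negbT; rewrite -ltNge.
    by move: (2 * _ - 1) (sin t) s1 => v w *; nra.
  apply: (@le_trans _ _ (2 ^+ 2 * L ^+ 2 * (C * (4 / N%:R ^+ 2 * ((k i)%:R - N%:R * u i x) ^+ 2)))).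
    apply: ler_wpM2l; first by rewrite mulr_ge0 ?sqr_ge0.
    by apply: (le_trans h1); rewrite ler_wpM2l.
  by rewrite le_eqVlt; apply/orP; left; apply/eqP; field; rewrite gt_eqF.
pose K2 := Kd * (4 * L ^+ 2 * (C * 4) / N%:R ^+ 2).
have K20 : 0 <= K2 by rewrite /K2 !mulr_ge0 ?invr_ge0 ?sqr_ge0 ?(ltW L0).
pose H (k : 'I_n -> nat) := e / 2 + K2 * \sum_i ((k i)%:R - N%:R * u i x) ^+ 2.
have fH k : `|f x - f (y k)| <= H k.
  apply: (le_trans (near_or_far k)); rewrite lerD2l /K2 -mulrA ler_wpM2l//.
  by rewrite mulr_sumr ler_sum.
have WH : walk (u ^~ x) l H (fun=> 0%N) <= e.
  rewrite walkD walk_cst walkZ walk_sum.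
  under eq_bigr do rewrite walk_sq cl add0r subrr expr0n/= addr0.
  have : K2 * \sum_(i < n) N%:R * (u i x * (1 - u i x)) <= K2 * \sum_(i < n) N%:R * 1.
    rewrite ler_wpM2l// ler_sum// => i _; rewrite ler_wpM2l ?(ltW N0)//.
    by have /andP[] := u01 x i; move: (u i x) => v *; nra.
  rewrite sumr_const card_ord mulr1.
  have -> : K2 * (N%:R *+ n) = K' * n%:R / N%:R.
    by rewrite -mulr_natr /K2 /K' /Kd; field; rewrite !gt_eqF.
  have : K' * n%:R / N%:R <= e / 2.
    rewrite ler_pdivrMr// -ler_pdivrMl//.
    by apply: le_trans NK; rewrite le_eqVlt; apply/orP; left; apply/eqP; field; rewrite gt_eqF.
  by move=> h1 h2; lra.
have gE : f x - g x = walk (u ^~ x) l (fun k => f x - f (y k)) (fun=> 0%N).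
  by rewrite walkB walk_cst.
apply: (@le_trans _ _ e); last by rewrite ler_peMr ?(ltW e0)//; lra.
rewrite gE ler_norml; apply/andP; split.
  apply: (@le_trans _ _ (walk (u ^~ x) l (fun k => 0 - H k) (fun=> 0%N))).
    by rewrite walkB walk_cst sub0r lerN2.
  apply: walk_mono => // k.
  by rewrite sub0r lerNl (le_trans _ (fH k))// -normrN ler_norm.
apply: le_trans WH; apply: walk_mono => // k.
by apply: le_trans (fH k); exact: ler_norm.
Qed.

End TrigPolynomials.

(** * The Fourier transform of a Gaussian density *)

Section GaussianIntegral.
Context {R : realType}.
Local Notation mu := (@lebesgue_measure R).
Implicit Types (H h : R -> R).

(** The fundamental theorem of calculus on [- n, n], in the limit. *)
Lemma integral_derive_eq0 H h : (forall x : R, is_derive x 1 H (h x)) -> continuous h ->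
  mu.-integrable setT (EFin \o h) ->
  H n.+1%:R @[n --> \oo] --> (0 : R) -> H (- n.+1%:R) @[n --> \oo] --> (0 : R) ->
  (\int[mu]_x (h x)%:E = 0)%E.
Proof.
move=> dH ch ih Hy HNy.
have cH : continuous H.
  by move=> y; apply/differentiable_continuous/derivable1_diffP; case: (dH y).
pose h_ n := (EFin \o h) \_ `[- n.+1%:R, n.+1%:R].
have hE n : (\int[mu]_x h_ n x = (H n.+1%:R - H (- n.+1%:R))%:E)%E.
  rewrite /h_ -integral_mkcond (@continuous_FTC2 _ h H)//.
  - by apply: (@lt_trans _ _ 0); rewrite ?oppr_lt0 ?ltr0n.
  - exact: continuous_subspaceT.
  - split; first by move=> x _; case: (dH x).
    + exact/cvg_at_right_filter/cH.
    + exact/cvg_at_left_filter/cH.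
  - by move=> x _; rewrite derive1E derive_val.
have mh := measurable_int _ ih.
have c1 : (\int[mu]_x h_ n x)%E @[n --> \oo] --> (\int[mu]_x (h x)%:E)%E.
  have := @dominated_convergence _ _ _ mu setT measurableT h_ (EFin \o h)
    (fun x => `|(h x)%:E|%E).
  case => //.
  - move=> n; apply: (proj1 (measurable_restrictT (EFin \o h) (measurable_itv _))).
    exact: measurable_funTS.
  - apply/aeW => x _; apply: cvg_near_cst.
    near=> n; rewrite /h_ patchE; case: ifPn => // /negP[].
    rewrite inE /= in_itv/= -ler_norml (@le_trans _ _ n%:R) ?ler_nat//.
    by near: n; exact: nbhs_infty_ger.
  - exact: integrable_abse.
  - apply/aeW => x n _; rewrite /h_ patchE; case: ifP => // _.
    by rewrite abse0.
have c2 : (\int[mu]_x h_ n x)%E @[n --> \oo] --> (0 : R)%:E.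
  under eq_fun do rewrite hE.
  apply: cvg_EFin; first exact: nearW.
  by rewrite -(subr0 0); apply: cvgB.
exact: (cvg_unique _ c1 c2).
Unshelve. all: by end_near.
Qed.

Variable k : R.
Hypothesis k0 : 0 < k.
Let e (x : R) := expR (- (k * x ^+ 2)).

Lemma is_derive_gauss (x : R) : is_derive x 1 e (- (2 * k * x) * e x).
Proof.
have h : is_derive x 1 (fun x : R => - (k * x ^+ 2)) (- (2 * k * x)).
  have -> : (fun x : R => - (k * x ^+ 2)) = (fun x => x * (x * - k)).
    by apply/funext => y; ring.
  rewrite -[X in is_derive _ _ _ X](_ :
      x *: (x *: (0 : R) + (- k) *: (1 : R)) + (x * - k) *: (1 : R) = _).
    have h1 : is_derive x 1 (fun b : R => b * - k)
      (x *: (0 : R) + (- k) *: (1 : R)) by apply: is_deriveM.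
    by apply: is_deriveM.
  by rewrite /GRing.scale/=; ring.
have := @is_derive1_comp _ (@expR R) (fun x : R => - (k * x ^+ 2)) x _ _ _ h.
by move=> /(_ _ (is_derive_expR _)); rewrite mulrC.
Qed.

Lemma continuous_gauss : continuous e.
Proof.
by move=> y; apply/differentiable_continuous/derivable1_diffP; case: (is_derive_gauss y).
Qed.

Lemma gauss_tail (n : nat) : e n.+1%:R <= k^-1 * n.+1%:R^-1.
Proof.
rewrite /e expRN -invfM lef_pV2 ?posrE ?expR_gt0 ?mulr_gt0//.
apply: le_trans (expR_ge1Dx _).
have n1 : 1 <= n.+1%:R :> R by rewrite ler1n.
by rewrite ler_wpDl// ler_pM2l// expr2 ler_peMr.
Qed.

End GaussianIntegral.

(** Up to a constant factor this is a normal density. *)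
Lemma integrable_gauss {R : realType} (k : R) : 0 < k ->
  (@lebesgue_measure R).-integrable setT (EFin \o (fun x => expR (- (k * x ^+ 2)))).
Proof.
move=> k0; pose s := Num.sqrt (1 / (2 * k)).
have s2 : s ^+ 2 = 1 / (2 * k) by rewrite sqr_sqrtr// divr_ge0// mulr_ge0// ltW.
have s0 : s != 0 by rewrite -sqrf_eq0 s2 gt_eqF// divr_gt0// mulr_gt0.
have := @integrable_normal_pdf R 0 s.
rewrite normal_pdfE// => /(integrableZl measurableT (normal_peak s)^-1).
apply: eq_integrable => // x _ /=.
rewrite -EFinM mulKf ?gt_eqF ?normal_peak_gt0//; congr (expR _)%:E.
by rewrite subr0 s2; field; rewrite gt_eqF.
Qed.

Section GaussianFourier.
Context {R : realType}.
Local Notation mu := (@lebesgue_measure R).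
Variables (k th : R).
Hypothesis k0 : 0 < k.
Let e (x : R) := expR (- (k * x ^+ 2)).

Lemma norm_mul_gauss_le (x : R) : `|x * e x| <= (1 + 2 / k) * expR (- (k / 2 * x ^+ 2)).
Proof.
have -> : e x = expR (- (k / 2 * x ^+ 2)) * expR (- (k / 2 * x ^+ 2)).
  by rewrite -expRD /e; congr expR; field.
rewrite mulrA normrM (ger0_norm (expR_ge0 _)) ler_wpM2r ?expR_ge0//.
rewrite normrM (ger0_norm (expR_ge0 _)) expRN ler_pdivrMr ?expR_gt0//.
have h : 1 + k / 2 * x ^+ 2 <= expR (k / 2 * x ^+ 2) by exact: expR_ge1Dx.
have k1 : 0 < 1 + 2 / k by rewrite ltr_wpDl// divr_gt0.
apply: (@le_trans _ _ ((1 + 2 / k) * (1 + k / 2 * x ^+ 2))); last by rewrite ler_pM2l.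
have -> : (1 + 2 / k) * (1 + k / 2 * x ^+ 2) = 1 + x ^+ 2 + (2 / k + k / 2 * x ^+ 2).
  by field; rewrite gt_eqF.
apply: (@le_trans _ _ (1 + x ^+ 2)).
  by rewrite -(real_normK (num_real x)); move: `|x| (normr_ge0 x) => u u0; nra.
have hk : 0 <= 2 / k by rewrite divr_ge0// ltW.
have hk2 : 0 <= k / 2 by rewrite divr_ge0// ltW.
by rewrite lerDl addr_ge0// mulr_ge0 ?sqr_ge0.
Qed.

Let f (b x : R) := e x * cos (b * x + th).

Lemma continuous_of_is_derive (h h' : R -> R) : (forall x : R, is_derive x 1 h (h' x)) -> continuous h.
Proof.
by move=> dh y; apply/differentiable_continuous/derivable1_diffP; case: (dh y).
Qed.

Let is_derive_affine (b x : R) : is_derive x 1 (fun x : R => b * x + th) b.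
Proof.
rewrite -[X in is_derive _ _ _ X]addr0; apply: is_deriveD.
have := @is_deriveZ _ R R id b x 1 1 (is_derive_id _ _).
by rewrite /GRing.scale/= mulr1.
Qed.

Let dcos (b x : R) : is_derive x 1 (fun x => cos (b * x + th)) (- sin (b * x + th) * b).
Proof. exact: (@is_derive1_comp _ (@cos R) (fun x => b * x + th) x _ _ (is_derive_cos _) (is_derive_affine b x)). Qed.

Let dsin (b x : R) : is_derive x 1 (fun x => sin (b * x + th)) (cos (b * x + th) * b).
Proof. exact: (@is_derive1_comp _ (@sin R) (fun x => b * x + th) x _ _ (is_derive_sin _) (is_derive_affine b x)). Qed.

Let ce : continuous e.
Proof. exact: continuous_gauss. Qed.
Let ccos (b : R) : continuous (fun x : R => cos (b * x + th)).
Proof. exact: continuous_of_is_derive (dcos b). Qed.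
Let csin (b : R) : continuous (fun x : R => sin (b * x + th)).
Proof. exact: continuous_of_is_derive (dsin b). Qed.

Let integrable_bounded_mul (h : R -> R) : continuous h -> (forall x, `|h x| <= 1) ->
  mu.-integrable setT (EFin \o (fun x : R => e x * h x)).
Proof.
move=> ch h1; apply: (le_integrable measurableT _ _ (integrable_gauss k0)).
  apply/measurable_EFinP; apply: continuous_measurable_fun => x.
  by apply: cvgM; [exact: ce|exact: ch].
move=> x _ /=; rewrite lee_fin normrM ger0_norm ?expR_ge0//.
by rewrite ler_piMr ?expR_ge0.
Qed.

Let integrable_x_mul (h : R -> R) : continuous h -> (forall x, `|h x| <= 1) ->
  mu.-integrable setT (EFin \o (fun x : R => x * e x * h x)).
Proof.
move=> ch h1.
have k20 : 0 < k / 2 by rewrite divr_gt0.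
have := integrableZl measurableT (1 + 2 / k) (integrable_gauss k20).
apply: le_integrable => //.
  apply/measurable_EFinP; apply: continuous_measurable_fun => x.
  by apply: cvgM; [apply: cvgM; [exact: cvg_id|exact: ce]|exact: ch].
move=> x _ /=; rewrite lee_fin normrM [leRHS]ger0_norm; last first.
  by rewrite mulr_ge0 ?expR_ge0// addr_ge0// divr_ge0// ltW.
by rewrite (le_trans _ (norm_mul_gauss_le x))// ler_piMr.
Qed.

Let F b : R := (\int[mu]_x f b x)%R.

Let stein b : (\int[mu]_x (x * e x * sin (b * x + th)))%R = b / (2 * k) * F b.
Proof.
pose H x := e x * sin (b * x + th).
pose h x := b * (e x * cos (b * x + th)) - 2 * k * (x * e x * sin (b * x + th)).
have dH (x : R) : is_derive x 1 H (h x).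
  have := @is_deriveM _ R e (fun x => sin (b * x + th)) x 1 _ _ (is_derive_gauss k x) (dsin b x).
  move=> /is_derive_eq; apply; rewrite /h /GRing.scale/= -/e -/(e x).
  by ring.
have i1 := integrable_bounded_mul (@ccos b) (fun x => cos_max _).
have i2 := integrable_x_mul (@csin b) (fun x => sin_max _).
have j1 := integrableZl measurableT b i1.
have j2 := integrableZl measurableT (2 * k) i2.
have ih : mu.-integrable setT (EFin \o h).
  have := integrableB measurableT j1 j2.
  by apply: eq_integrable.
have tail (x : R) n : `|x| = n.+1%:R -> `|H x| <= k^-1 * n.+1%:R^-1.
  move=> xn; rewrite /H normrM ger0_norm ?expR_ge0// (le_trans _ (gauss_tail k0 n))//.
  by rewrite /e -xn real_normK ?num_real// ler_piMr ?expR_ge0// sin_max.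
have t0 : k^-1 * n.+1%:R^-1 @[n --> \oo] --> (0 : R).
  by rewrite -(mulr0 k^-1); apply: cvgM; [exact: cvg_cst|exact: cvg_harmonic].
have ch : continuous h.
  move=> x; apply: cvgB; apply: cvgM; try exact: cvg_cst.
    by apply: cvgM; [exact: ce|exact: ccos].
  by apply: cvgM; [apply: cvgM; [exact: cvg_id|exact: ce]|exact: csin].
have I0 : (\int[mu]_x (h x)%:E = 0)%E.
  apply: (integral_derive_eq0 dH ch ih).
    apply: norm_cvg0; apply: (squeeze_cvgr _ (cvg_cst _) t0).
    by apply: nearW => n; rewrite normr_ge0/= tail// normr_nat.
  apply: norm_cvg0; apply: (squeeze_cvgr _ (cvg_cst _) t0).
  by apply: nearW => n; rewrite normr_ge0/= tail// normrN normr_nat.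
have : (\int[mu]_x h x)%R = 0 by rewrite /Rintegral I0.
rewrite /h RintegralB//.
rewrite RintegralZl// RintegralZl// -/(F b) => /eqP; rewrite subr_eq0 => /eqP hF.
have k2 : 2 * k != 0 by rewrite mulf_neq0// gt_eqF.
by apply: (mulfI k2); rewrite -hF /F /f; field; rewrite gt_eqF.
Qed.

Let derf (b x : R) : is_derive b 1 (f ^~ x) (- (x * e x * sin (b * x + th))).
Proof.
have h : is_derive b 1 (fun b : R => b * x + th) x.
  rewrite -[X in is_derive _ _ _ X]addr0; apply: is_deriveD.
  under eq_fun do rewrite mulrC.
  have := @is_deriveZ _ R R id x b 1 1 (is_derive_id _ _).
  by rewrite /GRing.scale/= mulr1.
have h2 := @is_derive1_comp _ (@cos R) (fun b => b * x + th) b _ _ (is_derive_cos _) h.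
have := @is_deriveZ _ R R _ (e x) b 1 _ h2.
by move=> /is_derive_eq; apply; rewrite /GRing.scale/=; ring.
Qed.

Let dF (b : R) : is_derive b 1 F (- (b / (2 * k)) * F b).
Proof.
have k20 : 0 < k / 2 by rewrite divr_gt0.
pose G x := (1 + 2 / k) * expR (- (k / 2 * x ^+ 2)).
have Ib : `]b - 1, b + 1[%classic b by rewrite /= in_itv/= ltrBlDr ltrDl ltr01.
have i1 x : `]b - 1, b + 1[%classic x -> mu.-integrable setT (EFin \o f x).
  by move=> _; apply: (integrable_bounded_mul (@ccos x)) => y; exact: cos_max.
have d1 x y : `]b - 1, b + 1[%classic x -> setT y -> derivable (f ^~ y) x 1.
  by move=> _ _; case: (derf x y).
have G0 y : 0 <= G y by rewrite mulr_ge0 ?expR_ge0// addr_ge0// divr_ge0// ltW.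
have iG : mu.-integrable setT (EFin \o G).
  exact: (integrableZl measurableT (1 + 2 / k) (integrable_gauss k20)).
have d1E x y : partial1of2 f x y = - (y * e y * sin (x * y + th)).
  by rewrite partial1of2E; case: (derf x y).
have Gub x y : `]b - 1, b + 1[%classic x -> setT y -> `|partial1of2 f x y| <= G y.
  move=> _ _; rewrite d1E normrN normrM (le_trans _ (norm_mul_gauss_le y))//.
  by rewrite ler_piMr// sin_max.
have D1 := derivable_under_integral measurableT Ib i1 d1 G0 iG Gub.
have D2 := differentiation_under_integral measurableT Ib i1 d1 G0 iG Gub.
apply: DeriveDef => //; rewrite -derive1E D2.
under eq_Rintegral do rewrite d1E.
have i2 := integrable_x_mul (@csin b) (fun x => sin_max _).
under eq_Rintegral do rewrite -mulN1r.
by rewrite RintegralZl// stein; ring.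
Qed.

(** Integration by parts turns the derivative of F b = \int e (x) cos (b x +
    th) dx into F' = - b F / (2 k), so that F b exp (b^2 / (4 k)) is
    constant. *)
Lemma gauss_fourier b : (\int[mu]_x (e x * cos (b * x + th)))%R =
  cos th * expR (- (b ^+ 2 / (4 * k))) * (\int[mu]_x e x)%R.
Proof.
pose Psi b := F b * expR (b ^+ 2 * (4 * k)^-1).
have dPsi (c : R) : is_derive c 1 Psi 0.
  move: c => {}b.
  have h1 : is_derive b 1 (fun b : R => b ^+ 2 * (4 * k)^-1) (b / (2 * k)).
    have -> : (fun b : R => b ^+ 2 * (4 * k)^-1) = (fun b => b * (b * (4 * k)^-1)).
      by apply/funext => y; rewrite mulrA -expr2.
    have h2 : is_derive b 1 (fun b : R => b * (4 * k)^-1)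
      (b *: (0 : R) + ((4 * k)^-1) *: (1 : R)) by apply: is_deriveM.
    rewrite -[X in is_derive _ _ _ X](_ :
      b *: (b *: (0 : R) + (4 * k)^-1 *: (1 : R)) + (b * (4 * k)^-1) *: (1 : R) = _).
      by apply: is_deriveM.
    by rewrite /GRing.scale/=; field; rewrite gt_eqF.
  have h2 := @is_derive1_comp _ (@expR R) _ b _ _ (is_derive_expR _) h1.
  have := @is_deriveM _ R F _ b 1 _ _ (dF b) h2.
  by move=> /is_derive_eq; apply; rewrite /GRing.scale/=; ring.
have := is_derive_0_is_cst b 0 dPsi.
rewrite /Psi expr0n/= mul0r expR0 mulr1 => hF.
rewrite -/(F b).
have F0 : F 0 = cos th * (\int[mu]_x e x)%R.
  rewrite /F /f; under eq_Rintegral do rewrite mul0r add0r mulrC.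
  by rewrite RintegralZl//; exact: integrable_gauss.
by rewrite mulrAC -F0 -hF expRN mulfK ?gt_eqF ?expR_gt0.
Qed.

End GaussianFourier.

(** * Cosine transforms of probability laws *)

Section ProbabilityIntegral.
Context {R : realType} d (T : measurableType d) (P : probability T R).
Implicit Types f g : T -> R.

Lemma bounded_integrable f (M : R) : measurable_fun setT f -> (forall x, `|f x| <= M) ->
  P.-integrable setT (EFin \o f).
Proof.
move=> mf fM; apply: (@measurable_bounded_integrable _ _ _ P f setT) => //.
  exact: le_lt_trans (probability_le1 P measurableT) (ltry _).
exists M; split; first exact: num_real.
by move=> y My x _; exact: le_trans (fM x) (ltW My).
Qed.

Lemma prob_Rintegral_cst (c : R) : (\int[P]_x c)%R = c.
Proof.
rewrite Rintegral_cst//; have -> : fine (P setT) = 1 by exact: (congr1 fine (probability_setT P)).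
by rewrite mulr1.
Qed.

Lemma expectation_Rintegral f : P.-integrable setT (EFin \o f) ->
  ('E_P[f] = (\int[P]_x f x)%R%:E)%E.
Proof. by move=> fi; rewrite unlock /Rintegral fineK// integrable_fin_num. Qed.

Lemma dist_Rintegral_le f g h : P.-integrable setT (EFin \o f) ->
  P.-integrable setT (EFin \o g) -> P.-integrable setT (EFin \o h) ->
  (forall x, `|f x - g x| <= h x) ->
  `|(\int[P]_x f x)%R - (\int[P]_x g x)%R| <= (\int[P]_x h x)%R.
Proof.
move=> fi gi hi fgh.
have fgi := integrableB measurableT fi gi.
rewrite -RintegralB// (le_trans (le_normr_Rintegral measurableT fgi))//.
apply: le_Rintegral => //; exact: integrable_norm fgi.
Qed.

End ProbabilityIntegral.

Section NormalLaw.
Context {R : realType}.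
Local Notation mu := (@lebesgue_measure R).

Lemma measurable_cos_affine d (T : measurableType d) (f : T -> R) (a th : R) :
  measurable_fun setT f -> measurable_fun setT (fun x => cos (a * f x + th)).
Proof.
move=> mf; apply: measurableT_comp.
  by apply: continuous_measurable_fun; exact: continuous_cos.
by apply: measurable_funD => //; exact: measurable_funM.
Qed.

Lemma normal_prob_integral (s : R) (f : R -> R) :
  (normal_prob 0 s).-integrable setT (EFin \o f) ->
  (\int[normal_prob 0 s]_x f x)%R = (\int[mu]_x (f x * normal_pdf 0 s x))%R.
Proof.
move=> fi; congr fine.
rewrite -(Radon_Nikodym_change_of_variables (normal_prob_dominates 0 s) measurableT fi).
have iRN : mu.-integrable setT
    (Radon_Nikodym (charge_of_finite_measure (normal_prob 0 s)) mu).
  by apply: Radon_Nikodym_integrable; exact: normal_prob_dominates.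
have ae : ae_eq mu setT (Radon_Nikodym (charge_of_finite_measure (normal_prob 0 s)) mu)
    (EFin \o normal_pdf 0 s).
  apply: integral_ae_eq => //.
    by apply/measurable_EFinP; exact: measurable_normal_pdf.
  move=> E _ mE; rewrite -Radon_Nikodym_integral//; exact: normal_prob_dominates.
have mf := measurable_int _ fi.
apply: ae_eq_integral => //.
- apply: emeasurable_funM; first exact: mf.
  exact: measurable_int iRN.
- apply/measurable_EFinP; apply: measurable_funM; last exact: measurable_normal_pdf.
  by apply/measurable_EFinP.
- move: ae; apply: filterS => x /= h _.
  by rewrite h// EFinM.
Qed.

Lemma normal_prob_cos (s a th : R) : s != 0 ->
  (\int[normal_prob 0 s]_x cos (a * x + th))%R = cos th * expR (- (a ^+ 2 * s ^+ 2 / 2)).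
Proof.
move=> s0.
have s2 : 0 < s ^+ 2 by rewrite exprn_even_gt0.
have mc : measurable_fun setT (fun x : R => cos (a * x + th)).
  exact: measurable_cos_affine.
rewrite normal_prob_integral; last first.
  by apply: (@bounded_integrable _ _ _ (normal_prob 0 s) _ 1) => // x; exact: cos_max.
pose k := (2 * s ^+ 2)^-1.
have k0 : 0 < k by rewrite invr_gt0 mulr_gt0.
have pdfE x : normal_pdf 0 s x = normal_peak s * expR (- (k * x ^+ 2)).
  rewrite normal_pdfE// /normal_fun subr0; congr (_ * expR _).
  by rewrite /k; field.
have ig := integrable_gauss k0.
have one : normal_peak s * (\int[mu]_x expR (- (k * x ^+ 2)))%R = 1.
  rewrite -RintegralZl// /Rintegral -[RHS]/(fine 1%E) -(integral_normal_pdf 0 s).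
  by congr fine; apply: eq_integral => x _; rewrite pdfE.
under eq_Rintegral do rewrite pdfE mulrCA [cos _ * _]mulrC.
rewrite RintegralZl//; last first.
  apply: (le_integrable measurableT _ _ ig).
    apply/measurable_EFinP; apply: measurable_funM => //.
    apply: continuous_measurable_fun; exact: continuous_gauss.
  move=> x _ /=; rewrite lee_fin normrM ler_piMr//; exact: cos_max.
rewrite gauss_fourier// mulrCA one mulr1; congr (_ * expR _).
by rewrite invfM /k invrK; field.
Qed.

(** The variance is the curvature of the characteristic function at 0: the
    functions 2 (1 - cos (a xi)) / a^2 are at most xi^2 and tend to it, and
    their means are known, so that the second moment is finite by the Fatou
    lemma. *)
Lemma second_moment_of_cos d (T : measurableType d) (P : probability T R)
    (xi : T -> R) (v : R) : measurable_fun setT xi -> 0 <= v ->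
  (forall a, (\int[P]_w cos (a * xi w))%R = expR (- (a ^+ 2 * v / 2))) ->
  P.-integrable setT (EFin \o (fun w => xi w ^+ 2)) /\ (\int[P]_w (xi w ^+ 2))%R = v.
Proof.
move=> mxi v0 cf.
pose a n : R := n.+1%:R^-1.
have a0 n : 0 < a n by rewrite invr_gt0.
have a2 n : 0 <= 2 / a n ^+ 2 by rewrite divr_ge0// exprn_ge0// ltW.
pose h n w := 2 / a n ^+ 2 * (1 - cos (a n * xi w)).
have mc n : measurable_fun setT (fun w => cos (a n * xi w)).
  have := measurable_cos_affine (a n) 0 mxi.
  by under eq_fun do rewrite addr0.
have ic n : P.-integrable setT (EFin \o (fun w => cos (a n * xi w))).
  by apply: (@bounded_integrable _ _ _ P _ 1) => // w; exact: cos_max.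
have i1 n : P.-integrable setT (EFin \o (fun w => 1 - cos (a n * xi w))).
  apply: (@bounded_integrable _ _ _ P _ (1 + 1)) => [|w].
    by apply: measurable_funB.
  by rewrite (le_trans (ler_normB _ _))// normr1 lerD2l cos_max.
have mh n : measurable_fun setT (h n) by apply: measurable_funM => //; exact: measurable_funB.
have h0 n w : 0 <= h n w by rewrite mulr_ge0// subr_ge0 cos_le1.
have ih n : P.-integrable setT (EFin \o h n) by exact: (integrableZl measurableT _ (i1 n)).
have Eh n : (\int[P]_w h n w)%R = 2 / a n ^+ 2 * (1 - expR (- (a n ^+ 2 * v / 2))).
  rewrite /h RintegralZl// RintegralB//; last first.
    by apply: (@bounded_integrable _ _ _ P _ 1) => // w; rewrite normr1.
  by rewrite prob_Rintegral_cst cf.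
have h_le n w : h n w <= xi w ^+ 2.
  rewrite /h.
  have -> : 1 - cos (a n * xi w) = 2 * sin (a n * xi w / 2) ^+ 2.
    have {1}-> : a n * xi w = (a n * xi w / 2) *+ 2 by rewrite -mulr_natr divfK.
    by rewrite cos_mulr2n cos2sin2; ring.
  have : sin (a n * xi w / 2) ^+ 2 <= (a n * xi w / 2) ^+ 2.
    rewrite -(real_normK (num_real (sin _))) -[leRHS](real_normK (num_real _)).
    rewrite lerXn2r ?nnegrE//.
    by have := sin_taylor1 0 (a n * xi w / 2); rewrite add0r sin0 subr0.
  move=> hs.
  have -> : xi w ^+ 2 = 2 / a n ^+ 2 * (2 * (a n * xi w / 2) ^+ 2).
    by field; rewrite gt_eqF.
  apply: ler_wpM2l => //; by rewrite ler_pM2l.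
have h_cvg w : (h n w)%:E @[n --> \oo] --> (xi w ^+ 2)%:E.
  apply: cvg_EFin; first exact: nearW.
  have bnd n : `|h n w - xi w ^+ 2| <= 2 * `|xi w| ^+ 3 * a n.
    have := cos_taylor3 0 (a n * xi w).
    rewrite add0r cos0 sin0 mulr0 addr0 mulr1 => ht.
    have -> : h n w - xi w ^+ 2 = - (2 / a n ^+ 2) *
        (cos (a n * xi w) - 1 + (a n * xi w) ^+ 2 / 2).
      by rewrite /h; field; rewrite gt_eqF.
    rewrite normrM normrN (ger0_norm (a2 n)).
    apply: (@le_trans _ _ (2 / a n ^+ 2 * `|a n * xi w| ^+ 3)).
      by rewrite ler_wpM2l.
    rewrite normrM (gtr0_norm (a0 n)) le_eqVlt; apply/orP; left; apply/eqP.
    by field; rewrite gt_eqF.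
  apply: (cvg_of_dist_le bnd).
  rewrite -(mulr0 (2 * `|xi w| ^+ 3)); apply: cvgM; [exact: cvg_cst|exact: cvg_harmonic].
have Eh_le n : (\int[P]_w h n w)%R <= v.
  rewrite Eh; have := expR_ge1Dx (- (a n ^+ 2 * v / 2)).
  move=> hx; apply: (@le_trans _ _ (2 / a n ^+ 2 * (a n ^+ 2 * v / 2))).
    by rewrite ler_wpM2l//; lra.
  by rewrite le_eqVlt; apply/orP; left; apply/eqP; field; rewrite gt_eqF.
have mx2 : measurable_fun setT (fun w => (xi w ^+ 2)%:E).
  by apply/measurable_EFinP; exact: measurable_funX.
have fat : (\int[P]_w (xi w ^+ 2)%:E <= v%:E)%E.
  have := @fatou _ _ _ P setT measurableT (fun n w => (h n w)%:E)
     (fun n => proj2 (measurable_EFinP _ _) (mh n)) (fun n w _ => h0 n w).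
  rewrite (eq_integral (fun w => (xi w ^+ 2)%:E)); last first.
    move=> w _; rewrite is_cvg_limn_einfE.
      by apply/cvg_lim => //; exact: h_cvg.
    by apply/cvg_ex; exists (xi w ^+ 2)%:E; exact: h_cvg.
  move=> /le_trans; apply; rewrite limn_einf_lim.
  apply: lime_le; first exact: is_cvg_einfs.
  apply: nearW => n; apply: (@le_trans _ _ (\int[P]_w (h n w)%:E)%E).
    by apply: ereal_inf_lbound; exists n => //=.
  by rewrite -(fineK (integrable_fin_num measurableT (ih n))) lee_fin; exact: Eh_le.
have ix : P.-integrable setT (EFin \o (fun w => xi w ^+ 2)).
  apply/integrableP; split => //.
  apply: le_lt_trans (ltry v); apply: le_trans fat.
  rewrite le_eqVlt; apply/orP; left; apply/eqP; apply: eq_integral => w _ /=.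
  by rewrite ger0_norm// sqr_ge0.
split=> //; apply/eqP; rewrite eq_le; apply/andP; split.
  by rewrite -lee_fin fineK//; exact: integrable_fin_num.
apply/ler_addgt0Pr => e e0.
have hn n : v - v ^+ 2 / 2 * a n <= (\int[P]_w (xi w ^+ 2))%R.
  apply: (@le_trans _ _ ((\int[P]_w h n w)%R)); last by apply: le_Rintegral.
  rewrite Eh; set y := a n ^+ 2 * v / 2.
  have y0 : 0 <= y by rewrite divr_ge0// mulr_ge0// sqr_ge0.
  have ey : expR (- y) <= 1 - y + y ^+ 2.
    rewrite expRN; apply: (@le_trans _ _ (1 + y)^-1).
      by rewrite lef_pV2 ?posrE ?expR_gt0 ?ltr_pwDl// expR_ge1Dx.
    rewrite -[leLHS]mul1r ler_pdivrMr ?ltr_pwDl//.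
    have -> : (1 - y + y ^+ 2) * (1 + y) = 1 + y ^+ 3 by ring.
    by rewrite lerDl exprn_ge0.
  apply: (@le_trans _ _ (2 / a n ^+ 2 * (y - y ^+ 2))).
    have -> : 2 / a n ^+ 2 * (y - y ^+ 2) = v - v ^+ 2 / 2 * (a n ^+ 2).
      by rewrite /y; field; rewrite gt_eqF.
    rewrite lerD2l lerN2 ler_wpM2l ?divr_ge0 ?sqr_ge0// expr2 ler_piMr ?(ltW (a0 n))//.
    by rewrite invf_le1 ?ler1n.
  by rewrite ler_wpM2l//; lra.
have lim : v - v ^+ 2 / 2 * a n @[n --> \oo] --> v - v ^+ 2 / 2 * 0.
  by apply: cvgB; [exact: cvg_cst|apply: cvgM; [exact: cvg_cst|exact: cvg_harmonic]].
rewrite mulr0 subr0 in lim.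
apply: (@le_trans _ _ ((\int[P]_w (xi w ^+ 2))%R)); last by rewrite lerDl ltW.
rewrite -(cvg_lim _ lim)//; apply: limr_le; first by apply/cvg_ex; exists v.
by apply: nearW.
Qed.

End NormalLaw.

(** * Gaussian vectors *)

Section LawOnTheLine.
Context {R : realType}.

(** The normal laws live on the reals with this sigma-algebra, whose display
    differs from that of the canonical one. *)
Let RM : measurableType _ := measurableTypeR R.

Implicit Types (P Q : probability RM R).

Let rv1 (x : R) : 'rV[R]_1 := \row_i x.

Let dot1 (t : 'rV[R]_1) x : dot t (rv1 x) = t 0 0 * x.
Proof. by rewrite /dot big_ord1 mxE. Qed.

Lemma measurable_trigpoly_comp n d (T : measurableType d) (Z : T -> 'rV[R]_n) (g : 'rV[R]_n -> R) :
  (forall i, measurable_fun setT (fun w => Z w 0 i)) -> trigpoly g ->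
  measurable_fun setT (fun w => g (Z w)).
Proof.
move=> mZ; elim => {g} [t th|f g _ mf _ mg|a f _ mf].
- have md : measurable_fun setT (fun w => dot t (Z w)).
    by apply: measurable_sum => i; exact: measurable_funM.
  have := measurable_cos_affine 1 th md.
  by under eq_fun do rewrite mul1r.
- exact: measurable_funD.
- exact: measurable_funM.
Qed.

Lemma trigpoly_bounded n (g : 'rV[R]_n -> R) : trigpoly g -> exists M, forall x, `|g x| <= M.
Proof.
elim => {g} [t th|f g _ [M fM] _ [N gN]|a f _ [M fM]].
- by exists 1 => x; exact: cos_max.
- by exists (M + N) => x; rewrite (le_trans (ler_normD _ _))// lerD.
- by exists (`|a| * M) => x; rewrite normrM ler_wpM2l.
Qed.

Lemma measurable_continuous_comp n d (T : measurableType d) (Z : T -> 'rV[R]_n) (f : 'rV[R]_n -> R) (M : R) :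
  (forall i, measurable_fun setT (fun w => Z w 0 i)) ->
  continuous f -> (forall x, `|f x| <= M) -> measurable_fun setT (fun w => f (Z w)).
Proof.
move=> mZ cf fM.
have app k : {g | trigpoly g & forall x, `|f x - g x| <= k.+1%:R^-1 * (1 + dot x x)}.
  by apply: cid2; apply: trigpoly_approx fM _ => //; rewrite invr_gt0.
pose g k := sval (app k).
have tg k : trigpoly (g k) by rewrite /g; case: (app k).
have gE k x : `|f x - g k x| <= k.+1%:R^-1 * (1 + dot x x) by rewrite /g; case: (app k).
apply: (@measurable_fun_cvg _ _ _ _ (fun k w => g k (Z w))).
  by move=> k; exact: measurable_trigpoly_comp.
move=> w _; apply: (@cvg_of_dist_le _ _ (fun k => k.+1%:R^-1 * (1 + dot (Z w) (Z w)))).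
  by move=> k; rewrite distrC.
by rewrite -(mul0r (1 + dot (Z w) (Z w))); apply: cvgM; [exact: cvg_harmonic|exact: cvg_cst].
Qed.

(** Continuous functions that decrease to the indicator of ]-oo, r]. *)
Let ramp (r : R) (k : nat) (x : R) : R := Num.min 1 (Num.max 0 (1 - k%:R * (x - r))).

Let ramp01 r k x : 0 <= ramp r k x <= 1.
Proof. by rewrite /ramp le_min ler01 le_max lexx ge_min lexx. Qed.

Let continuous_ramp r k : continuous (ramp r k).
Proof.
have c1 : continuous (fun x : R => 1 - k%:R * (x - r)).
  move=> x; apply: cvgB; first exact: cvg_cst.
  apply: cvgM; first exact: cvg_cst.
  by apply: cvgB; [exact: cvg_id|exact: cvg_cst].
move=> x.
have h1 : {for x, continuous (fun x : R => Num.max 0 (1 - k%:R * (x - r)))}.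
  exact: (@continuous_max R R (cst 0) _ x (cvg_cst _) (@c1 x)).
exact: (@continuous_min R R (cst 1) _ x (cvg_cst _) h1).
Qed.

Let cvg_ramp r x : ramp r k x @[k --> \oo] --> (\1_`]-oo, r]%classic x : R).
Proof.
rewrite indicE mem_setE in_itv/=; case: leP => [xr|rx].
  rewrite (_ : (fun k => _) = cst 1); first exact: cvg_cst.
  apply/funext => k; rewrite /ramp/=.
  have h : 1 <= 1 - k%:R * (x - r) by rewrite lerBrDr gerDl mulr_ge0_le0// subr_le0.
  by rewrite max_r ?(le_trans ler01)// min_l.
apply: cvg_near_cst; near=> k.
have h : 1 - k%:R * (x - r) <= 0.
  rewrite subr_le0 -ler_pdivrMr ?subr_gt0// div1r.
  by near: k; exact: nbhs_infty_ger.
by rewrite /ramp max_l// min_r.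
Unshelve. all: by end_near. Qed.

(** The cosine transforms give the integrals of trigonometric polynomials;
    the second moments control the error of approximating a bounded
    continuous function by these; continuous functions approximate the
    indicators of half lines. *)
Lemma law_unique P Q :
  P.-integrable setT (EFin \o (fun x => x ^+ 2)) ->
  Q.-integrable setT (EFin \o (fun x => x ^+ 2)) ->
  (forall a th, \int[P]_x cos (a * x + th) = \int[Q]_x cos (a * x + th)) ->
  forall B, measurable B -> P B = Q B.
Proof.
move=> iP iQ hcos.
have mrv i : measurable_fun setT (fun x : R => rv1 x 0 i).
  by under eq_fun do rewrite mxE; exact: measurable_id.
have htrig g : trigpoly g -> \int[P]_x g (rv1 x) = \int[Q]_x g (rv1 x).
  have ibl (P0 : probability RM R) (f : 'rV[R]_1 -> R) : trigpoly f -> P0.-integrable setT (EFin \o (fun x => f (rv1 x))).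
    move=> tf; have [M fM] := trigpoly_bounded tf.
    by apply: (@bounded_integrable _ _ _ P0 (fun x => f (rv1 x)) M) => //;
      exact: (measurable_trigpoly_comp mrv tf).
  move=> tg; elim: tg => {g} [t th|f g tf ef tg eg|a f tf ef].
  - by under eq_Rintegral do rewrite dot1; under [RHS]eq_Rintegral do rewrite dot1.
  - by rewrite !RintegralD//; try exact: ibl; rewrite ef eg.
  - by rewrite !RintegralZl//; try exact: ibl; rewrite ef.
have hcont (f : R -> R) (M : R) : continuous f -> (forall x, `|f x| <= M) -> \int[P]_x f x = \int[Q]_x f x.
  move=> cf fM; apply/eqP; rewrite -subr_eq0 -normr_le0; apply/ler_addgt0Pr => e e0.
  rewrite add0r.
  pose K := (1 + \int[P]_x (x ^+ 2)) + (1 + \int[Q]_x (x ^+ 2)).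
  have P20 (P0 : probability RM R) : 0 <= \int[P0]_x (x ^+ 2).
    by apply: Rintegral_ge0 => x _; exact: sqr_ge0.
  have K0 : 0 < K by rewrite /K; have := P20 P; have := P20 Q; lra.
  have cF : continuous (fun x : 'rV[R]_1 => f (x 0 0)).
    by move=> x; apply: continuous_comp; [exact: coord_continuous|exact: cf].
  have [g tg gE] := trigpoly_approx cF (fun x => fM _) (divr_gt0 e0 K0).
  have [N gN] := trigpoly_bounded tg.
  have bnd (P0 : probability RM R) : P0.-integrable setT (EFin \o (fun x => x ^+ 2)) ->
      `|\int[P0]_x f x - \int[P0]_x g (rv1 x)| <= e / K * (1 + \int[P0]_x (x ^+ 2)).
    move=> i2.
    have i1 : P0.-integrable setT (EFin \o (fun=> 1 : R)).
      by apply: (@bounded_integrable _ _ _ P0 _ 1) => // x; rewrite normr1.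
    have iD : P0.-integrable setT (EFin \o (fun x => 1 + x ^+ 2)) by exact: (integrableD measurableT i1 i2).
    rewrite -[X in _ * (X + _)](prob_Rintegral_cst P0) -RintegralD// -RintegralZl//.
    apply: dist_Rintegral_le.
    - apply: (@bounded_integrable _ _ _ P0 _ M) => //.
      exact: continuous_measurable_fun.
    - apply: (@bounded_integrable _ _ _ P0 _ N) => //.
      exact: (measurable_trigpoly_comp mrv tg).
    - exact: (integrableZl measurableT (e / K) iD).
    - by move=> x; have := gE (rv1 x); rewrite dot1 !mxE -expr2.
  have := lerD (bnd P iP) (bnd Q iQ); rewrite -mulrDr -/K divfK ?gt_eqF//.
  apply: le_trans; rewrite (htrig g tg) (distrC (\int[Q]_x f x)).
  apply: le_trans (ler_normD _ _).
  by rewrite addrA subrK.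
have hray (r : R) : P `]-oo, r]%classic = Q `]-oo, r]%classic.
  have lim (P0 : probability RM R) :
      (\int[P0]_x ramp r k x)%:E @[k --> \oo] --> P0 `]-oo, r]%classic.
    have := @dominated_convergence _ _ _ P0 setT measurableT
      (fun k x => (ramp r k x)%:E) (fun x => (\1_`]-oo, r]%classic x)%:E) (cst 1%E).
    case => //.
    - move=> k; apply/measurable_EFinP; apply: continuous_measurable_fun.
      exact: continuous_ramp.
    - by apply/measurable_EFinP.
    - by apply/aeW => x _; apply: cvg_EFin; [exact: nearW|exact: cvg_ramp].
    - exact: finite_measure_integrable_cst.
    - apply/aeW => x k _; rewrite /= lee_fin.
      by have /andP[h0 h1] := ramp01 r k x; rewrite ger0_norm.
    move=> _ _; rewrite integral_indic// setIT; apply: cvg_trans.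
    apply: near_eq_cvg; apply: nearW => k; rewrite /Rintegral fineK//.
    apply: integrable_fin_num => //; apply: (@bounded_integrable _ _ _ P0 _ 1).
      by apply: continuous_measurable_fun; exact: continuous_ramp.
    by move=> x; have /andP[h0 h1] := ramp01 r k x; rewrite ger0_norm.
  apply: (cvg_unique _ (lim P)) => //; have := lim Q.
  apply: cvg_trans; apply: near_eq_cvg; apply: nearW => k; congr (_%:E).
  apply/esym; apply: (hcont _ 1) => [|x]; first exact: continuous_ramp.
  by have /andP[h0 h1] := ramp01 r k x; rewrite ger0_norm.
move=> B mB.
apply: (@measure_unique _ R RM (@RGenOInfty.G R) (fun n => `]- n%:R, +oo[%classic : set RM)) => //.
- exact: RGenOInfty.measurableE.
- move=> _ _ [r ->] [s ->]; exists (Num.max r s).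
  apply/seteqP; split => x /=; rewrite !in_itv/= !andbT gt_max.
    by move=> [-> ->].
  by move=> /andP[].
- by move=> n; exists (- n%:R).
- apply/seteqP; split => // x _; exists (Num.truncn (- x)).+1 => //=.
  by rewrite in_itv/= andbT ltrNl truncnS_gt.
- move=> _ [r ->]; rewrite -setCitvl.
  have mI : measurable (`]-oo, r]%classic : set RM) by exact: measurable_itv.
  apply: (etrans (@probability_setC _ RM R P _ mI)).
  apply: (etrans _ (esym (@probability_setC _ RM R Q _ mI))).
  by congr (_ - _)%E; exact: hray.
- by move=> n; exact: le_lt_trans (probability_le1 P (measurable_itv _)) (ltry _).
Qed.

Lemma measurable_dot n d (T : measurableType d) (Z : T -> 'rV[R]_n) t :
  (forall i, measurable_fun setT (fun w => Z w 0 i)) ->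
  measurable_fun setT (fun w => dot t (Z w)).
Proof. by move=> mZ; apply: measurable_sum => i; exact: measurable_funM. Qed.

Lemma centered_normal_of_cos d (T : measurableType d) (P : probability T R)
    (xi : T -> R) (v : R) : measurable_fun setT xi -> 0 <= v ->
  (forall a th, \int[P]_w cos (a * xi w + th) = cos th * expR (- (a ^+ 2 * v / 2))) ->
  forall B, measurable B -> P [set w | B (xi w)] = centered_normal v B.
Proof.
move=> mxi v0 cf B mB.
pose X : {mfun T >-> RM} := @mfun_Sub _ _ T RM xi (mem_set mxi).
have XE : X = xi :> (T -> R) by [].
pose Q : probability RM R := distribution P X.
have msq : measurable_fun setT (fun x : R => x ^+ 2) by exact: measurable_funX.
have Qcos a th : \int[Q]_x cos (a * x + th) = cos th * expR (- (a ^+ 2 * v / 2)).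
  rewrite -cf /Rintegral /Q integral_distribution //.
    by apply/measurable_EFinP; exact: measurable_cos_affine.
  apply: (@bounded_integrable _ _ _ P (fun w => cos (a * xi w + th)) 1) => [|x].
    exact: measurable_cos_affine.
  exact: cos_max.
have second (Q0 : probability RM R) :
    (forall a th, \int[Q0]_x cos (a * x + th) = cos th * expR (- (a ^+ 2 * v / 2))) ->
    Q0.-integrable setT (EFin \o (fun x => x ^+ 2)).
  move=> h; apply: (proj1 (@second_moment_of_cos _ _ _ Q0 id v _ v0 _)) => // a.
  have := h a 0; rewrite cos0 mul1r => <-; apply: eq_Rintegral => x _.
  by rewrite addr0.
have -> : P [set w | B (xi w)] = Q B by [].
rewrite /centered_normal; have [v00|vn0] := eqVneq v 0.
  have dcos a th : \int[(\d_(0 : RM) : probability RM R)]_x cos (a * x + th) = cos th * expR (- (a ^+ 2 * v / 2)).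
    rewrite /Rintegral integral_dirac//; last first.
      by apply/measurable_EFinP; exact: measurable_cos_affine.
    by rewrite diracT mul1e/= v00 !mulr0 add0r mul0r oppr0 expR0 mulr1.
  apply: (@law_unique Q (\d_(0 : RM))) => //; try exact: second.
  by move=> a th; rewrite Qcos dcos.
have s0 : Num.sqrt v != 0 by rewrite gt_eqF// sqrtr_gt0 lt_neqAle eq_sym vn0.
have ncos a th : \int[normal_prob 0 (Num.sqrt v)]_x cos (a * x + th) =
    cos th * expR (- (a ^+ 2 * v / 2)).
  by rewrite normal_prob_cos// sqr_sqrtr.
apply: (@law_unique Q (normal_prob 0 (Num.sqrt v))) => //; try exact: second.
by move=> a th; rewrite Qcos ncos.
Qed.

End LawOnTheLine.

Section GaussianVectors.
Context {R : realType}.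

(** Gaussian vectors by their characteristic function. A cosine with a phase
    avoids complex-valued integrals: th = 0 and th = - pi / 2 give the real
    and the imaginary part. *)
Definition gauss_cos d (T : measurableType d) (P : probability T R) n
    (Z : T -> 'rV[R]_n) (S : 'M[R]_n) :=
  (forall i, measurable_fun setT (fun w => Z w 0 i)) /\
  forall t th, \int[P]_w cos (dot t (Z w) + th) =
    cos th * expR (- (dot (t *m S) t / 2)).

Lemma gauss_cos_normal_vector d (T : measurableType d) (P : probability T R) n
    (Z : T -> 'rV[R]_n) (S : 'M[R]_n) : psd S -> gauss_cos P Z S -> normal_vector P S Z.
Proof.
move=> Sp [mZ cf]; split=> // t B mB; rewrite -dotE.
apply: (centered_normal_of_cos (xi := fun w => dot t (Z w))) => //.
- exact: measurable_dot.
- move=> a th; under eq_Rintegral do rewrite -dotZl.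
  by rewrite cf -scalemxAl dotZl dotZr mulrA -expr2.
Qed.

Section Product.
Variables (d : measure_display) (T : measurableType d) (P : probability T R).
Variables (d' : measure_display) (T' : measurableType d') (P' : probability T' R).
Local Open Scope ereal_scope.

Definition prod_prob := P \x P'.

HB.instance Definition _ := Measure.on prod_prob.

Let prod_prob_setT : prod_prob setT = 1.
Proof.
by rewrite /prod_prob -setXTT product_measure1E// -[RHS]mule1;
  congr (_ * _); exact: probability_setT.
Qed.

HB.instance Definition _ := Measure_isProbability.Build _ _ _ prod_prob prod_prob_setT.

End Product.

(** Z + xi q with xi a standard normal variable independent of Z adds q^T q
    to the covariance; independence is a product space and the cosine
    transform is computed by integrating out xi. *)
Lemma gauss_cos_exists n (qs : seq 'rV[R]_n) :
  exists (d : measure_display) (T : measurableType d) (P : probability T R)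
    (Z : T -> 'rV[R]_n), gauss_cos P Z (\sum_(q <- qs) q^T *m q).
Proof.
elim: qs => [|q qs [d [T [P [Z [mZ cf]]]]]].
  exists _, R, (\d_(0 : R)), (fun=> 0); split.
    by move=> i; under eq_fun do rewrite mxE; exact: measurable_cst.
  move=> t th; under eq_Rintegral do rewrite dot0r add0r.
  by rewrite prob_Rintegral_cst big_nil mulmx0 dot0l mul0r oppr0 expR0 mulr1.
set S := \sum_(q <- qs) _ in cf.
pose RM : measurableType _ := measurableTypeR R.
pose N : probability RM R := normal_prob (0 : R) 1.
exists _, (T * RM)%type, (prod_prob P N), (fun w => Z w.1 + (w.2 : R) *: q); split.
  move=> i; under eq_fun do rewrite !mxE.
  apply: measurable_funD.
    by apply: (measurableT_comp (mZ i)); exact: measurable_fst.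
  by apply: measurable_funM => //; exact: (@measurable_snd _ _ T RM).
move=> t th.
pose f (w : T * RM) : R := cos (dot t (Z w.1 + (w.2 : R) *: q) + th).
have mf : measurable_fun setT f.
  have : measurable_fun setT (fun w : T * RM => dot t (Z w.1) + (w.2 : R) * dot t q).
    apply: measurable_funD.
      by apply: (measurableT_comp (measurable_dot t mZ)); exact: measurable_fst.
    by apply: measurable_funM => //; exact: (@measurable_snd _ _ T RM).
  move=> /(measurable_cos_affine 1 th).
  by under eq_fun do rewrite mul1r -dotZr -dotDr.
have fi : (P \x N)%E.-integrable setT (EFin \o f).
  apply: (@bounded_integrable _ _ _ (prod_prob P N) f 1) => // x; exact: cos_max.
have inner w : (\int[N]_y (f (w, y))%:E)%E =
    (expR (- (dot t q ^+ 2 / 2)) * cos (dot t (Z w) + th))%:E.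
  have h := @normal_prob_cos R 1 (dot t q) (dot t (Z w) + th) (oner_neq0 _).
  rewrite expr1n mulr1 in h; rewrite [in RHS]mulrC -h /Rintegral fineK.
    apply: eq_integral => y _; congr (_%:E).
    by rewrite /f /= dotDr dotZr; congr cos; ring.
  apply: integrable_fin_num => //; apply: (@bounded_integrable _ _ _ N _ 1) => [|y].
      have mi : measurable_fun setT (fun y : RM => (y : R)) by exact: measurable_id.
    exact: (measurable_cos_affine (dot t q) (dot t (Z w) + th) mi).
  exact: cos_max.
rewrite -/(Rintegral _ _ f) /Rintegral -[X in fine X](integral12_prod_meas1 fi).
rewrite /fubini_F; under eq_integral do rewrite /= inner.
rewrite -/(Rintegral P setT (fun w => expR (- (dot t q ^+ 2 / 2)) * cos (dot t (Z w) + th))).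
rewrite RintegralZl//; last first.
  apply: (@bounded_integrable _ _ _ P _ 1) => [|w]; last exact: cos_max.
  have := measurable_cos_affine 1 th (measurable_dot t mZ).
  by under eq_fun do rewrite mul1r.
rewrite cf big_cons -/S mulrCA -expRD; congr (_ * expR _).
rewrite mulmxDr mulmxA dotDl.
have -> : dot (t *m q^T *m q) t = dot t q ^+ 2.
  rewrite [t *m q^T]mx11_scalar mul_scalar_mx dotZl (dotC q).
  by rewrite expr2 dotE.
by lra.
Qed.

End GaussianVectors.

(** * Expectations along the urn process *)

Section BoundedVariables.
Context d (T : measurableType d) (R : realType) (P : probability T R).
Implicit Types f g : T -> R.

(** All the functions of X_n are of this kind, as X_n takes finitely many
    values; this gives integrability without estimates. *)
Definition bounded_rv f := measurable_fun setT f /\ exists M, forall w, `|f w| <= M.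

Lemma bounded_rv_integrable f : bounded_rv f -> P.-integrable setT (EFin \o f).
Proof. by move=> [mf [M fM]]; exact: (@bounded_integrable _ _ _ P f M). Qed.

Lemma bounded_rv_cst c : bounded_rv (fun=> c).
Proof. by split; [exact: measurable_cst|exists `|c|]. Qed.

Lemma bounded_rvD f g : bounded_rv f -> bounded_rv g -> bounded_rv (fun w => f w + g w).
Proof.
move=> [mf [M fM]] [mg [N gN]]; split; first exact: measurable_funD.
by exists (M + N) => w; rewrite (le_trans (ler_normD _ _))// lerD.
Qed.

Lemma bounded_rvM f g : bounded_rv f -> bounded_rv g -> bounded_rv (fun w => f w * g w).
Proof.
move=> [mf [M fM]] [mg [N gN]]; split; first exact: measurable_funM.
by exists (M * N) => w; rewrite normrM ler_pM.
Qed.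

Lemma bounded_rv_sum (I : Type) (r : seq I) (F : I -> T -> R) :
  (forall i, bounded_rv (F i)) -> bounded_rv (fun w => \sum_(i <- r) F i w).
Proof.
move=> Fb; elim: r => [|i r IH].
  by under eq_fun do rewrite big_nil; exact: bounded_rv_cst.
by under eq_fun do rewrite big_cons; exact: bounded_rvD.
Qed.

Lemma bounded_rv_indic B : measurable B -> bounded_rv (\1_B : T -> R).
Proof.
move=> mB; split; first exact: measurable_indic.
by exists 1 => w; rewrite indicE ger0_norm// lern1 leq_b1.
Qed.

Lemma Rintegral_bounded_sum (I : Type) (r : seq I) (F : I -> T -> R) :
  (forall i, bounded_rv (F i)) ->
  \int[P]_w (\sum_(i <- r) F i w) = \sum_(i <- r) \int[P]_w F i w.
Proof.
move=> Fb; elim: r => [|i r IH].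
  by under eq_Rintegral do rewrite big_nil; rewrite prob_Rintegral_cst big_nil.
under eq_Rintegral do rewrite big_cons.
rewrite RintegralD//; first by rewrite IH big_cons.
  exact: bounded_rv_integrable.
by apply: bounded_rv_integrable; exact: bounded_rv_sum.
Qed.

Lemma Rintegral_indicator B : measurable B -> \int[P]_w (\1_B w : R) = fine (P B).
Proof. by move=> mB; rewrite /Rintegral integral_indic// setIT. Qed.

End BoundedVariables.

Section UrnExpectation.
Context d (T : measurableType d) (R : realType) (P : probability T R).
Variables (s : nat) (A : 'M[R]_s) (X0 : 'rV[R]_s) (X : nat -> T -> 'rV[R]_s).
Variable K : nat -> T -> 'I_s.

Let draw (x : 'rV[R]_s) k : R := x 0 k / \sum_(j < s) x 0 j.

Hypothesis mK : forall n k, measurable (K n @^-1` [set k]).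
Hypothesis X0E : forall w, X 0%N w = X0.
Hypothesis XS : forall n w, X n.+1 w = X n w + row (K n w) A.
Hypothesis law : forall (n : nat) (x : nat -> 'rV[R]_s) (k : 'I_s),
  let past := [set w | forall i, (i <= n)%N -> X i w = x i] in
  P (past `&` K n @^-1` [set k]) = (P past * (draw (x n) k)%:E)%E.

Let drawn n k w : R := \1_(K n @^-1` [set k]) w.

Let sum_drawn n w (F : 'I_s -> R) : \sum_k drawn n k w * F k = F (K n w).
Proof.
rewrite (bigD1 (K n w))//= big1 ?addr0 => [|k kn].
  by rewrite /drawn indicE mem_set// mul1r.
rewrite /drawn indicE memNset ?mul0r//= => h.
by rewrite h eqxx in kn.
Qed.

Lemma urn_measurable_preimage n (B : set 'rV[R]_s) : measurable (X n @^-1` B).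
Proof.
elim: n B => [|n IH] B.
  have [BX|BX] := pselect (B X0).
    rewrite (_ : _ @^-1` _ = setT)//.
    by apply/seteqP; split => w //= _; rewrite X0E.
  rewrite (_ : _ @^-1` _ = set0)//.
  by apply/seteqP; split => w //=; rewrite X0E.
rewrite (_ : _ @^-1` _ = \bigcup_(k in [set: 'I_s])
    (K n @^-1` [set k] `&` X n @^-1` [set y | B (y + row k A)])).
  by apply: fin_bigcup_measurable => [|k _]; [exact: finite_finset|exact: measurableI].
apply/seteqP; split => w /=; first by rewrite XS => h; exists (K n w).
by move=> [k _ /= [<- h]]; rewrite XS.
Qed.

Lemma urn_bounded n (g : 'rV[R]_s -> R) : bounded_rv (fun w => g (X n w)).
Proof.
split; first by move=> _ Y mY; rewrite setTI; exact: (urn_measurable_preimage n [set y | Y (g y)]).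
elim: n g => [|n IH] g; first by exists `|g X0| => w; rewrite X0E.
have {IH} h k : {M | forall w, `|g (X n w + row k A)| <= M}.
  exact: cid (IH (fun y => g (y + row k A))).
exists (\sum_k `|sval (h k)|) => w; rewrite XS (le_trans (svalP (h (K n w)) w))//.
by rewrite (le_trans (ler_norm _))// (bigD1 (K n w))//= lerDl sumr_ge0.
Qed.

Let hist j (x : nat -> 'rV[R]_s) := [set w | forall i, (i <= j)%N -> X i w = x i].

Let measurable_hist j x : measurable (hist j x).
Proof.
rewrite (_ : hist j x = \bigcap_(i in [set i | (i <= j)%N]) X i @^-1` [set x i]); last first.
  by apply/seteqP; split => w /=.
by apply: bigcap_measurableType => i _; exact: urn_measurable_preimage.
Qed.

Let bounded_drawn n k : bounded_rv (drawn n k).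
Proof. exact: bounded_rv_indic. Qed.

(** A history is split according to the finitely many values of the next
    state; repetitions among these values are removed because different
    colours may lead to the same state. *)
Let hist_split j x w : \1_(hist j x) w =
  \sum_(y <- undup [seq x j + row k A | k <- enum 'I_s])
    (\1_(hist j.+1 (fun i => if (i <= j)%N then x i else y)) w : R).
Proof.
have [hw|hw] := pselect (hist j x w); last first.
  rewrite indicE memNset// big1// => y _; rewrite indicE memNset//= => h.
  by apply: hw => i ij; rewrite h ?(leq_trans ij)// ij.
rewrite indicE mem_set// (bigD1_seq (X j.+1 w))/= ?undup_uniq//; last first.
  by rewrite mem_undup XS hw//; apply: map_f; rewrite mem_enum.
rewrite indicE mem_set => [|i]; last first.
  by rewrite leq_eqVlt ltnS; case: leqP => [ij _|ji]; [exact: hw|rewrite orbF => /eqP ->].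
rewrite big1 ?addr0// => y yX; rewrite indicE memNset//= => /(_ j.+1 (leqnn _)).
by rewrite ltnn => h; rewrite h eqxx in yX.
Qed.

(** The law of K_n is given on complete histories up to time n; summing over
    the continuations extends it to shorter histories, down to the trivial
    one. *)
Let draw_on_hist m n j x k g : (j + m = n)%N ->
  \int[P]_w (\1_(hist j x) w * (drawn n k w * g (X n w))) =
  \int[P]_w (\1_(hist j x) w * (draw (X n w) k * g (X n w))).
Proof.
elim: m j x => [|m IH] j x.
  rewrite addn0 => <-{n}.
  rewrite (@eq_Rintegral _ _ _ P _ (fun w => g (x j) * \1_(hist j x `&` K j @^-1` [set k]) w)); last first.
    move=> w _; rewrite indicI /= mulrCA [RHS]mulrA [in RHS]mulrC -!/(drawn j k w) !indicE.
    case: (boolP (w \in hist j x)) => [|_]; last by rewrite !(mul0r, mulr0).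
    by rewrite inE => hw; rewrite hw// mul1r mulr1.
  rewrite [RHS](@eq_Rintegral _ _ _ P _ (fun w => (draw (x j) k * g (x j)) * \1_(hist j x) w)); last first.
    move=> w _; rewrite !indicE.
    case: (boolP (w \in hist j x)) => [|_]; last by rewrite !mul0r mulr0.
    by rewrite inE => hw; rewrite hw// mul1r mulr1.
  have mI : measurable (hist j x `&` K j @^-1` [set k]) by exact: measurableI.
  rewrite !RintegralZl//; try by apply: bounded_rv_integrable; exact: bounded_rv_indic.
  rewrite (Rintegral_indicator P mI) (Rintegral_indicator P (measurable_hist j x)).
  have fP : P (hist j x) \is a fin_num by apply: fin_num_measure; exact: measurable_hist.
  by rewrite law fineM//=; ring.
rewrite -addSnnS => jm.
have split f : bounded_rv f -> \int[P]_w (\1_(hist j x) w * f w) =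
    \sum_(y <- undup [seq x j + row k A | k <- enum 'I_s])
      \int[P]_w (\1_(hist j.+1 (fun i => if (i <= j)%N then x i else y)) w * f w).
  move=> bf; under eq_Rintegral do rewrite hist_split mulr_suml.
  rewrite Rintegral_bounded_sum// => y; apply: bounded_rvM => //.
  by apply: bounded_rv_indic; exact: measurable_hist.
rewrite !split; last 2 first.
- exact: (urn_bounded n (fun y => draw y k * g y)).
- by apply: bounded_rvM => //; exact: urn_bounded.
by apply: eq_bigr => y _; exact: IH.
Qed.

Lemma urn_step n (g : 'rV[R]_s -> R) :
  \int[P]_w g (X n.+1 w) =
  \int[P]_w (\sum_k draw (X n w) k * g (X n w + row k A)).
Proof.
have -> : \int[P]_w g (X n.+1 w) = \int[P]_w (\sum_k drawn n k w * g (X n w + row k A)).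
  by apply: eq_Rintegral => w _; rewrite XS sum_drawn.
rewrite !Rintegral_bounded_sum; last 2 first.
- by move=> k; exact: (urn_bounded n (fun y => draw y k * g (y + row k A))).
- by move=> k; apply: bounded_rvM => //; exact: (urn_bounded n (fun y => g (y + row k A))).
apply: eq_bigr => k _.
have h := @draw_on_hist n n 0%N (fun=> X0) k (fun y => g (y + row k A)) (add0n n).
have one w : \1_(hist 0%N (fun=> X0)) w = 1 :> R.
  by rewrite indicE mem_set// => i; rewrite leqn0 => /eqP ->.
transitivity (\int[P]_w (\1_(hist 0%N (fun=> X0)) w * (drawn n k w * g (X n w + row k A)))).
  by apply: eq_Rintegral => w _; rewrite one mul1r.
by rewrite h; apply: eq_Rintegral => w _; rewrite one mul1r.
Qed.

Variables (m : R) (v : 'rV[R]_s).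
Hypotheses (A_bal : balanced A m) (m0 : 0 < m) (w00 : 0 < \sum_j X0 0 j).

Definition urn_weight n : R := \sum_j X0 0 j + n%:R * m.

Lemma urn_weightS n : urn_weight n.+1 = urn_weight n + m.
Proof. by rewrite /urn_weight -natr1 mulrDl mul1r addrA. Qed.

Lemma urn_weight_gt0 n : 0 < urn_weight n.
Proof. by rewrite ltr_pwDl// mulr_ge0// ltW. Qed.

Lemma urn_total n w : \sum_j X n w 0 j = urn_weight n.
Proof.
elim: n => [|n IH]; first by rewrite X0E /urn_weight mul0r addr0.
rewrite urn_weightS -IH -[X in _ + X](A_bal (K n w)) -big_split/=.
by apply: eq_bigr => j _; rewrite XS !mxE.
Qed.

(** On every trajectory, X_n grows at most linearly and its total exactly so.
    *)
Lemma urn_share_bound : exists C, forall n w k, `|X n w 0 k / urn_weight n| <= C.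
Proof.
pose M := \sum_i \sum_j `|A i j|.
pose N := \sum_k `|X0 0 k|.
have h n w k : `|X n w 0 k| <= N + n%:R * M.
  elim: n => [|n IH].
    by rewrite X0E mul0r addr0 /N (bigD1 k)//= lerDl sumr_ge0.
  rewrite XS !mxE (le_trans (ler_normD _ _))// -natr1 mulrDl mul1r addrA lerD//.
  rewrite /M (bigD1 (K n w))//= (bigD1 k)//= -addrA lerDl addr_ge0//.
    by rewrite sumr_ge0.
  by rewrite sumr_ge0// => i _; rewrite sumr_ge0.
exists (N / \sum_j X0 0 j + M / m) => n w k.
rewrite normrM normfV (ger0_norm (ltW (urn_weight_gt0 n))) ler_pdivrMr ?urn_weight_gt0//.
apply: le_trans (h n w k) _.
have N0 : 0 <= N by exact: sumr_ge0.
have M0 : 0 <= M by apply: sumr_ge0 => i _; exact: sumr_ge0.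
rewrite mulrDl lerD//.
  rewrite mulrAC ler_pdivlMr// ler_wpM2l// /urn_weight lerDl mulr_ge0//.
  exact: ltW.
rewrite mulrAC ler_pdivlMr// mulrAC [M * _]mulrC ler_wpM2r// /urn_weight lerDr.
exact: ltW.
Qed.

Definition centered n w := X n w - urn_weight n *: v.

Lemma centered_step n (g : 'rV[R]_s -> R) :
  \int[P]_w g (centered n.+1 w) =
  \int[P]_w (\sum_k (v 0 k + centered n w 0 k / urn_weight n) *
     g (centered n w + row k (deflated A m v))).
Proof.
rewrite (urn_step n (fun y => g (y - urn_weight n.+1 *: v))).
apply: eq_Rintegral => w _; apply: eq_bigr => k _; congr (_ * g _).
  rewrite /draw urn_total /centered !mxE mulrBl [_ * v 0 k]mulrC mulfK ?gt_eqF ?urn_weight_gt0//.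
  by rewrite addrCA subrr addr0.
rewrite /centered urn_weightS deflated_row scalerDl.
by apply/rowP => j; rewrite !mxE; ring.
Qed.

End UrnExpectation.

(** * Moments of the walk with linear drift *)

Section PowerExpansion.
Context {R : realFieldType}.

(** A perturbation e of u with e^2 = O(u) changes u^(p + 1) by its first
    order term up to O(u^p). *)
Lemma pow_expansion (C : R) (p : nat) : 0 <= C -> exists2 C' : R, 0 <= C' &
  forall u e : R, 1 <= u -> e ^+ 2 <= C * u ->
  `|(u + e) ^+ p.+1 - u ^+ p.+1 - p.+1%:R * u ^+ p * e| <= C' * u ^+ p.
Proof.
move=> C0; elim: p => [|p [C' C'0 IH]].
  exists 0 => // u e _ _; rewrite !expr1 expr0 mulr1 mul1r mul0r.
  by rewrite (_ : _ - _ = 0) ?normr0//; ring.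
exists ((2 + C) * C' + p.+1%:R * C) => [|u e u1 eC].
  by rewrite addr_ge0// mulr_ge0// addr_ge0.
have u0 : 0 <= u by rewrite (le_trans _ u1).
have -> : (u + e) ^+ p.+2 - u ^+ p.+2 - p.+2%:R * u ^+ p.+1 * e =
    (u + e) * ((u + e) ^+ p.+1 - u ^+ p.+1 - p.+1%:R * u ^+ p * e) + p.+1%:R * u ^+ p * e ^+ 2.
  by rewrite -(natr1 p.+1) !exprS; ring.
rewrite (le_trans (ler_normD _ _))// [leRHS]mulrDl lerD//.
  rewrite normrM.
  have -> : (2 + C) * C' * u ^+ p.+1 = ((2 + C) * u) * (C' * u ^+ p) by rewrite exprS; ring.
  rewrite ler_pM//; last exact: IH.
  have e1 : `|e| <= 1 + e ^+ 2 by have := sqr_ge0 (`|e| - 1); rewrite -(real_normK (num_real e)); nra.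
  by rewrite (le_trans (ler_normD _ _))// (ger0_norm u0); nra.
have -> : p.+1%:R * C * u ^+ p.+1 = p.+1%:R * u ^+ p * (C * u) by rewrite exprS; ring.
have up : 0 <= p.+1%:R * u ^+ p by rewrite mulr_ge0// exprn_ge0.
by rewrite ger0_norm ?ler_wpM2l// mulr_ge0// sqr_ge0.
Qed.

Lemma pow_step_ge (w m : R) p : 0 <= w -> 0 <= m ->
  w ^+ p.+1 + p.+1%:R * m * w ^+ p <= (w + m) ^+ p.+1.
Proof.
move=> w0 m0; elim: p => [|p IH]; first by rewrite !expr1 expr0 mul1r mulr1.
rewrite [leRHS]exprS; apply: le_trans (ler_wpM2l (addr_ge0 w0 m0) IH).
have h : 0 <= m * (p.+1%:R * m * w ^+ p).
  by rewrite !mulr_ge0// exprn_ge0.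
have -> : (w + m) * (w ^+ p.+1 + p.+1%:R * m * w ^+ p) =
  w ^+ p.+2 + p.+2%:R * m * w ^+ p.+1 + m * (p.+1%:R * m * w ^+ p).
  by rewrite -(natr1 p.+1) !exprS; ring.
by rewrite lerDl.
Qed.

End PowerExpansion.

Section Chain.
Context {R : realType}.
Variables (s : nat) (v : 'rV[R]_s) (M : 'M[R]_s) (w : nat -> R) (m C0 : R).
Variable E : nat -> ('rV[R]_s -> R) -> R.
Variable supp : nat -> 'rV[R]_s -> Prop.

Definition step_weight n (y : 'rV[R]_s) k : R := v 0 k + y 0 k / w n.
Local Notation p := step_weight.

(** The properties of the centred urn D_n that the limit theorem rests on: E
    n g stands for the mean of g (D_n), [supp n] for the set of values of
    D_n, and the weights p n y k for the probabilities of the steps row k M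
    from the state y. *)
Record expectation_chain : Prop := ExpectationChain {
  chain_w_gt0 : forall n, 0 < w n;
  chain_wS : forall n, w n.+1 = w n + m;
  chain_m_gt0 : 0 < m;
  chain_cst : forall n c, E n (fun=> c) = c;
  chainD : forall n f g, E n (fun y => f y + g y) = E n f + E n g;
  chainZ : forall n a f, E n (fun y => a * f y) = a * E n f;
  chain_le : forall n f g, (forall y, supp n y -> f y <= g y) -> E n f <= E n g;
  chain_step : forall n g,
    E n.+1 g = E n (fun y => \sum_k p n y k * g (y + row k M));
  chain_p_le : forall n y k, supp n y -> `|p n y k| <= C0;
  chain_p_sum : forall n y, supp n y -> \sum_k p n y k = 1;
  chain_vM : v *m M = 0 }.

Hypothesis H : expectation_chain.

Let w0 := chain_w_gt0 H.
Let wS := chain_wS H.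
Let m0 := chain_m_gt0 H.
Let E_cst := chain_cst H.
Let E_D := chainD H.
Let E_Z := chainZ H.
Let E_le := chain_le H.
Let E_step := chain_step H.
Let p_le := chain_p_le H.
Let p_sum := chain_p_sum H.
Let vM := chain_vM H.

Lemma chain_ext n f g : (forall y, f y = g y) -> E n f = E n g.
Proof. by move=> fg; congr (E n _); apply/funext. Qed.

Lemma chain_le_norm n f g : (forall y, supp n y -> `|f y| <= g y) -> `|E n f| <= E n g.
Proof.
move=> fg; rewrite ler_norml -mulN1r -E_Z !E_le// => y sy; have := fg y sy; rewrite ler_norml ?mulN1r;
  by case/andP.
Qed.

(** v M = 0 leaves only the part of the weights that is linear in y. *)
Lemma drift (u y : 'rV[R]_s) n :
  \sum_k p n y k * dot u (row k M) = dot u (y *m M) / w n.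
Proof.
have h (x : 'rV[R]_s) : \sum_k x 0 k * dot u (row k M) = dot u (x *m M).
  rewrite [x *m M]mulmx_sum_row dot_sumr; apply: eq_bigr => k _.
  by rewrite dotZr.
under eq_bigr do rewrite mulrDl.
rewrite big_split/= h vM dot0r add0r -h mulr_suml.
by apply: eq_bigr => k _; rewrite mulrAC.
Qed.

Section Moments.
Variables (k : nat) (Q : 'M[R]_(s, k)) (b : R).
Hypotheses (b_lt : b < m / 2)
  (Qb : forall x : 'rV[R]_s, dot (x *m M *m Q) (x *m Q) <= b * dot (x *m Q) (x *m Q)).

Let U (y : 'rV[R]_s) : R := 1 + dot (y *m Q) (y *m Q).

Let U1 y : 1 <= U y.
Proof. by rewrite /U lerDl dot_ge0. Qed.

Let a' := Num.max 0 b.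

Let a'0 : 0 <= a'. Proof. by rewrite le_max lexx. Qed.

Let a'm : 2 * a' < m.
Proof.
have : a' < m / 2 by rewrite gt_max b_lt andbT divr_gt0.
by lra.
Qed.

Let e (y : 'rV[R]_s) i : R := 2 * dot (y *m Q) (row i M *m Q) + dot (row i M *m Q) (row i M *m Q).

Let U_step y i : U (y + row i M) = U y + e y i.
Proof.
by rewrite /U /e mulmxDl !dotDl !dotDr (dotC (row i M *m Q) (y *m Q)); ring.
Qed.

Let c1 : R := \sum_i dot (row i M *m Q) (row i M *m Q).

Let c1_ge i : dot (row i M *m Q) (row i M *m Q) <= c1.
Proof. by rewrite /c1 (bigD1 i)//= lerDl sumr_ge0// => j _; exact: dot_ge0. Qed.

Let c1_0 : 0 <= c1.
Proof. by rewrite sumr_ge0// => j _; exact: dot_ge0. Qed.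

Let e_sqr y i : e y i ^+ 2 <= (8 * c1 + 2 * c1 ^+ 2) * U y.
Proof.
have h1 := dot_sqr_le (y *m Q) (row i M *m Q).
have h2 := c1_ge i; have h3 := dot_ge0 (row i M *m Q); have h4 := dot_ge0 (y *m Q).
rewrite /e /U; move: (dot (y *m Q) (row i M *m Q)) (dot (row i M *m Q) _) (dot (y *m Q) (y *m Q)) h1 h2 h3 h4.
move=> x a q h1 h2 h3 h4.
have ha : a ^+ 2 <= c1 ^+ 2 by rewrite ler_sqr ?nnegrE.
have hq : q * a <= q * c1 by rewrite ler_wpM2l.
have hx := sqr_ge0 (2 * x - a); have hcq : 0 <= c1 ^+ 2 * q by rewrite mulr_ge0// sqr_ge0.
nra.
Qed.

Let drift_U n y : supp n y ->
  \sum_i p n y i * e y i <= 2 * a' / w n * U y + s%:R * (C0 * c1).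
Proof.
move=> sy; rewrite /e; under eq_bigr do rewrite mulrDr mulrCA.
rewrite big_split/= -mulr_sumr lerD//.
  have -> : \sum_i p n y i * dot (y *m Q) (row i M *m Q) = dot (y *m M *m Q) (y *m Q) / w n.
    under eq_bigr do rewrite dotC dot_mulmx dotC.
    by rewrite drift dotC -dot_mulmx.
  rewrite (_ : 2 * a' / w n * U y = 2 * (a' * U y / w n)); last by ring.
  rewrite ler_pM2l// ler_pM2r ?invr_gt0//.
  have := Qb y; have := dot_ge0 (y *m Q); rewrite /U.
  have : b <= a' by rewrite le_max lexx orbT.
  by have := a'0; move: (dot (y *m M *m Q) _) (dot _ _) => x q; nra.
have -> : s%:R * (C0 * c1) = \sum_(i < s) C0 * c1 by rewrite mulr_natl sumr_const card_ord.
apply: ler_sum => i _.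
rewrite (le_trans (ler_norm _))// normrM ler_pM//; first exact: p_le.
by rewrite ger0_norm ?dot_ge0.
Qed.

(** Let U = 1 + |y Q|^2. One step multiplies the mean of U^(r + 1) by at most
    1 + 2 a' (r + 1) / w and adds a multiple of the mean of U^r, which is
    O(w^r); since 2 a' < m, the bound B w^(r + 1) grows fast enough to absorb
    both. *)
Lemma chain_moment_bound (r : nat) :
  exists2 B : R, 0 <= B & forall n, E n (fun y => U y ^+ r) <= B * w n ^+ r.
Proof.
elim: r => [|r [B B0 IH]].
  by exists 1 => // n; rewrite (@chain_ext n _ (fun=> 1)) ?E_cst ?mul1r// expr0.
have D0 : 0 <= 8 * c1 + 2 * c1 ^+ 2.
  by rewrite addr_ge0// mulr_ge0// exprn_ge0.
have [D' D'0 hD'] := pow_expansion r D0.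
pose C3 := r.+1%:R * (s%:R * (`|C0| * c1)) + s%:R * (`|C0| * D').
have C30 : 0 <= C3 by rewrite addr_ge0// !mulr_ge0.
have step n : E n.+1 (fun y => U y ^+ r.+1) <=
    (1 + r.+1%:R * (2 * a' / w n)) * E n (fun y => U y ^+ r.+1) + C3 * E n (fun y => U y ^+ r).
  rewrite E_step -!E_Z -E_D; apply: E_le => y sy.
  have Ur0 : 0 <= U y ^+ r by rewrite exprn_ge0// (le_trans _ (U1 y)).
  pose rem i := (U y + e y i) ^+ r.+1 - U y ^+ r.+1 - r.+1%:R * U y ^+ r * e y i.
  have -> : \sum_i p n y i * U (y + row i M) ^+ r.+1 =
      U y ^+ r.+1 + r.+1%:R * U y ^+ r * (\sum_i p n y i * e y i) + \sum_i p n y i * rem i.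
    have {1}-> : U y ^+ r.+1 = \sum_i p n y i * U y ^+ r.+1 by rewrite -mulr_suml p_sum// mul1r.
    rewrite mulr_sumr -!big_split/=.
    by apply: eq_bigr => i _; rewrite U_step /rem; ring.
  have h1 : \sum_i p n y i * rem i <= s%:R * (`|C0| * D') * U y ^+ r.
    have -> : s%:R * (`|C0| * D') * U y ^+ r = \sum_(i < s) `|C0| * (D' * U y ^+ r).
      by rewrite sumr_const card_ord -mulr_natl; ring.
    apply: ler_sum => i _; rewrite (le_trans (ler_norm _))// normrM ler_pM//.
      by rewrite (le_trans (p_le i sy))// ler_norm.
    by apply: hD' => //; exact: e_sqr.
  have h2 : r.+1%:R * U y ^+ r * (\sum_i p n y i * e y i) <=
      r.+1%:R * U y ^+ r * (2 * a' / w n * U y + s%:R * (`|C0| * c1)).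
    rewrite ler_wpM2l ?mulr_ge0// (le_trans (drift_U sy))// lerD2l ler_wpM2l// ler_wpM2r//.
    exact: ler_norm.
  apply: le_trans (lerD (lerD (lexx _) h2) h1) _.
  by rewrite /C3 exprS le_eqVlt; apply/orP; left; apply/eqP; ring.
pose B' := `|E 0%N (fun y => U y ^+ r.+1)| / w 0%N ^+ r.+1 + C3 * B / (m - 2 * a').
have mB : 0 < m - 2 * a' by rewrite subr_gt0.
have B'0 : 0 <= B'.
  by rewrite addr_ge0// ?divr_ge0// ?mulr_ge0// ?exprn_ge0// ltW.
exists B' => //; elim=> [|n IHn].
  rewrite (le_trans (ler_norm _))// /B' mulrDl divfK ?gt_eqF ?exprn_gt0// lerDl.
  by rewrite mulr_ge0// ?exprn_ge0 ?(ltW (w0 _))// divr_ge0// ?mulr_ge0// ltW.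
apply: le_trans (step n) _; rewrite wS.
apply: le_trans (ler_wpM2l B'0 (pow_step_ge r (ltW (w0 n)) (ltW m0))).
have wr : 0 <= w n ^+ r by rewrite exprn_ge0// ltW.
have h1 : (1 + r.+1%:R * (2 * a' / w n)) * E n (fun y => U y ^+ r.+1) <=
    (1 + r.+1%:R * (2 * a' / w n)) * (B' * w n ^+ r.+1).
  by rewrite ler_wpM2l// addr_ge0// mulr_ge0// divr_ge0// ?mulr_ge0// ltW.
have h2 := ler_wpM2l C30 (IH n).
apply: le_trans (lerD h1 h2) _.
have -> : (1 + r.+1%:R * (2 * a' / w n)) * (B' * w n ^+ r.+1) =
    B' * w n ^+ r.+1 + r.+1%:R * (2 * a') * B' * w n ^+ r.
  by rewrite exprS; field; rewrite gt_eqF.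
have h3 : C3 * B <= (m - 2 * a') * B'.
  rewrite [leRHS]mulrC -ler_pdivrMr// /B' lerDr divr_ge0// exprn_ge0//.
  exact: ltW.
have h4 : (m - 2 * a') * B' <= r.+1%:R * ((m - 2 * a') * B').
  by rewrite ler_peMl ?mulr_ge0 ?(ltW mB)// ler1n.
have h5 : r.+1%:R * (2 * a') * B' + C3 * B <= r.+1%:R * m * B'.
  by have := le_trans h3 h4; lra.
by have := ler_wpM2r wr h5; lra.
Qed.

End Moments.

End Chain.

(** * Characteristic functions of the walk with linear drift *)

Section OneStep.
Context {R : realType}.

Lemma cos_one_step (I : finType) (p h : I -> R) (x g b : R) :
  \sum_i p i = 1 -> \sum_i p i * h i = g ->
  `|\sum_i p i * cos (x + h i) - (1 - b) * cos (x + g)| <=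
  `|b * g| + `|\sum_i p i * h i ^+ 2 - 2 * b| + \sum_i `|p i| * `|h i| ^+ 3 + `|1 - b| * g ^+ 2.
Proof.
move=> p1 pg.
pose r i := cos (x + h i) - cos x + h i * sin x + h i ^+ 2 / 2 * cos x.
pose r' := cos (x + g) - cos x + g * sin x.
have -> : \sum_i p i * cos (x + h i) - (1 - b) * cos (x + g) =
  - (b * g) * sin x - (\sum_i p i * h i ^+ 2 - 2 * b) * (cos x / 2)
  + \sum_i p i * r i - (1 - b) * r'.
  have -> : \sum_i p i * cos (x + h i) = (\sum_i p i) * cos x - (\sum_i p i * h i) * sin x
     - (\sum_i p i * h i ^+ 2) * (cos x / 2) + \sum_i p i * r i.
    rewrite !mulr_suml -!sumrB -big_split/=; apply: eq_bigr => i _.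
    by rewrite /r; field.
  by rewrite p1 pg /r'; field.
rewrite (le_trans (ler_normB _ _))// lerD//; last first.
  by rewrite normrM ler_wpM2l// -(real_normK (num_real g)); exact: cos_taylor2.
rewrite (le_trans (ler_normD _ _))// lerD//; last first.
  rewrite (le_trans (ler_norm_sum _ _ _))// ler_sum// => i _.
  by rewrite normrM ler_wpM2l//; exact: cos_taylor3.
rewrite (le_trans (ler_normB _ _))// lerD//.
  by rewrite normrM normrN ler_piMr//; exact: sin_max.
rewrite normrM ler_piMr// normrM.
have := cos_max x; rewrite (ger0_norm (x := 2^-1))//; lra.
Qed.

(** (1 - b) exp b = 1 + O(b^2). *)
Lemma expR_one_step (b rho : R) : 0 <= b <= 1 -> 0 <= rho ->
  `|(1 - b) * expR (b - rho) - 1| <= b ^+ 2 + rho.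
Proof.
move=> /andP[b0 b1] r0.
have h1 : 1 - b <= expR (- b) by have := expR_ge1Dx (- b); lra.
have h2 : 1 + b <= expR b := expR_ge1Dx b.
have h3 : 1 - rho <= expR (- rho) by have := expR_ge1Dx (- rho); lra.
have h4 : expR (- rho) <= 1 by rewrite -expR0 ler_expR oppr_le0.
have h5 : 0 < expR (- rho) := expR_gt0 _.
have h6 : expR b * expR (- b) = 1 by rewrite -expRD subrr expR0.
have h7 : 0 < expR b := expR_gt0 _.
rewrite expRD; move: (expR b) (expR (- b)) (expR (- rho)) h1 h2 h3 h4 h5 h6 h7 => x y z *.
have h8 : (1 - b) * x <= 1 by nra.
have h9 : 1 - b ^+ 2 <= (1 - b) * x by nra.
have h10 : (1 - b) * x * z <= 1 by nra.
have h11 : (1 - b ^+ 2) * z <= (1 - b) * x * z by nra.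
have h12 : z - b ^+ 2 <= (1 - b ^+ 2) * z by nra.
rewrite ler_norml; apply/andP; split; nra.
Qed.

(** W x = x^(- k) with a small exponent k <= 1 / 2: it tends to 0, but slowly
    enough to dominate 1 / sqrt x and to lose at most the factor 1 - c / x in
    one step. *)
Lemma slow_weight (m c : R) : 0 < m -> 0 < c ->
  exists W : R -> R, [/\ forall x, 0 < W x,
    forall x, 1 <= x -> (Num.sqrt x)^-1 <= W x,
    forall x, 1 <= x -> W x * (1 - c / x) <= W (x + m)
  & forall e, 0 < e -> exists x0, forall x, x0 <= x -> W x <= e].
Proof.
move=> m0 c0; pose k := Num.min (2^-1) (c / m).
have k0 : 0 < k by rewrite lt_min invr_gt0 ltr0n divr_gt0.
have kh : k <= 2^-1 by rewrite ge_min lexx.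
have km : k * m <= c by rewrite -ler_pdivlMr// ge_min lexx orbT.
exists (fun x => expR (- (k * ln x))); split.
- by move=> x; exact: expR_gt0.
- move=> x x1; have x0 : 0 < x by exact: lt_le_trans x1.
  have -> : (Num.sqrt x)^-1 = expR (- (ln x / 2)).
    rewrite expRN; congr (_^-1).
    rewrite -[in LHS](lnK (x := x)) ?posrE//.
    have -> : expR (ln x) = expR (ln x / 2) ^+ 2 by rewrite -expRM_natl; congr expR; field.
    by rewrite sqrtr_sqr ger0_norm// expR_ge0.
  by rewrite ler_expR; have := ln_ge0 x1; nra.
- move=> x x1; have x0 : 0 < x by exact: lt_le_trans x1.
  have -> : expR (- (k * ln (x + m))) = expR (- (k * ln x)) * expR (- (k * ln (1 + m / x))).
    rewrite -expRD; congr expR.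
    have -> : x + m = x * (1 + m / x) by field; rewrite gt_eqF.
    by rewrite lnM ?posrE// ?addr_gt0 ?divr_gt0//; ring.
  rewrite ler_wpM2l ?expR_ge0//.
  have h1 := expR_ge1Dx (- (k * ln (1 + m / x))).
  have h2 : ln (1 + m / x) <= m / x by rewrite le_ln1Dx// (lt_trans _ (divr_gt0 m0 x0))// ltrN10.
  have h3 : k * ln (1 + m / x) <= c / x.
    by apply: le_trans (ler_wpM2l (ltW k0) h2) _; rewrite mulrA ler_pM2r ?invr_gt0.
  by lra.
- move=> e e0; exists (expR (- (ln e / k))) => x xe.
  have x0 : 0 < x by rewrite (lt_le_trans _ xe)// expR_gt0.
  rewrite -[leRHS](lnK (x := e)) ?posrE// ler_expR lerNl.
  rewrite mulrC -ler_pdivrMr// mulNr -[leLHS]expRK ler_ln ?posrE ?expR_gt0//.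
Qed.

End OneStep.

Section CharacteristicFunction.
Context {R : realType}.
Variables (s : nat) (v : 'rV[R]_s) (M : 'M[R]_s) (w : nat -> R) (m C0 : R).
Variable E : nat -> ('rV[R]_s -> R) -> R.
Variable supp : nat -> 'rV[R]_s -> Prop.
Hypothesis H : expectation_chain v M w m C0 E supp.

Variables (k : nat) (Q : 'M[R]_(s, k)) (Q' : 'M[R]_(k, s)) (b' : R).
Hypotheses (QQ' : Q *m Q' = 1%:M) (b'm : b' < m / 2)
  (Qb : forall x : 'rV[R]_s, dot (x *m M^T *m Q) (x *m Q) <= b' * dot (x *m Q) (x *m Q)).

Variables (S B : 'M[R]_s).
Hypotheses (S_sym : S^T = S) (S_psd : psd S)
  (S_eq : M^T *m S + S *m M = m *: S - B)
  (BE : forall t : 'rV[R]_s, dot (t *m B) t = \sum_i v 0 i * dot t (row i M) ^+ 2)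
  (B_psd : psd B).

Variable CY : R.
Let Y n (y : 'rV[R]_s) : R := 1 + dot y y / w n.
Hypothesis Y_le : forall n, E n (Y n) <= CY.

Let w0 := chain_w_gt0 H.
Let wS := chain_wS H.
Let m0 := chain_m_gt0 H.
Let p := step_weight v w.

Let N2 (t : 'rV[R]_s) : R := dot (t *m Q) (t *m Q).
Let N t := Num.sqrt (N2 t).
Let form (t : 'rV[R]_s) : R := dot (t *m S) t.

Let N2_ge0 t : 0 <= N2 t. Proof. exact: dot_ge0. Qed.
Let N_ge0 t : 0 <= N t. Proof. exact: sqrtr_ge0. Qed.
Let N_sqr t : N t ^+ 2 = N2 t. Proof. by rewrite sqr_sqrtr. Qed.

Let dot_le_N2 : exists2 c, 0 <= c & forall t, dot t t <= c * N2 t.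
Proof.
have [c c0 hc] := form_bound (Q' *m Q'^T); exists c => // t.
have -> : dot t t = dot ((t *m Q) *m (Q' *m Q'^T)) (t *m Q).
  by rewrite mulmxA dot_mulmx trmxK -[t *m Q *m Q']mulmxA QQ' mulmx1.
exact: le_trans (ler_norm _) (hc _).
Qed.

(** One constant for all the elementary estimates in terms of the adapted
    norm N. *)
Let unif_bound : exists K : R, [/\ 1 <= K,
  forall t i, `|dot t (row i M)| <= K * N t,
  forall t y, dot t y ^+ 2 <= K * N2 t * dot y y,
  forall t y, dot (t *m M^T) y ^+ 2 <= K * N2 t * dot y y &
  forall t, [/\ dot (t *m B) t <= K * N2 t, form t <= K * N2 t,
    form (t *m M^T) <= K * N2 t & N2 (t *m M^T) <= K * N2 t]].
Proof.
have [c c0 hc] := dot_le_N2.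
have fb (G : 'M[R]_s) : exists2 K : R, 0 <= K & forall t, dot (t *m G) t <= K * N2 t.
  have [K K0 hK] := form_bound G; exists (K * c) => [|t]; first exact: mulr_ge0.
  by rewrite (le_trans (ler_norm _))// (le_trans (hK t))// -mulrA ler_wpM2l.
have [K1 K10 h1] := fb B; have [K2 K20 h2] := fb S.
have [K3 K30 h3] := fb (M^T *m S *m M); have [K4 K40 h4] := fb (M^T *m (Q *m Q^T) *m M).
have [K5 K50 h5] := fb (M^T *m M).
pose D := \sum_i dot (row i M) (row i M).
have D0 : 0 <= D by rewrite sumr_ge0// => i _; exact: dot_ge0.
have cD : 0 <= c * D by rewrite mulr_ge0.
pose K := 1 + c + K1 + K2 + K3 + K4 + K5 + c * D.
have big a t : a <= K -> a * N2 t <= K * N2 t by move=> ?; rewrite ler_wpM2r.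
exists K; split.
- by rewrite /K; lra.
- move=> t i; rewrite -ler_sqr ?nnegrE ?mulr_ge0//; last by rewrite /K; lra.
  rewrite real_normK ?num_real// exprMn N_sqr (le_trans (dot_sqr_le _ _))//.
  have hi : dot (row i M) (row i M) <= D.
    by rewrite /D (bigD1 i)//= lerDl sumr_ge0// => j _; exact: dot_ge0.
  have := ler_pM (dot_ge0 _) (dot_ge0 _) (hc t) hi.
  have hK : c * D <= K ^+ 2 by rewrite /K; nra.
  by move=> /le_trans; apply; rewrite mulrAC ler_wpM2r.
- move=> t y; rewrite (le_trans (dot_sqr_le _ _))// ler_wpM2r ?dot_ge0//.
  by rewrite (le_trans (hc t))// big// /K; lra.
- move=> t y; rewrite (le_trans (dot_sqr_le _ _))// ler_wpM2r ?dot_ge0//.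
  rewrite dot_mulmx trmxK dotC -[t *m M^T *m M]mulmxA.
  by rewrite (le_trans (h5 t))// big// /K; lra.
- move=> t; split.
  + by rewrite (le_trans (h1 t))// big// /K; lra.
  + by rewrite (le_trans (h2 t))// big// /K; lra.
  + have -> : form (t *m M^T) = dot (t *m (M^T *m S *m M)) t.
      by rewrite /form !mulmxA [RHS]dot_mulmx.
    by rewrite (le_trans (h3 t))// big// /K; lra.
  + have -> : N2 (t *m M^T) = dot (t *m (M^T *m (Q *m Q^T) *m M)) t.
      by rewrite /N2 !mulmxA [RHS]dot_mulmx [RHS]dot_mulmx trmxK.
    by rewrite (le_trans (h4 t))// big// /K; lra.
Qed.

(** The frequency at time n that corresponds to t at time n + 1: the drift
    adds y M / w n to the state, and the normalization changes from sqrt (w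
    n.+1) to sqrt (w n). *)
Let next n (t : 'rV[R]_s) : 'rV[R]_s :=
  (Num.sqrt (w n) / Num.sqrt (w n.+1)) *: (t + (w n)^-1 *: (t *m M^T)).

Let r_gt0 n : 0 < Num.sqrt (w n). Proof. by rewrite sqrtr_gt0. Qed.
Let r_sqr n : Num.sqrt (w n) ^+ 2 = w n. Proof. by rewrite sqr_sqrtr// ltW. Qed.

Let ratio_sqr n : (Num.sqrt (w n) / Num.sqrt (w n.+1)) ^+ 2 = w n / w n.+1.
Proof. by rewrite expr_div_n !r_sqr. Qed.

Let wn0 n : w n != 0. Proof. by rewrite gt_eqF. Qed.

(** The Lyapunov equation for S makes the form decrease by the variance of
    one step, up to O(1 / w^2). *)
Let form_next n t : form (next n t) =
  form t - dot (t *m B) t / w n.+1 + form (t *m M^T) / (w n * w n.+1).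
Proof.
have h : 2 * dot (t *m M^T *m S) t = m * form t - dot (t *m B) t.
  have h1 : dot (t *m M^T *m S) t = dot (t *m (M^T *m S)) t by rewrite mulmxA.
  have h2 : dot (t *m M^T *m S) t = dot (t *m (S *m M)) t.
    by rewrite form_sym// mulmxA dotC dot_mulmx trmxK dotC.
  rewrite mulr_natl mulr2n {1}h1 h2 -dotDl -mulmxDr S_eq mulmxBr dotDl dotNl.
  by rewrite -scalemxAr dotZl.
rewrite /form /next -scalemxAl dotZl dotZr mulrA -expr2 ratio_sqr.
rewrite mulmxDl -scalemxAl !dotDl !dotDr !dotZl !dotZr (form_sym _ (t *m M^T) S_sym).
have -> : dot (t *m B) t = m * form t - 2 * dot (t *m M^T *m S) t by rewrite h; ring.
have := wn0 n.+1; rewrite wS /form => wm; field.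
by rewrite wm wn0.
Qed.

(** The drift stretches N t by at most 1 + b' / w and the normalization
    shrinks it by about 1 - m / (2 w); the first effect is the smaller one
    because b' < m / 2. *)
Let N_next c n t : 0 < c -> 2 * b' + 2 * c <= m ->
  (forall t, N2 (t *m M^T) <= c * w n * N2 t) -> c <= w n ->
  N (next n t) <= (1 - c / (2 * w n.+1)) * N t.
Proof.
move=> c0 bc hM cw.
have wm : 0 < w n.+1 by exact: w0.
have cw' : c / (2 * w n.+1) <= 1 / 2.
  rewrite ler_pdivrMr ?mulr_gt0//.
  by have := w0 n; have := m0; rewrite wS; lra.
rewrite -ler_sqr ?nnegrE ?mulr_ge0//; last by lra.
rewrite exprMn !N_sqr.
have -> : N2 (next n t) = (w n / w n.+1) * (N2 t + 2 * dot (t *m M^T *m Q) (t *m Q) / w n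
    + N2 (t *m M^T) / w n ^+ 2).
  rewrite /N2 /next -scalemxAl dotZl dotZr mulrA -expr2 ratio_sqr.
  rewrite mulmxDl -scalemxAl !dotDl !dotDr !dotZl !dotZr (dotC (t *m Q)).
  by field; rewrite !wn0.
have h1 : 2 * dot (t *m M^T *m Q) (t *m Q) / w n <= 2 * b' / w n * N2 t.
  rewrite -!mulrA ler_pM2l// [leRHS](_ : _ = b' * N2 t / w n); last by rewrite /N2; ring.
  by rewrite ler_pM2r ?invr_gt0//; exact: Qb.
have h2 : N2 (t *m M^T) / w n ^+ 2 <= c / w n * N2 t.
  rewrite ler_pdivrMr ?exprn_gt0// (le_trans (hM t))// le_eqVlt; apply/orP; left.
  by apply/eqP; field.
have h3 : w n / w n.+1 * (N2 t + 2 * b' / w n * N2 t + c / w n * N2 t) =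
    (1 - (m - 2 * b' - c) / w n.+1) * N2 t.
  by have := wn0 n.+1; rewrite wS => wm'; field; rewrite wn0 wm'.
have wr : 0 <= w n / w n.+1 by rewrite divr_ge0// ltW.
apply: le_trans (ler_wpM2l wr (lerD (lerD (lexx _) h1) h2)) _.
rewrite h3 ler_wpM2r//.
have h4 : c / w n.+1 <= (m - 2 * b' - c) / w n.+1.
  by rewrite ler_pM2r ?invr_gt0//; lra.
have h5 : c / w n.+1 = 2 * (c / (2 * w n.+1)) by field.
have := sqr_ge0 (c / (2 * w n.+1)); lra.
Qed.

Let Phi n t th : R := E n (fun y => cos (dot t y / Num.sqrt (w n) + th)).
Let G t th : R := cos th * expR (- (form t / 2)).
Let bt n t : R := dot (t *m B) t / (2 * w n.+1).

Let Y1 n y : 1 <= Y n y.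
Proof. by rewrite /Y lerDl divr_ge0 ?dot_ge0// ltW. Qed.

Let dot_le_Y n y : dot y y <= w n * Y n y.
Proof. by rewrite /Y mulrDr mulr1 mulrC divfK// lerDr ltW. Qed.

Let coord_le_Y n (y : 'rV[R]_s) i : `|y 0 i / w n| <= Y n y / Num.sqrt (w n).
Proof.
have h : `|y 0 i| <= Num.sqrt (w n) * Y n y.
  rewrite -ler_sqr ?nnegrE ?mulr_ge0 ?(ltW (r_gt0 n)) ?(le_trans ler01 (Y1 n y))//.
  rewrite real_normK ?num_real// exprMn r_sqr.
  have h1 := coord_mul_le y i i; rewrite -expr2 ger0_norm ?sqr_ge0// in h1.
  apply: le_trans h1 (le_trans (dot_le_Y n y) _).
  rewrite ler_wpM2l ?(ltW (w0 n))// expr2 ler_peMl//.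
  exact: le_trans (Y1 n y).
rewrite normrM normfV (ger0_norm (ltW (w0 n))) ler_pdivrMr// (le_trans h)//.
have -> : Y n y / Num.sqrt (w n) * w n = Num.sqrt (w n) * Y n y; last exact: lexx.
by rewrite -[X in _ * X = _](r_sqr n); field; rewrite gt_eqF.
Qed.

Let mono_le (L nu u : R) a b : 0 <= nu <= L -> 0 <= u <= 1 ->
  nu ^+ a.+1 * u ^+ (3 + b) <= L ^+ a * (nu * u ^+ 3).
Proof.
move=> /andP[n0 nL] /andP[u0 u1].
have -> : nu ^+ a.+1 * u ^+ (3 + b) = nu ^+ a * (nu * u ^+ 3 * u ^+ b) by rewrite exprS exprD; ring.
rewrite ler_pM// ?exprn_ge0 ?mulr_ge0 ?exprn_ge0//.
  by rewrite lerXn2r// nnegrE// (le_trans n0).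
by rewrite ler_piMr ?exprn_ile1 ?mulr_ge0 ?exprn_ge0.
Qed.

(** Both the chain and its Gaussian limit satisfy, up to an error N t /
    w^(3/2), the same recursion with the factor 1 - b, where b is half the
    variance of one step at frequency t. *)
Let one_step_bound L : 0 < L -> exists C W0, forall n t th, W0 <= w n -> N t <= L ->
  [/\ 0 <= bt n t <= 1,
   `|Phi n.+1 t th - (1 - bt n t) * Phi n (next n t) th| <= C * (N t * (Num.sqrt (w n))^-1 ^+ 3)
   & `|(1 - bt n t) * G (next n t) th - G t th| <= C * (N t * (Num.sqrt (w n))^-1 ^+ 3)].
Proof.
move=> L0; have [K [K1 hK1 hK2 hK3 hK4]] := unif_bound.
have K0 : 0 <= K by exact: le_trans K1.
have CY0 : 1 <= CY.
  by apply: le_trans (Y_le 0%N); rewrite -(chain_cst H 0%N 1); apply: (chain_le H) => y _.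
pose C1 := K ^+ 2 * L ^+ 2 + s%:R * K ^+ 2 * L + s%:R * `|C0| * K ^+ 3 * L ^+ 2 + K * L.
pose C2 := K ^+ 2 * L ^+ 3 + K * L.
have C10 : 0 <= C1 by rewrite !addr_ge0// ?mulr_ge0// ?exprn_ge0// ?mulr_ge0// ltW.
have C20 : 0 <= C2 by rewrite !addr_ge0// ?mulr_ge0// ?exprn_ge0// ?mulr_ge0// ltW.
exists (C1 * CY + C2), (1 + K * L ^+ 2) => n t th wW tL.
set u := (Num.sqrt (w n))^-1; set nu := N t.
have w1 : 1 <= w n by apply: le_trans wW; rewrite lerDl mulr_ge0 ?exprn_ge0// ltW.
have u0 : 0 <= u by rewrite invr_ge0 ltW.
have u1 : u <= 1 by rewrite invf_le1//; have := ler_wsqrtr w1; rewrite sqrtr1.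
have nu0 : 0 <= nu by exact: N_ge0.
have nu01 : 0 <= nu <= L by rewrite nu0.
have u01 : 0 <= u <= 1 by rewrite u0.
have u2 : u ^+ 2 = (w n)^-1 by rewrite exprVn r_sqr.
have unu : 0 <= nu * u ^+ 3 by rewrite mulr_ge0// exprn_ge0.
have wS0 : 0 < w n.+1 by [].
have wwS : w n <= w n.+1 by rewrite wS lerDl ltW.
have rS : (Num.sqrt (w n.+1))^-1 <= u by rewrite lef_pV2 ?posrE// ler_wsqrtr.
have wSV : (w n.+1)^-1 <= u ^+ 2 by rewrite u2 lef_pV2 ?posrE.
have [hB hS hSM hNM] := hK4 t; rewrite -N_sqr -/nu in hB hS hSM hNM.
have bE : 2 * bt n t = dot (t *m B) t / w n.+1 by rewrite /bt; field; rewrite gt_eqF.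
have b0 : 0 <= bt n t by rewrite divr_ge0 ?B_psd// mulr_ge0 ?ler0n// ltW.
have bu : bt n t <= K * nu ^+ 2 * u ^+ 2.
  have : 2 * bt n t <= K * nu ^+ 2 * u ^+ 2.
    by rewrite bE ler_pM ?B_psd ?invr_ge0 ?(ltW wS0).
  by lra.
have b1 : bt n t <= 1.
  apply: (le_trans bu); rewrite u2 ler_pdivrMr// mul1r (le_trans _ wW)//.
  have : nu ^+ 2 <= L ^+ 2 by rewrite ler_sqr ?nnegrE// ltW.
  by nra.
have b1' : `|1 - bt n t| <= 1 by rewrite ger0_norm; lra.
split; first by rewrite b0.
  pose h i := dot t (row i M) / Num.sqrt (w n.+1).
  pose x y := dot t y / Num.sqrt (w n.+1) + th.
  pose g y := dot (t *m M^T) y / w n / Num.sqrt (w n.+1).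
  have point y : supp n y -> `|\sum_i p n y i * cos (x y + h i) - (1 - bt n t) * cos (x y + g y)|
      <= C1 * (nu * u ^+ 3) * Y n y.
    move=> sy; have Yy := Y1 n y; have Y0 : 0 <= Y n y by exact: le_trans Yy.
    have hsum : \sum_i p n y i * h i = g y.
      rewrite /h; under eq_bigr do rewrite mulrA.
      by rewrite -mulr_suml (drift H) /g dot_mulmx trmxK.
    have hi i : `|h i| <= K * nu * u.
      rewrite /h normrM normfV (ger0_norm (ltW (r_gt0 n.+1))) ler_pM// invr_ge0 ltW//.
    have hi2 i : h i ^+ 2 <= K ^+ 2 * nu ^+ 2 * u ^+ 2.
      by rewrite -!exprMn -(real_normK (num_real (h i))) lerXn2r ?nnegrE// !mulr_ge0.
    have gsq : g y ^+ 2 <= K * nu ^+ 2 * u ^+ 4 * Y n y.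
      have -> : g y ^+ 2 = dot (t *m M^T) y ^+ 2 * (u ^+ 4 * (w n.+1)^-1).
        have u4 : u ^+ 4 = (w n)^-1 ^+ 2 by rewrite -u2 -exprM.
        by rewrite u4 /g !exprMn !exprVn r_sqr; field; rewrite !wn0.
      have h1 := le_trans (hK3 t y) (ler_wpM2l (mulr_ge0 K0 (N2_ge0 t)) (dot_le_Y n y)).
      have h2 : 0 <= u ^+ 4 * (w n.+1)^-1 by rewrite mulr_ge0 ?exprn_ge0// invr_ge0 ltW.
      apply: le_trans (ler_wpM2r h2 h1) _.
      rewrite -N_sqr -/nu.
      have -> : K * nu ^+ 2 * (w n * Y n y) * (u ^+ 4 * (w n.+1)^-1) =
        K * nu ^+ 2 * u ^+ 4 * Y n y * (w n / w n.+1) by ring.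
      by rewrite ler_piMr ?mulr_ge0 ?exprn_ge0// ler_pdivrMr// mul1r.
    have gab : `|g y| <= K * nu * u ^+ 2 * Y n y.
      rewrite -ler_sqr ?nnegrE ?mulr_ge0 ?exprn_ge0// real_normK ?num_real//.
      apply: (le_trans gsq).
      have -> : (K * nu * u ^+ 2 * Y n y) ^+ 2 = (K * nu ^+ 2 * u ^+ 4 * Y n y) * (K * Y n y) by ring.
      by rewrite ler_peMr ?mulr_ge0 ?exprn_ge0// mulr_ege1.
    have hvar : `|\sum_i p n y i * h i ^+ 2 - 2 * bt n t| <= s%:R * (K ^+ 2 * nu ^+ 2 * u ^+ 3 * Y n y).
      have -> : \sum_i p n y i * h i ^+ 2 - 2 * bt n t = \sum_i y 0 i / w n * h i ^+ 2.
        rewrite bE BE mulr_suml -sumrB; apply: eq_bigr => i _.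
        by rewrite /p /step_weight /h exprMn exprVn r_sqr; ring.
      rewrite (le_trans (ler_norm_sum _ _ _))//.
      have -> : s%:R * (K ^+ 2 * nu ^+ 2 * u ^+ 3 * Y n y) =
          \sum_(i < s) (Y n y / Num.sqrt (w n)) * (K ^+ 2 * nu ^+ 2 * u ^+ 2).
        by rewrite sumr_const card_ord -mulr_natl -/u; ring.
      apply: ler_sum => i _; rewrite normrM (ger0_norm (sqr_ge0 _)).
      by apply: ler_pM => //; exact: sqr_ge0.
    have hcub : \sum_i `|p n y i| * `|h i| ^+ 3 <= s%:R * (`|C0| * (K ^+ 3 * nu ^+ 3 * u ^+ 3)).
      have -> : s%:R * (`|C0| * (K ^+ 3 * nu ^+ 3 * u ^+ 3)) =
          \sum_(i < s) `|C0| * (K ^+ 3 * nu ^+ 3 * u ^+ 3).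
        by rewrite mulr_natl sumr_const card_ord.
      apply: ler_sum => i _; rewrite ler_pM// ?exprn_ge0//.
        by rewrite (le_trans (chain_p_le H i sy))// ler_norm.
      by rewrite -!exprMn lerXn2r ?nnegrE// !mulr_ge0.
    apply: le_trans (cos_one_step (x y) (bt n t) (chain_p_sum H sy) hsum) _.
    have m1 := mono_le 2 1 nu01 u01; have m2 := mono_le 1 0 nu01 u01.
    have m3 := mono_le 2 0 nu01 u01; have m4 := mono_le 1 1 nu01 u01.
    rewrite ?addn0 ?expr1 in m1 m2 m3 m4.
    set q := nu * u ^+ 3 in m1 m2 m3 m4 unu *.
    have e1 : `|bt n t * g y| <= K ^+ 2 * L ^+ 2 * q * Y n y.
      rewrite normrM (ger0_norm b0).
      apply: le_trans (ler_pM b0 (normr_ge0 _) bu gab) _.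
      have -> : K * nu ^+ 2 * u ^+ 2 * (K * nu * u ^+ 2 * Y n y) =
        K ^+ 2 * (nu ^+ 3 * u ^+ (3 + 1)) * Y n y by ring.
      by rewrite -[K ^+ 2 * L ^+ 2 * q]mulrA ler_wpM2r// ler_wpM2l// exprn_ge0.
    have e2 : s%:R * (K ^+ 2 * nu ^+ 2 * u ^+ 3 * Y n y) <= s%:R * K ^+ 2 * L * q * Y n y.
      have -> : s%:R * (K ^+ 2 * nu ^+ 2 * u ^+ 3 * Y n y) =
        s%:R * K ^+ 2 * (nu ^+ 2 * u ^+ 3) * Y n y by ring.
      by rewrite -[s%:R * K ^+ 2 * L * q]mulrA ler_wpM2r// ler_wpM2l// mulr_ge0// exprn_ge0.
    have e3 : s%:R * (`|C0| * (K ^+ 3 * nu ^+ 3 * u ^+ 3)) <=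
        s%:R * `|C0| * K ^+ 3 * L ^+ 2 * q * Y n y.
      have -> : s%:R * (`|C0| * (K ^+ 3 * nu ^+ 3 * u ^+ 3)) =
        s%:R * `|C0| * K ^+ 3 * (nu ^+ 3 * u ^+ 3) by ring.
      rewrite -[s%:R * `|C0| * K ^+ 3 * L ^+ 2 * q]mulrA.
      have c0 : 0 <= s%:R * `|C0| * K ^+ 3 by rewrite !mulr_ge0// exprn_ge0.
      apply: le_trans (ler_wpM2l c0 m3) _.
      by rewrite ler_peMr// mulr_ge0// mulr_ge0// exprn_ge0// ltW.
    have e4 : `|1 - bt n t| * g y ^+ 2 <= K * L * q * Y n y.
      apply: le_trans (ler_wpM2r (sqr_ge0 _) b1') _; rewrite mul1r.
      apply: (le_trans gsq).
      have -> : K * nu ^+ 2 * u ^+ 4 * Y n y = K * (nu ^+ 2 * u ^+ (3 + 1)) * Y n y by ring.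
      by rewrite -[K * L * q]mulrA ler_wpM2r// ler_wpM2l.
    have -> : C1 * q * Y n y = K ^+ 2 * L ^+ 2 * q * Y n y + s%:R * K ^+ 2 * L * q * Y n y
      + s%:R * `|C0| * K ^+ 3 * L ^+ 2 * q * Y n y + K * L * q * Y n y by rewrite /C1; ring.
    by rewrite lerD// lerD// ?(le_trans hcub)// lerD// (le_trans hvar).
  have -> : Phi n.+1 t th - (1 - bt n t) * Phi n (next n t) th =
      E n (fun y => \sum_i p n y i * cos (x y + h i) - (1 - bt n t) * cos (x y + g y)).
    have EB f1 f2 a : E n (fun y => f1 y - a * f2 y) = E n f1 - a * E n f2.
      by rewrite -mulNr -(chainZ H) -(chainD H); apply: chain_ext => y; rewrite mulNr.
    rewrite EB; congr (_ - _ * _).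
      rewrite /Phi (chain_step H); apply: chain_ext => y; apply: eq_bigr => i _.
      by rewrite /x /h dotDr; congr (_ * cos _); ring.
    apply: chain_ext => y; congr cos.
    rewrite /x /g /next dotZl dotDl dotZl; field.
    by rewrite !gt_eqF.
  have c0 : 0 <= C1 * (nu * u ^+ 3) by rewrite mulr_ge0.
  apply: le_trans (chain_le_norm H point) _; rewrite (chainZ H).
  apply: le_trans (ler_wpM2l c0 (Y_le n)) _.
  by rewrite [leLHS]mulrAC [leRHS]mulrDl lerDl mulr_ge0.
have rho0 : 0 <= form (t *m M^T) / (2 * w n * w n.+1).
  by rewrite divr_ge0 ?S_psd// !mulr_ge0// ltW.
have b01 : 0 <= bt n t <= 1 by rewrite b0.
have -> : (1 - bt n t) * G (next n t) th - G t th =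
  cos th * expR (- (form t / 2)) *
    ((1 - bt n t) * expR (bt n t - form (t *m M^T) / (2 * w n * w n.+1)) - 1).
  have -> : G (next n t) th = cos th * expR (- (form t / 2)) *
      expR (bt n t - form (t *m M^T) / (2 * w n * w n.+1)).
    rewrite /G -mulrA -expRD form_next; congr (_ * expR _).
    by rewrite /bt; field; rewrite !wn0.
  by rewrite /G; ring.
rewrite normrM.
have hc : `|cos th * expR (- (form t / 2))| <= 1.
  rewrite normrM (ger0_norm (expR_ge0 _)) mulr_ile1 ?expR_ge0 ?cos_max//.
  by rewrite -expR0 ler_expR oppr_le0 divr_ge0//; exact: S_psd.
apply: le_trans (ler_pM (normr_ge0 _) (normr_ge0 _) hc (expR_one_step b01 rho0)) _.
rewrite mul1r.
have m1 := mono_le 3 1 nu01 u01; have m2 := mono_le 1 1 nu01 u01.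
rewrite ?expr1 in m1 m2.
set q := nu * u ^+ 3 in m1 m2 unu *.
have e1 : bt n t ^+ 2 <= K ^+ 2 * L ^+ 3 * q.
  have : bt n t ^+ 2 <= (K * nu ^+ 2 * u ^+ 2) ^+ 2.
    by rewrite lerXn2r ?nnegrE// !mulr_ge0// exprn_ge0.
  move=> /le_trans; apply.
  have -> : (K * nu ^+ 2 * u ^+ 2) ^+ 2 = K ^+ 2 * (nu ^+ 4 * u ^+ (3 + 1)) by ring.
  by rewrite -mulrA ler_wpM2l// exprn_ge0.
have e2 : form (t *m M^T) / (2 * w n * w n.+1) <= K * L * q.
  have h1 : (2 * w n * w n.+1)^-1 <= u ^+ 4.
    have -> : (2 * w n * w n.+1)^-1 = 2^-1 * (u ^+ 2 * (w n.+1)^-1).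
      by rewrite u2; field; rewrite !wn0.
    have h : u ^+ 2 * (w n.+1)^-1 <= u ^+ 2 * u ^+ 2 by rewrite ler_wpM2l// exprn_ge0.
    have h' : 0 <= u ^+ 4 by rewrite exprn_ge0.
    by move: h; rewrite -exprD; lra.
  have h2 : 0 <= (2 * w n * w n.+1)^-1 by rewrite invr_ge0 !mulr_ge0// ltW.
  apply: le_trans (ler_pM (S_psd _) h2 hSM h1) _.
  by have := ler_wpM2l K0 m2; rewrite !mulrA.
have h : C2 * q <= (C1 * CY + C2) * q.
  by rewrite ler_wpM2r// lerDr mulr_ge0// (le_trans ler01).
by apply: le_trans h; rewrite [leRHS]mulrDl lerD.
Qed.

Let base_bound L n : 0 < L -> exists D, forall t th, N t <= L ->
  `|Phi n t th - G t th| <= D * N t.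
Proof.
move=> L0; have [K [K1 hK1 hK2 hK3 hK4]] := unif_bound.
have K0 : 0 <= K by exact: le_trans K1.
exists (K * CY + K * L) => t th tL.
have nu0 : 0 <= N t by exact: N_ge0.
have h1 : `|Phi n t th - cos th| <= K * CY * N t.
  have -> : Phi n t th - cos th = E n (fun y => cos (dot t y / Num.sqrt (w n) + th) - cos th).
    by rewrite (chainD H) (chain_cst H).
  have point y : supp n y -> `|cos (dot t y / Num.sqrt (w n) + th) - cos th| <= K * N t * Y n y.
    move=> _; rewrite (addrC _ th) (le_trans (cos_taylor1 _ _))//.
    rewrite -ler_sqr ?nnegrE ?mulr_ge0// ?(le_trans ler01 (Y1 n y))//.
    rewrite real_normK ?num_real// exprMn exprVn r_sqr ler_pdivrMr//.
    apply: le_trans (hK2 t y) _.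
    apply: le_trans (ler_wpM2l (mulr_ge0 K0 (N2_ge0 t)) (dot_le_Y n y)) _.
    rewrite -N_sqr.
    have -> : (K * N t * Y n y) ^+ 2 * w n = K * N t ^+ 2 * (w n * Y n y) * (K * Y n y) by ring.
    have hY : 0 <= Y n y by exact: le_trans (Y1 n y).
    by rewrite ler_peMr ?mulr_ge0 ?exprn_ge0 ?(ltW (w0 n))// mulr_ege1.
  apply: le_trans (chain_le_norm H point) _; rewrite (chainZ H) [leRHS]mulrAC.
  by rewrite ler_wpM2l// mulr_ge0.
have h2 : `|cos th - G t th| <= K * L * N t.
  have S0 : 0 <= form t by exact: S_psd.
  have -> : cos th - G t th = cos th * (1 - expR (- (form t / 2))) by rewrite /G; ring.
  have e1 : expR (- (form t / 2)) <= 1 by rewrite -[leRHS]expR0 ler_expR; lra.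
  have e2 := expR_ge1Dx (- (form t / 2)).
  have [_ hS _ _] := hK4 t; rewrite -N_sqr in hS.
  rewrite normrM (ger0_norm (x := 1 - _)); last by lra.
  apply: le_trans (ler_piMl _ (cos_max th)) _; first by lra.
  have h3 : K * N t ^+ 2 <= K * L * N t by rewrite expr2 mulrA ler_wpM2r// ler_wpM2l.
  by lra.
rewrite mulrDl; have := lerD h1 h2; apply: le_trans.
by apply: le_trans (ler_normD _ _); rewrite addrA subrK.
Qed.

Let weight_tends x : \forall n \near \oo, x <= w n.
Proof.
have wE n : w n = w 0%N + n%:R * m.
  by elim: n => [|i IH]; rewrite ?mul0r ?addr0// wS IH -natr1; ring.
near=> n.
rewrite wE; have : x / m <= n%:R by near: n; exact: nbhs_infty_ger.
by rewrite ler_pdivrMr//; have := w0 0%N; lra.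
Unshelve. all: by end_near. Qed.

(** By induction on n, the distance at frequency t is at most F (N t) W (w
    n). The factor N t, and not merely a bound on it, is what makes the
    contraction of the frequencies effective; this gain of order 1 / w covers
    the loss of W in one step and the new error. *)
Lemma chain_cf_cvg t th : Phi n t th @[n --> \oo] --> G t th.
Proof.
pose L := 1 + N t; have L0 : 0 < L by rewrite ltr_pwDl.
have [C [x1 step]] := one_step_bound L0.
have [K [K1 _ _ _ hK4]] := unif_bound.
pose c := Num.min ((m - 2 * b') / 2) 1.
have c0 : 0 < c by rewrite lt_min ltr01 andbT; have := b'm; lra.
have cb : 2 * b' + 2 * c <= m.
  have : c <= (m - 2 * b') / 2 by rewrite ge_min lexx.
  by lra.
have [W [W0 Wsqrt WS Wlim]] := slow_weight m0 (divr_gt0 c0 (ltr0n R 8)).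
pose x0 := 1 + `|x1| + m + K / c.
have Kc : 0 <= K / c by rewrite divr_ge0 ?(ltW c0)// (le_trans ler01).
have [n0 _ hn0] := weight_tends x0.
have [D hD] := base_bound n0 L0.
pose F := `|D| / W (w n0) + 16 * `|C| / c.
have F0 : 0 <= F by rewrite addr_ge0// divr_ge0 ?mulr_ge0// ltW.
have base t' th' : N t' <= L -> `|Phi n0 t' th' - G t' th'| <= F * N t' * W (w n0).
  move=> t'L; apply: le_trans (hD _ _ t'L) _; rewrite mulrAC ler_wpM2r//.
  rewrite /F mulrDl divfK ?gt_eqF// (le_trans (ler_norm _))// lerDl.
  by rewrite mulr_ge0 ?divr_ge0 ?mulr_ge0// ltW.
have main n : (n0 <= n)%N -> forall t' th', N t' <= L ->
    `|Phi n t' th' - G t' th'| <= F * N t' * W (w n).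
  elim: n => [|n IH] n0n t' th' t'L.
    by move: n0n base; rewrite leqn0 => /eqP -> base; exact: base.
  move: n0n; rewrite leq_eqVlt => /predU1P[<-|]; first exact: base.
  rewrite ltnS => n0n; have := hn0 n n0n; rewrite /x0 => wx0.
  have x1a := ler_norm x1; have x1b := normr_ge0 x1.
  have m0' : 0 < m by [].
  have x1w : x1 <= w n by lra.
  have [/andP[b0 b1] hPhi hG] := step n t' th' x1w t'L.
  have w1 : 1 <= w n by lra.
  have wm : m <= w n by lra.
  have Kw : K <= c * w n by rewrite mulrC -ler_pdivrMr//; lra.
  have hN : N (next n t') <= (1 - c / (2 * w n.+1)) * N t'.
    apply: N_next => // [t''|]; last by rewrite (le_trans _ w1)// ge_min lexx orbT.
    have [_ _ _ h] := hK4 t''; apply: (le_trans h).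
    by rewrite ler_wpM2r.
  have nu0 : 0 <= N t' by exact: N_ge0.
  have cw0 : 0 <= c / (2 * w n.+1) by rewrite divr_ge0 ?(ltW c0)// mulr_ge0// ltW.
  have nextL : N (next n t') <= L.
    by apply: le_trans hN (le_trans _ t'L); rewrite ler_piMl// gerBl.
  have hIH := IH n0n (next n t') th' nextL.
  have hIH' : `|(1 - bt n t') * (Phi n (next n t') th' - G (next n t') th')| <=
      F * ((1 - c / (2 * w n.+1)) * N t') * W (w n).
    rewrite normrM ger0_norm ?subr_ge0//.
    apply: le_trans (ler_piMl (normr_ge0 _) _) _; first by rewrite gerBl.
    by apply: (le_trans hIH); rewrite ler_wpM2r ?(ltW (W0 _))// ler_wpM2l.
  have tri : `|Phi n.+1 t' th' - G t' th'| <=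
      C * (N t' * (Num.sqrt (w n))^-1 ^+ 3) +
      F * ((1 - c / (2 * w n.+1)) * N t') * W (w n) +
      C * (N t' * (Num.sqrt (w n))^-1 ^+ 3).
    have -> : Phi n.+1 t' th' - G t' th' =
      (Phi n.+1 t' th' - (1 - bt n t') * Phi n (next n t') th') +
      (1 - bt n t') * (Phi n (next n t') th' - G (next n t') th') +
      ((1 - bt n t') * G (next n t') th' - G t' th') by ring.
    rewrite (le_trans (ler_normD _ _))// lerD//.
    by rewrite (le_trans (ler_normD _ _))// lerD.
  apply: (le_trans tri).
  have FN : 0 <= F * N t' by rewrite mulr_ge0.
  have hW : W (w n) * (1 - c / 8 / w n) <= W (w n.+1) by rewrite wS; exact: WS.
  apply: le_trans (ler_wpM2l FN hW).
  have hu : C * (N t' * (Num.sqrt (w n))^-1 ^+ 3) <= `|C| * N t' * (W (w n) / w n).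
    rewrite mulrA; apply: le_trans (_ : `|C| * N t' * (Num.sqrt (w n))^-1 ^+ 3 <= _).
      by rewrite ler_wpM2r ?exprn_ge0 ?invr_ge0 ?(ltW (r_gt0 n))// ler_wpM2r// ler_norm.
    rewrite ler_wpM2l ?mulr_ge0// exprS exprVn r_sqr ler_pM2r ?invr_gt0//.
    exact: Wsqrt.
  have hc : c / (4 * w n) <= c / (2 * w n.+1).
    rewrite ler_pM2l// lef_pV2 ?posrE ?mulr_gt0// wS; lra.
  have hF : `|C| * 16 / c <= F by rewrite /F [`|C| * _]mulrC lerDr divr_ge0// ltW.
  have NW : 0 <= N t' * (W (w n) / w n) by rewrite mulr_ge0// divr_ge0// ltW.
  have h1 : F * ((1 - c / (2 * w n.+1)) * N t') * W (w n) <=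
      F * ((1 - c / (4 * w n)) * N t') * W (w n).
    rewrite ler_wpM2r ?(ltW (W0 _))// ler_wpM2l// ler_wpM2r//; lra.
  have h2 : 2 * `|C| * (N t' * (W (w n) / w n)) <= F * c / 8 * (N t' * (W (w n) / w n)).
    rewrite ler_wpM2r//; move: hF; rewrite ler_pdivrMr//; lra.
  have h3 : F * ((1 - c / (4 * w n)) * N t') * W (w n) + F * c / 8 * (N t' * (W (w n) / w n))
      = F * N t' * (W (w n) * (1 - c / 8 / w n)) by field.
  by rewrite -h3; lra.
apply/cvgrPdist_le => e e0.
have [y0 hy0] := Wlim (e / (1 + F * N t)) (divr_gt0 e0 (ltr_pwDl ltr01 (mulr_ge0 F0 (N_ge0 t)))).
near=> n.
have n0n : (n0 <= n)%N by near: n; exact: nbhs_infty_ge.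
have tL : N t <= L by rewrite /L lerDr.
rewrite distrC; apply: le_trans (main n n0n t th tL) _.
have FN : 0 <= F * N t by rewrite mulr_ge0.
have hW : W (w n) <= e / (1 + F * N t) by apply: hy0; near: n; exact: weight_tends.
apply: le_trans (ler_wpM2l FN hW) _.
rewrite mulrCA ler_piMr ?(ltW e0)// ler_pdivrMr ?mul1r ?lerDr//.
by rewrite ltr_pwDl.
Unshelve. all: by end_near. Qed.

End CharacteristicFunction.

(** * From characteristic functions and moments to convergence *)

Section Truncation.
Context {R : realType}.

Definition clamp (L x : R) : R := Num.max (- L) (Num.min L x).

Lemma clamp_le L x : 0 <= L -> `|clamp L x| <= L.
Proof.
move=> L0; rewrite /clamp ler_norml le_max lexx/= ge_max ge_min lexx andbT.
by rewrite lerNl (le_trans _ L0)// oppr_le0.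
Qed.

Lemma clamp_dist L x : 0 < L -> `|x - clamp L x| <= L^-1 * x ^+ 2.
Proof.
move=> L0; rewrite mulrC ler_pdivlMr// /clamp.
case: (leP L x) => Lx.
  have -> : Num.max (- L) L = L by apply/max_idPr; lra.
  by rewrite ger0_norm; nra.
case: (leP (- L) x) => Lx'; last by rewrite ler0_norm; nra.
by rewrite subrr normr0 mul0r sqr_ge0.
Qed.

Lemma continuous_min_comp (V : topologicalType) (f : V -> R) (L : R) :
  continuous f -> continuous (fun x => Num.min (f x) L).
Proof. by move=> cf x; exact: (@continuous_min R V f (cst L) x (cf x) (cvg_cst _)). Qed.

Lemma continuous_clamp_comp (V : topologicalType) (f : V -> R) (L : R) :
  continuous f -> continuous (fun x => clamp L (f x)).
Proof.
move=> cf x.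
have h1 : {for x, continuous (fun x => Num.min L (f x))}.
  exact: (@continuous_min R V (cst L) f x (cvg_cst _) (cf x)).
exact: (@continuous_max R V (cst (- L)) _ x (cvg_cst _) h1).
Qed.

(** Monotone convergence. *)
Lemma integrable_of_truncations d (T : measurableType d) (P : probability T R)
    (f : T -> R) (B : R) :
  measurable_fun setT f -> (forall w, 0 <= f w) ->
  (forall k : nat, \int[P]_w Num.min (f w) k%:R <= B) ->
  P.-integrable setT (EFin \o f) /\ \int[P]_w f w <= B.
Proof.
move=> mf f0 fB.
pose g (k : nat) w := (Num.min (f w) k%:R)%:E.
have mg k : measurable_fun setT (g k).
  by apply/measurable_EFinP; apply: measurable_minr.
have g0 k w : (0 <= g k w)%E by rewrite lee_fin le_min f0 ler0n.
have gE k : (\int[P]_w g k w = (\int[P]_w Num.min (f w) k%:R)%:E)%E.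
  rewrite /Rintegral fineK//; apply: integrable_fin_num => //.
  apply: (@bounded_integrable _ _ _ P _ k%:R) => [|w]; first exact: measurable_minr.
  by rewrite ger0_norm ?le_min ?f0 ?ler0n// ge_min lexx orbT.
have lim : (\int[P]_w g k w @[k --> \oo] --> \int[P]_w (f w)%:E)%E.
  have := @cvg_monotone_convergence _ _ _ P setT measurableT g mg (fun k w _ => g0 k w).
  rewrite (eq_integral (fun w => (f w)%:E)) => [|w _].
    apply=> w _ a b ab; rewrite lee_fin le_min ge_min lexx/= ge_min ler_nat ab orbT.
    by [].
  apply/cvg_lim => //; apply: cvg_near_cst; near=> k.
  by rewrite /g min_l//; near: k; exact: nbhs_infty_ger.
have le : (\int[P]_w (f w)%:E <= B%:E)%E.
  rewrite -(cvg_lim _ lim)//; apply: lime_le; first by apply/cvg_ex; eexists; exact: lim.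
  by apply: nearW => k; rewrite gE lee_fin.
have fi : P.-integrable setT (EFin \o f).
  apply/integrableP; split; first exact/measurable_EFinP.
  rewrite (eq_integral (fun w => (f w)%:E)) => [|w _]; last by rewrite /= ger0_norm.
  exact: le_lt_trans le (ltry _).
split=> //; rewrite -lee_fin /Rintegral fineK//; exact: integrable_fin_num.
Unshelve. all: by end_near. Qed.

End Truncation.

Section MethodOfMoments.
Context {R : realType} (n : nat).
Context d (T : measurableType d) (P : probability T R).
Context d' (T' : measurableType d') (P' : probability T' R).
Variables (Y : nat -> T -> 'rV[R]_n) (Z : T' -> 'rV[R]_n) (S : 'M[R]_n).
Hypotheses (bY : forall k (g : 'rV[R]_n -> R), bounded_rv (fun w => g (Y k w)))
  (Zcos : gauss_cos P' Z S) (S_psd : psd S) (S_sym : S^T = S).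
Hypothesis cf : forall t th,
  \int[P]_w cos (dot t (Y k w) + th) @[k --> \oo] --> \int[P']_w cos (dot t (Z w) + th).
Hypothesis moments : forall r, exists B, forall k,
  \int[P]_w ((1 + dot (Y k w) (Y k w)) ^+ r) <= B.

Let iY k g : P.-integrable setT (EFin \o (fun w => g (Y k w))).
Proof. by apply: bounded_rv_integrable; exact: bY. Qed.

Let mZ := proj1 Zcos.

Lemma gauss_second_moment t : P'.-integrable setT (EFin \o (fun w => dot t (Z w) ^+ 2)) /\
  \int[P']_w (dot t (Z w) ^+ 2) = dot (t *m S) t.
Proof.
apply: second_moment_of_cos; [exact: measurable_dot|exact: S_psd|move=> a].
have := (proj2 Zcos) (a *: t) 0.
rewrite cos0 mul1r -scalemxAl dotZl dotZr mulrA -expr2 => <-.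
by apply: eq_Rintegral => w _; rewrite addr0 dotZl.
Qed.

Let iZ2 i : P'.-integrable setT (EFin \o (fun w => Z w 0 i ^+ 2)).
Proof. by have [h _] := gauss_second_moment (delta_mx 0 i); under eq_fun do rewrite -dot_delta. Qed.

Let iZZ : P'.-integrable setT (EFin \o (fun w => dot (Z w) (Z w))).
Proof.
have := @integrable_sum _ _ _ P' setT measurableT _ (index_enum 'I_n) xpredT
  (fun i => EFin \o (fun w => Z w 0 i ^+ 2)) (fun i _ => iZ2 i).
apply: eq_integrable => // w _; rewrite /= /dot sumEFin.
by congr (_%:E); apply: eq_bigr => i _; rewrite expr2.
Qed.

Let iZb (f : 'rV[R]_n -> R) (M : R) : continuous f -> (forall x, `|f x| <= M) ->
  P'.-integrable setT (EFin \o (fun w => f (Z w))).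
Proof.
move=> c fM; apply: (@bounded_integrable _ _ _ P' _ M) => //.
exact: measurable_continuous_comp fM.
Qed.

Let iZt g : trigpoly g -> P'.-integrable setT (EFin \o (fun w => g (Z w))).
Proof.
move=> tg; have [M gM] := trigpoly_bounded tg.
apply: (@bounded_integrable _ _ _ P' _ M) => //.
exact: measurable_trigpoly_comp.
Qed.

Lemma cvg_trigpoly g : trigpoly g ->
  \int[P]_w g (Y k w) @[k --> \oo] --> \int[P']_w g (Z w).
Proof.
elim=> {g} [t th|f g tf IHf tg IHg|a f tf IHf]; first exact: cf.
- rewrite RintegralD//; try exact: iZt.
  under eq_fun do rewrite (RintegralD measurableT (iY _ f) (iY _ g)).
  exact: cvgD.
- rewrite RintegralZl//; last exact: iZt.
  under eq_fun do rewrite (RintegralZl _ measurableT (iY _ f)).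
  by apply: cvgM => //; exact: cvg_cst.
Qed.

Lemma cvg_bounded_continuous (f : 'rV[R]_n -> R) (M : R) :
  continuous f -> (forall x, `|f x| <= M) ->
  \int[P]_w f (Y k w) @[k --> \oo] --> \int[P']_w f (Z w).
Proof.
move=> c fM; have [B hB] := moments 1.
have i1 : P'.-integrable setT (EFin \o (fun=> 1 : R)).
  by apply: (@bounded_integrable _ _ _ P' _ 1) => // x; rewrite normr1.
have iD : P'.-integrable setT (EFin \o (fun w => 1 + dot (Z w) (Z w))).
  exact: (integrableD measurableT i1 iZZ).
pose B' := \int[P']_w (1 + dot (Z w) (Z w)).
have B'0 : 0 <= B' by apply: Rintegral_ge0 => w _; rewrite addr_ge0// dot_ge0.
have B0 : 0 <= B.
  apply: le_trans (hB 0%N); apply: Rintegral_ge0 => w _.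
  by rewrite exprn_ge0// addr_ge0// dot_ge0.
apply/cvgrPdist_le => e e0.
pose K := 1 + B + B'; have K0 : 0 < K by rewrite /K; lra.
have eK : 0 < e / 2 / K by rewrite !divr_gt0.
have [g tg gE] := trigpoly_approx c fM eK.
have hZ : `|\int[P']_w f (Z w) - \int[P']_w g (Z w)| <= e / 2 / K * B'.
  rewrite -RintegralZl//; apply: dist_Rintegral_le => //.
  - exact: iZb fM.
  - exact: iZt.
  - exact: (integrableZl measurableT (e / 2 / K) iD).
have hY k : `|\int[P]_w f (Y k w) - \int[P]_w g (Y k w)| <= e / 2 / K * B.
  have i2 : P.-integrable setT (EFin \o (fun w => 1 + dot (Y k w) (Y k w))).
    exact: (iY k (fun y => 1 + dot y y)).
  apply: le_trans (_ : e / 2 / K * \int[P]_w (1 + dot (Y k w) (Y k w)) <= _); last first.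
    rewrite ler_wpM2l ?(ltW eK)//; have := hB k.
    by under eq_Rintegral do rewrite expr1.
  rewrite -RintegralZl//; apply: dist_Rintegral_le => //.
  exact: (integrableZl measurableT (e / 2 / K) i2).
have /cvgrPdist_le/(_ _ (divr_gt0 e0 (ltr0n R 2))) hg := cvg_trigpoly tg.
near=> k.
have hgk : `|\int[P']_w g (Z w) - \int[P]_w g (Y k w)| <= e / 2 by near: k.
rewrite (_ : _ - _ = (\int[P']_w f (Z w) - \int[P']_w g (Z w)) +
  (\int[P']_w g (Z w) - \int[P]_w g (Y k w)) +
  (\int[P]_w g (Y k w) - \int[P]_w f (Y k w))); last by ring.
have hY' := hY k; rewrite distrC in hY'.
apply: le_trans (ler_normD _ _) _; apply: le_trans (lerD (ler_normD _ _) (lexx _)) _.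
have h1 : e / 2 / K * B' + e / 2 / K * B <= e / 2.
  rewrite -mulrDr -[leRHS](divfK (lt0r_neq0 K0)) ler_wpM2l ?(ltW eK)//.
  by rewrite /K; lra.
have := lerD (lerD hZ hgk) hY'; lra.
Unshelve. all: by end_near. Qed.

(** The truncation error of f is at most f^2 / L, uniformly in n by the
    moment bounds. The same bound for Z follows from the convergence of the
    bounded truncations of f^2. *)
Lemma cvg_poly_growth (f : 'rV[R]_n -> R) (r : nat) :
  continuous f -> (forall x, f x ^+ 2 <= (1 + dot x x) ^+ r) ->
  measurable_fun setT (fun w => f (Z w)) ->
  P'.-integrable setT (EFin \o (fun w => f (Z w))) /\
  \int[P]_w f (Y k w) @[k --> \oo] --> \int[P']_w f (Z w).
Proof.
move=> c fr mf; have [B hB] := moments r.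
have f2B k : \int[P]_w (f (Y k w) ^+ 2) <= B.
  apply: le_trans (hB k); apply: le_Rintegral => //.
  - exact: (iY k (fun y => f y ^+ 2)).
  - exact: (iY k (fun y => (1 + dot y y) ^+ r)).
have B0 : 0 <= B.
  by apply: le_trans (f2B 0%N); apply: Rintegral_ge0 => w _; exact: sqr_ge0.
have [i2 Z2] : P'.-integrable setT (EFin \o (fun w => f (Z w) ^+ 2)) /\
    \int[P']_w (f (Z w) ^+ 2) <= B.
  apply: integrable_of_truncations => [|w|L]; [exact: measurable_funX|exact: sqr_ge0|].
  have cm : continuous (fun x => Num.min (f x ^+ 2) L%:R).
    apply: continuous_min_comp => x.
    by apply: (@continuous_comp _ _ _ f (fun y : R => y ^+ 2)); [exact: c|exact: exprn_continuous].
  have bm x : `|Num.min (f x ^+ 2) L%:R| <= L%:R.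
    by rewrite ger0_norm ?le_min ?sqr_ge0 ?ler0n// ge_min lexx orbT.
  have lim := cvg_bounded_continuous cm bm.
  rewrite -(cvg_lim _ lim)//; apply: limr_le; first by apply/cvg_ex; eexists; exact: lim.
  apply: nearW => k; apply: le_trans (f2B k); apply: le_Rintegral => //.
  - exact: (iY k (fun y => Num.min (f y ^+ 2) L%:R)).
  - exact: (iY k (fun y => f y ^+ 2)).
  - by move=> w _; rewrite ge_min lexx.
have i1 : P'.-integrable setT (EFin \o (fun w => 1 + f (Z w) ^+ 2)).
  have h1 : P'.-integrable setT (EFin \o (fun=> 1 : R)).
    by apply: (@bounded_integrable _ _ _ P' _ 1) => // x; rewrite normr1.
  exact: (integrableD measurableT h1 i2).
have iZ : P'.-integrable setT (EFin \o (fun w => f (Z w))).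
  apply: le_integrable i1 => //; first exact/measurable_EFinP.
  move=> w _; rewrite /= lee_fin (ger0_norm (x := 1 + _)) ?addr_ge0 ?sqr_ge0//.
  by have := sqr_ge0 (`|f (Z w)| - 1); rewrite -(real_normK (num_real (f (Z w)))); nra.
split=> //; apply/cvgrPdist_le => e e0.
pose L := 1 + 4 * B / e.
have L0 : 0 < L by rewrite ltr_pwDl// divr_ge0 ?mulr_ge0// ltW.
have LB : L^-1 * B <= e / 4.
  rewrite mulrC ler_pdivrMr// /L mulrDr mulr1.
  have -> : e / 4 * (4 * B / e) = B by field; rewrite gt_eqF.
  by rewrite lerDr divr_ge0// ltW.
have cl : continuous (fun x => clamp L (f x)) by exact: continuous_clamp_comp.
have bl x : `|clamp L (f x)| <= L by apply: clamp_le; exact: ltW.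
have hZ : `|\int[P']_w f (Z w) - \int[P']_w clamp L (f (Z w))| <= L^-1 * B.
  have Li : 0 <= L^-1 by rewrite invr_ge0 ltW.
  apply: le_trans (ler_wpM2l Li Z2); rewrite -RintegralZl//; apply: dist_Rintegral_le => //.
  - exact: (iZb cl bl).
  - exact: (integrableZl measurableT L^-1 i2).
  - by move=> w; exact: clamp_dist.
have hY k : `|\int[P]_w clamp L (f (Y k w)) - \int[P]_w f (Y k w)| <= L^-1 * B.
  have Li : 0 <= L^-1 by rewrite invr_ge0 ltW.
  have j2 := iY k (fun y => f y ^+ 2).
  rewrite distrC; apply: le_trans (ler_wpM2l Li (f2B k)); rewrite -RintegralZl//; apply: dist_Rintegral_le => //.
  - exact: (iY k (fun y => clamp L (f y))).
  - exact: (integrableZl measurableT L^-1 j2).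
  - by move=> w; exact: clamp_dist.
have /cvgrPdist_le/(_ _ (divr_gt0 e0 (ltr0n R 2))) hg := cvg_bounded_continuous cl bl.
near=> k.
have hgk : `|\int[P']_w clamp L (f (Z w)) - \int[P]_w clamp L (f (Y k w))| <= e / 2 by near: k.
rewrite (_ : _ - _ = (\int[P']_w f (Z w) - \int[P']_w clamp L (f (Z w))) +
  (\int[P']_w clamp L (f (Z w)) - \int[P]_w clamp L (f (Y k w))) +
  (\int[P]_w clamp L (f (Y k w)) - \int[P]_w f (Y k w))); last by ring.
apply: le_trans (ler_normD _ _) _; apply: le_trans (lerD (ler_normD _ _) (lexx _)) _.
have := lerD (lerD hZ hgk) (hY k); lra.
Unshelve. all: by end_near. Qed.

End MethodOfMoments.

(** * Moments of the limit *)

Section GaussianMoments.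
Context {R : realType} (n : nat).
Context d (T : measurableType d) (P : probability T R).
Variables (Z : T -> 'rV[R]_n) (S : 'M[R]_n).
Hypotheses (Zcos : gauss_cos P Z S) (S_psd : psd S) (S_sym : S^T = S).

Let mZ := proj1 Zcos.

Let second i : P.-integrable setT (EFin \o (fun w => Z w 0 i ^+ 2)) /\
  \int[P]_w (Z w 0 i ^+ 2) = S i i.
Proof.
have [h1 h2] := gauss_second_moment Zcos S_psd (delta_mx 0 i).
under eq_fun do rewrite -dot_delta; split=> //.
by rewrite h2 form_delta.
Qed.

Lemma gauss_coord_integrable i : P.-integrable setT (EFin \o (fun w => Z w 0 i)).
Proof.
have h1 : P.-integrable setT (EFin \o (fun=> 1 : R)).
  by apply: (@bounded_integrable _ _ _ P _ 1) => // x; rewrite normr1.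
have iD : P.-integrable setT (EFin \o (fun w => 1 + Z w 0 i ^+ 2)).
  exact: (integrableD measurableT h1 (second i).1).
apply: le_integrable iD => //; first exact/measurable_EFinP.
move=> w _; rewrite /= lee_fin (ger0_norm (x := 1 + _)) ?addr_ge0 ?sqr_ge0//.
by have := sqr_ge0 (`|Z w 0 i| - 1); rewrite -(real_normK (num_real (Z w 0 i))); nra.
Qed.

(** The sine of a Z_i has mean 0 and differs from a Z_i by at most (a Z_i)^2;
    divide by a small a. *)
Lemma gauss_mean i : \int[P]_w Z w 0 i = 0.
Proof.
have [i2 v2] := second i; have i1 := gauss_coord_integrable i.
apply/eqP; rewrite -normr_le0; apply/ler_addgt0Pr => e e0; rewrite add0r.
have Sii : 0 <= S i i by rewrite -v2; apply: Rintegral_ge0 => w _; exact: sqr_ge0.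
pose a := e / (1 + S i i).
have a0 : 0 < a by rewrite divr_gt0// ltr_pwDl.
have hsin : \int[P]_w sin (a * Z w 0 i) = 0.
  have := (proj2 Zcos) (a *: delta_mx 0 i) (- (pi / 2)).
  rewrite cosN cos_pihalf mul0r => <-; apply: eq_Rintegral => w _.
  by rewrite dotZl dot_delta cosBpihalf.
have isin : P.-integrable setT (EFin \o (fun w => sin (a * Z w 0 i))).
  apply: (@bounded_integrable _ _ _ P _ 1) => [|w]; last exact: sin_max.
  have := measurable_cos_affine a (- (pi / 2)) (mZ i).
  by under eq_fun do rewrite cosBpihalf.
have h : `|\int[P]_w (a * Z w 0 i) - \int[P]_w sin (a * Z w 0 i)| <= \int[P]_w (a ^+ 2 * Z w 0 i ^+ 2).
  apply: dist_Rintegral_le => //.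
  - exact: (integrableZl measurableT a i1).
  - exact: (integrableZl measurableT (a ^+ 2) i2).
  - move=> w; rewrite distrC; have := sin_taylor2 0 (a * Z w 0 i).
    by rewrite add0r sin0 cos0 subr0 mulr1 real_normK ?num_real// exprMn.
rewrite hsin subr0 (RintegralZl a measurableT i1) (RintegralZl _ measurableT i2) v2 in h.
have {}h : `|\int[P]_w Z w 0 i| <= a * S i i.
  by rewrite -(ler_pM2l a0) mulrA -expr2 -{1}(gtr0_norm a0) -normrM.
apply: (le_trans h); rewrite /a mulrAC ler_pdivrMr ?ltr_pwDl// ler_wpM2l ?(ltW e0)//.
by rewrite lerDr.
Qed.

Lemma gauss_covariance i j : \int[P]_w (Z w 0 i * Z w 0 j) = S i j.
Proof.
have [i1 v1] := gauss_second_moment Zcos S_psd (delta_mx 0 i + delta_mx 0 j).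
have [i2 v2] := gauss_second_moment Zcos S_psd (delta_mx 0 i - delta_mx 0 j).
have -> : \int[P]_w (Z w 0 i * Z w 0 j) =
   \int[P]_w (4^-1 * (dot (delta_mx 0 i + delta_mx 0 j) (Z w) ^+ 2 -
     dot (delta_mx 0 i - delta_mx 0 j) (Z w) ^+ 2)).
  by apply: eq_Rintegral => w _; rewrite !dotDl dotNl !dot_delta; field.
rewrite RintegralZl//; last exact: (integrableB measurableT i1 i2).
rewrite RintegralB// v1 v2 !mulmxDl mulNmx !dotDl !dotDr !dotNl !dotNr.
rewrite !form_delta (_ : S j i = S i j); last by rewrite -[in LHS]S_sym mxE.
by field.
Qed.

End GaussianMoments.

Lemma continuous_big_prod (R : realType) (V : topologicalType) (I : Type) (r : seq I)
    (F : I -> V -> R) :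
  (forall i, continuous (F i)) -> continuous (fun x => \prod_(i <- r) F i x).
Proof.
move=> Fc; elim: r => [|i r IH] x.
  rewrite (_ : (fun x => _) = cst 1); first exact: cvg_cst.
  by apply/funext => y; rewrite big_nil.
rewrite (_ : (fun x => _) = (fun y => F i y * \prod_(j <- r) F j y)).
  by apply: cvgM; [exact: Fc|exact: IH].
by apply/funext => y; rewrite big_cons.
Qed.

Section Monomials.
Context {R : realType} (n : nat) (alpha : 'I_n -> nat).

Lemma continuous_monomial : continuous (fun x : 'rV[R]_n => \prod_i x 0 i ^+ alpha i).
Proof.
apply: continuous_big_prod => i x.
apply: (@continuous_comp _ _ _ (fun y : 'rV[R]_n => y 0 i) (fun a : R => a ^+ alpha i)).
  exact: coord_continuous.
exact: exprn_continuous.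
Qed.

Lemma monomial_sqr_le (x : 'rV[R]_n) :
  (\prod_i x 0 i ^+ alpha i) ^+ 2 <= (1 + dot x x) ^+ (\sum_i alpha i).
Proof.
rewrite -prodrXl -prodrXr; apply: ler_prod => i _; rewrite exprAC exprn_ge0 ?sqr_ge0//=.
rewrite lerXn2r ?nnegrE ?sqr_ge0 ?addr_ge0 ?dot_ge0//.
have := coord_mul_le x i i; rewrite -expr2 ger0_norm ?sqr_ge0//; lra.
Qed.

Lemma measurable_monomial d (T : measurableType d) (Z : T -> 'rV[R]_n) :
  (forall i, measurable_fun setT (fun w => Z w 0 i)) ->
  measurable_fun setT (fun w => \prod_i Z w 0 i ^+ alpha i).
Proof.
move=> mZ; elim: (index_enum _) => [|i r IH].
  by under eq_fun do rewrite big_nil; exact: measurable_cst.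
under eq_fun do rewrite big_cons.
by apply: measurable_funM => //; exact: measurable_funX.
Qed.

End Monomials.

Section BoundedCovariance.
Context d (T : measurableType d) (R : realType) (P : probability T R).

Lemma fine_covariance_affine (f g : T -> R) (a b c : R) : bounded_rv f -> bounded_rv g ->
  fine (covariance P (fun w => a * f w + b) (fun w => a * g w + c)) =
  a ^+ 2 * (\int[P]_w (f w * g w) - \int[P]_w f w * \int[P]_w g w).
Proof.
move=> bf bg.
have bc (r : R) : bounded_rv (fun _ : T => r) by exact: bounded_rv_cst.
have iE h r : bounded_rv h -> fine 'E_P[fun w => a * h w + r] = a * \int[P]_w h w + r.
  move=> bh; have bah : bounded_rv (fun w => a * h w) by apply: bounded_rvM.
  rewrite expectation_Rintegral; last by apply: bounded_rv_integrable; exact: bounded_rvD.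
  rewrite /= RintegralD//; try exact: bounded_rv_integrable.
  by rewrite prob_Rintegral_cst RintegralZl//; exact: bounded_rv_integrable.
rewrite unlock !iE//.
set F := \int[P]_w f w; set G := \int[P]_w g w.
have bfg : bounded_rv (fun w => f w * g w) by exact: bounded_rvM.
pose h w := a ^+ 2 * ((f w * g w - G * f w) - F * g w + F * G).
rewrite [X in ('E_P[X])%E](_ : _ = h); last by apply/funext => w; rewrite /h fctE/=; ring.
have b1 : bounded_rv (fun w => f w * g w - G * f w).
  under eq_fun do rewrite -mulNr; apply: bounded_rvD => //; exact: bounded_rvM.
have b2 : bounded_rv (fun w => f w * g w - G * f w - F * g w).
  under eq_fun do rewrite -(mulNr F); apply: bounded_rvD => //; exact: bounded_rvM.
have b3 : bounded_rv (fun w => f w * g w - G * f w - F * g w + F * G) by exact: bounded_rvD.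
have bi k := @bounded_rv_integrable _ _ _ P k.
rewrite expectation_Rintegral; last by apply: bi; exact: bounded_rvM.
rewrite /= /h RintegralZl//; last exact: bi.
congr (_ * _); rewrite RintegralD//; try exact: bi.
rewrite RintegralB//; try (by apply: bi => //; exact: bounded_rvM).
rewrite RintegralB//; try (by apply: bi => //; exact: bounded_rvM).
rewrite !RintegralZl//; try exact: bi.
by rewrite prob_Rintegral_cst -/F -/G; ring.
Qed.

End BoundedCovariance.

(** * The central limit theorem for the urn *)

Section LimitCovariance.
Context {R : realType}.
Variables (s : nat) (A : 'M[R]_s) (m : R) (v : 'rV[R]_s).
Hypotheses (m0 : 0 < m) (A_bal : balanced A m) (vA : v *m A = m *: v)
  (v_sum : \sum_i v 0 i = 1) (v_ge0 : forall i, 0 <= v 0 i) (A_small : strictly_small A m).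

Let M := deflated A m v.

Definition step_covariance : 'M[R]_s := \sum_i v 0 i *: ((row i M)^T *m row i M).

Lemma step_covariance_form t :
  dot (t *m step_covariance) t = \sum_i v 0 i * dot t (row i M) ^+ 2.
Proof.
rewrite /step_covariance mulmx_sumr dotC dot_sumr; apply: eq_bigr => i _.
rewrite -scalemxAr dotZr dotC mulmxA [t *m _]mx11_scalar mul_scalar_mx dotZl -dotE.
by rewrite expr2 (dotC (row i M)).
Qed.

Lemma step_covariance_psd : psd step_covariance.
Proof.
move=> t; rewrite step_covariance_form; apply: sumr_ge0 => i _.
by rewrite mulr_ge0// sqr_ge0.
Qed.

Lemma step_covariance_sym : step_covariance^T = step_covariance.
Proof.
rewrite /step_covariance linear_sum; apply: eq_bigr => i _.
by rewrite linearZ/= trmx_mul trmxK.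
Qed.

(** N = M^T - m / 2 is stable because the spectrum of M^T lies to the left of
    m / 2, and N S + S N^T = - B is the required equation. *)
Lemma limit_form_exists : exists S : 'M[R]_s, [/\ S^T = S, psd S &
  M^T *m S + S *m M = m *: S - step_covariance].
Proof.
have [k [Q [Q' [b [bm QQ' hQ]]]]] :=
  lyapunov_norm (deflated_tr_eigenvalue A_bal v_sum m0 A_small).
have b0 : b - m / 2 < 0 by rewrite subr_lt0.
pose N := M^T - (m / 2)%:M.
have hN (x : 'rV[R]_s) : dot (x *m N *m Q) (x *m Q) <= (b - m / 2) * dot (x *m Q) (x *m Q).
  have -> : x *m N *m Q = x *m M^T *m Q - (m / 2) *: (x *m Q).
    by rewrite /N mulmxBr mul_mx_scalar mulmxBl -scalemxAl.
  by rewrite dotDl dotNl dotZl mulrBl lerD2r.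
have [S [S1 S2 S3]] := lyapunov_solve b0 QQ' hN step_covariance_sym step_covariance_psd.
exists S; split=> //.
have NT : N^T = M - (m / 2)%:M by rewrite /N linearB/= trmxK tr_scalar_mx.
move: S2; rewrite NT /N mulmxBl mulmxBr mul_scalar_mx mul_mx_scalar => h.
rewrite -h; apply/matrixP => i j; rewrite !mxE; lra.
Qed.

End LimitCovariance.

Section UrnLimit.
Context {R : realType}.
Variables (s : nat) (A : 'M[R]_s) (m : R) (v : 'rV[R]_s).
Hypotheses (m0 : 0 < m) (A_bal : balanced A m) (vA : v *m A = m *: v)
  (v_sum : \sum_i v 0 i = 1) (v_ge0 : forall i, 0 <= v 0 i) (A_small : strictly_small A m).
Context d (T : measurableType d) (P : probability T R).
Variables (X0 : 'rV[R]_s) (X : nat -> T -> 'rV[R]_s).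
Hypotheses (urn : polya_urn P A X0 X) (X00 : 0 < \sum_j X0 0 j).
Variable S : 'M[R]_s.
Hypotheses (S_sym : S^T = S) (S_psd : psd S).
Hypothesis S_eq : (deflated A m v)^T *m S + S *m deflated A m v = m *: S - step_covariance A m v.

Let M := deflated A m v.
Let w := urn_weight X0 m.
Let D := centered X0 X m v.

Let w0 n : 0 < w n. Proof. exact: urn_weight_gt0. Qed.

Lemma urn_bounded_rv n (g : 'rV[R]_s -> R) : bounded_rv (fun w => g (X n w)).
Proof. by have [K [mK X0E XS law]] := urn; exact: (urn_bounded mK X0E XS). Qed.

Let bD n (g : 'rV[R]_s -> R) : bounded_rv (fun w => g (D n w)).
Proof. exact: (urn_bounded_rv n (fun y => g (y - w n *: v))). Qed.

Definition urn_mean n (g : 'rV[R]_s -> R) : R := \int[P]_x g (D n x).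

Lemma urn_expectation_chain : exists C0,
  expectation_chain v M w m C0 urn_mean (fun n y => exists x, y = D n x).
Proof.
have [K [mK X0E XS law]] := urn.
have [C0 hC0] := urn_share_bound X0E XS m0 X00; exists C0.
have share n x k : step_weight v w n (D n x) k = X n x 0 k / w n.
  rewrite /step_weight /D /centered !mxE mulrBl [_ * v 0 k]mulrC mulfK ?gt_eqF//.
  by rewrite addrCA subrr addr0.
have iD n g : P.-integrable setT (EFin \o (fun x => g (D n x))).
  by apply: bounded_rv_integrable; exact: bD.
split=> //.
- by move=> n; rewrite /w urn_weightS.
- by move=> n c; exact: prob_Rintegral_cst.
- by move=> n f g; exact: RintegralD.
- by move=> n a f; exact: (RintegralZl a measurableT (iD n f)).
- move=> n f g fg; apply: le_Rintegral => //; try exact: iD.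
  by move=> x _; apply: fg; exists x.
- by move=> n g; exact: (centered_step mK X0E XS law).
- by move=> n y k [x ->]; rewrite share; exact: hC0.
- move=> n y [x ->]; under eq_bigr do rewrite share.
  rewrite -mulr_suml (urn_total X0E XS A_bal) divff// gt_eqF//; exact: w0.
- exact: mul_deflated.
Qed.

Lemma centered_moments r : exists2 B, 0 <= B &
  forall n, urn_mean n (fun y => (1 + dot y y) ^+ r) <= B * w n ^+ r.
Proof.
have [k [Q [Q' [b [bm QQ' hQ]]]]] :=
  lyapunov_norm (deflated_eigenvalue A_bal v_sum m0 A_small).
have [C0 chain] := urn_expectation_chain.
have [B B0 hB] := chain_moment_bound chain bm hQ r.
have [c c0 hc] := form_bound (Q' *m Q'^T).
have le1 (y : 'rV[R]_s) : 1 + dot y y <= (1 + c) * (1 + dot (y *m Q) (y *m Q)).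
  have -> : dot y y = dot ((y *m Q) *m (Q' *m Q'^T)) (y *m Q).
    by rewrite mulmxA dot_mulmx trmxK -[y *m Q *m Q']mulmxA QQ' mulmx1.
  have := le_trans (ler_norm _) (hc (y *m Q)).
  have := dot_ge0 (y *m Q); move: (dot _ _) (dot (y *m Q) _) => a q; nra.
exists ((1 + c) ^+ r * B) => [|n]; first by rewrite mulr_ge0// exprn_ge0// addr_ge0.
have c1 : 0 <= (1 + c) ^+ r by rewrite exprn_ge0// addr_ge0.
rewrite -mulrA; apply: le_trans (ler_wpM2l c1 (hB n)).
rewrite -(chainZ chain n ((1 + c) ^+ r)).
apply: (chain_le chain) => y _; rewrite -exprMn lerXn2r ?nnegrE ?addr_ge0 ?dot_ge0//.
by rewrite mulr_ge0// addr_ge0// dot_ge0.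
Qed.

Lemma centered_cf t th :
  urn_mean n (fun y => cos (dot t y / Num.sqrt (w n) + th)) @[n --> \oo] -->
  cos th * expR (- (dot (t *m S) t / 2)).
Proof.
have [k [Q [Q' [b [bm QQ' hQ]]]]] :=
  lyapunov_norm (deflated_tr_eigenvalue A_bal v_sum m0 A_small).
have [C0 chain] := urn_expectation_chain.
have [B B0 hB] := centered_moments 1.
apply: (chain_cf_cvg chain QQ' bm hQ S_sym S_psd S_eq _ _ (CY := 1 + B)).
- exact: step_covariance_form.
- exact: step_covariance_psd.
move=> n; rewrite (chainD chain) (chain_cst chain) lerD2l.
rewrite (@chain_ext _ _ _ _ _ (fun y => (w n)^-1 * dot y y)) => [|y]; last exact: mulrC.
rewrite (chainZ chain) mulrC ler_pdivrMr//.
have := hB n; rewrite expr1; apply: le_trans; apply: (chain_le chain) => y _.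
by rewrite expr1 lerDr.
Qed.

Let Y (n : nat) (x : T) : 'rV[R]_s := (Num.sqrt n%:R)^-1 *: (X n x - (n%:R * m) *: v).
Let w00 := \sum_j X0 0 j.

Let YE n x : Y n x = (Num.sqrt n%:R)^-1 *: (D n x + w00 *: v).
Proof.
rewrite /Y /D /centered /urn_weight -/w00 scalerDl; congr (_ *: _).
by apply/rowP => j; rewrite !mxE; ring.
Qed.

Lemma urn_bounded_scaled n (g : 'rV[R]_s -> R) : bounded_rv (fun x => g (Y n x)).
Proof. exact: (urn_bounded_rv n (fun y => g ((Num.sqrt n%:R)^-1 *: (y - (n%:R * m) *: v)))). Qed.

(** The bounds on D_n carry over since Y_n = (D_n + |X_0| v1) / sqrt n and
    w_n = O(n). *)
Lemma scaled_moments r : exists B, forall n,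
  \int[P]_x ((1 + dot (Y n x) (Y n x)) ^+ r) <= B.
Proof.
have [B B0 hB] := centered_moments r.
pose c := 2 + 2 * w00 ^+ 2 * dot v v.
have c0 : 0 <= c by have := mulr_ge0 (sqr_ge0 w00) (dot_ge0 v); rewrite /c; lra.
have [C0 chain] := urn_expectation_chain.
exists (2 ^+ r * (1 + c ^+ r * B * (w00 + m) ^+ r)) => n.
have n0 : (0 : R) <= n%:R^-1 by rewrite invr_ge0.
have YY x : 1 + dot (Y n x) (Y n x) <= 1 + c * (1 + dot (D n x) (D n x)) * n%:R^-1.
  rewrite YE dotZl dotZr mulrA -expr2 exprVn sqr_sqrtr// mulrC lerD2l ler_wpM2r//.
  exact: dot_shift_le.
have pow (a : R) : 0 <= a -> (1 + a) ^+ r <= 2 ^+ r * (1 + a ^+ r).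
  move=> a0; case: (leP a 1) => a1.
    apply: le_trans (_ : 2 ^+ r <= _).
      by rewrite lerXn2r ?nnegrE ?addr_ge0//; lra.
    by rewrite ler_peMr ?exprn_ge0// lerDl exprn_ge0.
  apply: le_trans (_ : 2 ^+ r * a ^+ r <= _).
    by rewrite -exprMn lerXn2r ?nnegrE ?addr_ge0 ?mulr_ge0//; lra.
  by rewrite ler_wpM2l ?exprn_ge0// lerDr.
have D1 (y : 'rV[R]_s) : 0 <= 1 + dot y y by rewrite addr_ge0// dot_ge0.
have le1 : \int[P]_x ((1 + dot (Y n x) (Y n x)) ^+ r) <=
    2 ^+ r * (1 + c ^+ r * (n%:R^-1) ^+ r * urn_mean n (fun y => (1 + dot y y) ^+ r)).
  rewrite -(chainZ chain n (c ^+ r * n%:R^-1 ^+ r) (fun y => (1 + dot y y) ^+ r)).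
  rewrite -[X in X + _](chain_cst chain n 1) -(chainD chain).
  rewrite -(chainZ chain n (2 ^+ r)
    (fun y => 1 + c ^+ r * n%:R^-1 ^+ r * (1 + dot y y) ^+ r)).
  apply: le_Rintegral => //.
  - apply: bounded_rv_integrable; exact: (urn_bounded_scaled n (fun y => (1 + dot y y) ^+ r)).
  - apply: bounded_rv_integrable.
    exact: (bD n (fun y => 2 ^+ r * (1 + c ^+ r * n%:R^-1 ^+ r * (1 + dot y y) ^+ r))).
  - move=> x _; apply: le_trans (_ : (1 + c * (1 + dot (D n x) (D n x)) * n%:R^-1) ^+ r <= _).
      by rewrite lerXn2r ?nnegrE ?addr_ge0 ?dot_ge0 ?mulr_ge0// addr_ge0// dot_ge0.
    apply: le_trans (pow _ (mulr_ge0 (mulr_ge0 c0 (D1 (D n x))) n0)) _.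
    by rewrite !exprMn [c ^+ r * _ * _]mulrAC.
apply: (le_trans le1); rewrite ler_wpM2l ?exprn_ge0// lerD2l -!mulrA ler_wpM2l ?exprn_ge0//.
have nr : 0 <= n%:R^-1 ^+ r :> R by rewrite exprn_ge0.
apply: le_trans (ler_wpM2l nr (hB n)) _; rewrite mulrCA ler_wpM2l// -exprMn.
have wm : 0 <= w00 + m by rewrite addr_ge0 ?ltW.
rewrite lerXn2r ?nnegrE ?mulr_ge0 ?(ltW (w0 n))// /w /urn_weight -/w00.
case: (posnP n) => [->|np]; first by rewrite invr0 mul0r.
rewrite mulrDr mulrA mulVf ?pnatr_eq0 -?lt0n// mul1r lerD2r.
by rewrite ler_piMl ?(ltW X00)// invf_le1 ?ltr0n// ler1n.
Qed.

Let cvg_inv_sqrt : (Num.sqrt n%:R)^-1 @[n --> \oo] --> (0 : R).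
Proof.
apply/cvgrPdist_le => e e0; near=> n.
rewrite sub0r normrN normfV ger0_norm ?sqrtr_ge0//.
have n0 : 0 < Num.sqrt n%:R :> R by rewrite sqrtr_gt0 ltr0n; near: n; exact: nbhs_infty_gt.
rewrite invf_ple ?posrE//.
have h : e^-1 ^+ 2 <= n%:R by near: n; exact: nbhs_infty_ger.
have := ler_wsqrtr h; rewrite sqrtr_sqr ger0_norm// invr_ge0; exact: ltW.
Unshelve. all: by end_near. Qed.

Let cvg_ratio : Num.sqrt (w n) / Num.sqrt n%:R @[n --> \oo] --> Num.sqrt m.
Proof.
have h : w n / n%:R @[n --> \oo] --> m.
  have : w00 * (Num.sqrt n%:R)^-1 ^+ 2 + m @[n --> \oo] --> w00 * 0 ^+ 2 + m.
    apply: cvgD; last exact: cvg_cst.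
    by apply: cvgM; [exact: cvg_cst|rewrite !expr2; exact: cvgM].
  rewrite expr0n mulr0 add0r; apply: cvg_trans; apply: near_eq_cvg; near=> n.
  have n0 : n%:R != 0 :> R by rewrite pnatr_eq0 -lt0n; near: n; exact: nbhs_infty_gt.
  by rewrite exprVn sqr_sqrtr// /w /urn_weight -/w00 mulrDl mulrAC divff// mul1r.
have : Num.sqrt (w n / n%:R) @[n --> \oo] --> Num.sqrt m by apply: (cvg_comp _ _ h); exact: sqrt_continuous.
apply: cvg_trans; apply: near_eq_cvg; apply: nearW => n /=.
by rewrite sqrtrM ?(ltW (w0 n))// sqrtrV.
Unshelve. all: by end_near. Qed.

(** Passing from the normalization sqrt w_n to sqrt n multiplies the
    frequency by sqrt m in the limit. *)
Lemma scaled_cf t th : \int[P]_x cos (dot t (Y n x) + th) @[n --> \oo] -->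
  cos th * expR (- (dot (t *m (m *: S)) t / 2)).
Proof.
have [B B0 hB] := centered_moments 1.
have [C0 chain] := urn_expectation_chain.
pose t' := Num.sqrt m *: t.
have -> : dot (t *m (m *: S)) t = dot (t' *m S) t'.
  rewrite /t' -scalemxAl -scalemxAr !dotZl dotZr mulrA -expr2 sqr_sqrtr//.
  exact: ltW.
pose C := 1 + dot t t * B.
pose e n := `|Num.sqrt (w n) / Num.sqrt n%:R - Num.sqrt m| * C + `|w00 * dot t v| * (Num.sqrt n%:R)^-1.
have dist n : `|\int[P]_x cos (dot t (Y n x) + th) -
    \int[P]_x cos (dot t' (D n x) / Num.sqrt (w n) + th)| <= e n.
  pose h (y : 'rV[R]_s) := `|Num.sqrt (w n) / Num.sqrt n%:R - Num.sqrt m| *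
    (1 + dot t t / w n * dot y y) + `|w00 * dot t v| * (Num.sqrt n%:R)^-1.
  have he : urn_mean n h <= e n.
    rewrite /h (chainD chain) (chain_cst chain) (chainZ chain) (chainD chain) (chain_cst chain).
    rewrite (chainZ chain) lerD2r ler_wpM2l// lerD2l -mulrA ler_wpM2l ?dot_ge0//.
    rewrite mulrC ler_pdivrMr//.
    have := hB n; rewrite expr1; apply: le_trans; apply: (chain_le chain) => y _.
    by rewrite expr1 lerDr.
  apply: le_trans he; apply: dist_Rintegral_le.
  - apply: bounded_rv_integrable; exact: (urn_bounded_scaled n (fun y => cos (dot t y + th))).
  - apply: bounded_rv_integrable.
    exact: (bD n (fun y => cos (dot t' y / Num.sqrt (w n) + th))).
  - by apply: bounded_rv_integrable; exact: bD.
  move=> x; set y := D n x.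
  pose a := dot t' y / Num.sqrt (w n) + th.
  pose r := Num.sqrt (w n) / Num.sqrt n%:R - Num.sqrt m.
  have rw : Num.sqrt (w n) != 0 by rewrite gt_eqF// sqrtr_gt0.
  have -> : dot t (Y n x) + th = a + (r * (dot t y / Num.sqrt (w n)) +
      w00 * dot t v * (Num.sqrt n%:R)^-1).
    rewrite YE -/y dotZr dotDr dotZr /a /t' dotZl /r; move: (Num.sqrt n%:R)^-1 => z.
    by field.
  apply: le_trans (cos_taylor1 _ _) _; apply: le_trans (ler_normD _ _) _.
  rewrite lerD//; last by rewrite normrM (ger0_norm (x := _^-1))// invr_ge0 sqrtr_ge0.
  rewrite normrM ler_wpM2l//.
  set z := dot t y / Num.sqrt (w n).
  have z2 : z ^+ 2 <= dot t t / w n * dot y y.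
    rewrite /z exprMn exprVn sqr_sqrtr ?(ltW (w0 n))// [leRHS]mulrAC ler_pM2r ?invr_gt0//.
    exact: dot_sqr_le.
  by have := sqr_ge0 (`|z| - 1); rewrite -(real_normK (num_real z)) in z2 *; nra.
have e0 : e n @[n --> \oo] --> (0 : R).
  rewrite -[X in _ --> X](_ : 0 * C + `|w00 * dot t v| * 0 = 0); last by rewrite mul0r mulr0 addr0.
  apply: cvgD; apply: cvgM => //; try exact: cvg_cst.
  rewrite -[X in _ --> X](_ : `|Num.sqrt m - Num.sqrt m| = 0); last by rewrite subrr normr0.
  by apply: cvg_norm; apply: cvgB => //; exact: cvg_cst.
have lim := @centered_cf t' th.
rewrite -[X in _ --> X]add0r.
have -> : (fun n => \int[P]_x cos (dot t (Y n x) + th)) = (fun n =>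
   (\int[P]_x cos (dot t (Y n x) + th) - \int[P]_x cos (dot t' (D n x) / Num.sqrt (w n) + th)) +
   \int[P]_x cos (dot t' (D n x) / Num.sqrt (w n) + th)).
  by apply/funext => n; rewrite subrK.
apply: cvgD => //; apply: (cvg_of_dist_le _ e0) => n.
by rewrite subr0.
Qed.

End UrnLimit.

Theorem theorem1p1 (R : realType) (s : nat) (A : 'M[R]_s) (m : R) (v1 : 'rV[R]_s)
    (m_gt0 : 0 < m)
    (A_balanced : balanced A m)
    (A_irreducible : irreducible_mx A)
    (A_strictly_small : strictly_small A m)
    (v1_gt0 : forall i : 'I_s, 0 < v1 0 i)
    (v1_eigen : v1 *m A = m *: v1)
    (v1_norm : \sum_(i < s) `|v1 0 i| = 1) :
  exists Sigma : 'M[R]_s, covariance_mx Sigma /\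
  exists (d' : measure_display) (T' : measurableType d') (P' : probability T' R)
    (Z : T' -> 'rV[R]_s), normal_vector P' Sigma Z /\
  forall (X0 : 'rV[R]_s),
    (forall i : 'I_s, 0 <= X0 0 i) -> X0 != 0 -> tenability_cond A X0 ->
  forall (d : measure_display) (T : measurableType d) (P : probability T R)
    (X : nat -> T -> 'rV[R]_s), polya_urn P A X0 X ->
  let Y := fun (n : nat) (w : T) =>
    (Num.sqrt n%:R)^-1 *: (X n w - (n%:R * m) *: v1) in
  [/\ cvg_in_distribution P P' Y Z,
      cvg_moments P P' Y Z,
      forall i : 'I_s,
        (fun n : nat => fine 'E_P[fun w => (X n w 0 i)%R]%E - n%:R * m * v1 0 i)
        =o_\oo (fun n : nat => Num.sqrt n%:R : R)
    & forall i j : 'I_s,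
        (fun n : nat => fine (covariance P (fun w => X n w 0 i) (fun w => X n w 0 j))
                        - n%:R * Sigma i j)
        =o_\oo (fun n : nat => n%:R : R)].
Proof.
have v_ge0 i : 0 <= v1 0 i by exact: ltW.
have v_sum : \sum_i v1 0 i = 1.
  by rewrite -v1_norm; apply: eq_bigr => i _; rewrite ger0_norm.
have [S [S_sym S_psd S_eq]] := limit_form_exists m_gt0 A_balanced v_sum v_ge0 A_strictly_small.
have mS_sym : (m *: S)^T = m *: S by rewrite linearZ/= S_sym.
have mS_psd : psd (m *: S).
  by move=> t; rewrite -scalemxAr dotZl mulr_ge0// ltW.
exists (m *: S); split; first by split=> // t; rewrite -dotE.
have [qs qsE] := psd_factor mS_sym mS_psd.
have [d' [T' [P' [Z Zcos]]]] := gauss_cos_exists qs; rewrite -qsE in Zcos.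
exists d', T', P', Z; split; first exact: gauss_cos_normal_vector.
move=> X0 X0_ge0 X0_neq0 _ d T P X urn Y.
have X00 : 0 < \sum_j X0 0 j.
  rewrite lt_neqAle eq_sym sumr_ge0 ?andbT//; apply: contra X0_neq0.
  rewrite psumr_eq0// => /allP h; apply/eqP/rowP => j; rewrite mxE.
  by apply/eqP; apply: h; rewrite mem_index_enum.
have bY n (g : 'rV[R]_s -> R) : bounded_rv (fun w => g (Y n w)).
  exact: (urn_bounded_scaled m v1 urn n g).
have cf t th : \int[P]_w cos (dot t (Y n w) + th) @[n --> \oo] -->
    \int[P']_w cos (dot t (Z w) + th).
  rewrite (proj2 Zcos).
  exact: (scaled_cf m_gt0 A_balanced v1_eigen v_sum v_ge0 A_strictly_small urn X00 S_sym S_psd S_eq).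
have moments := scaled_moments m_gt0 A_balanced v1_eigen v_sum A_strictly_small urn X00.
have cvg_mono (alpha : 'I_s -> nat) :=
  cvg_poly_growth bY Zcos mS_psd cf moments (@continuous_monomial R s alpha)
    (monomial_sqr_le alpha) (measurable_monomial alpha (proj1 Zcos)).
have iY n g : P.-integrable setT (EFin \o (fun w => g (Y n w))).
  by apply: bounded_rv_integrable.
have cvg1 i : \int[P]_w Y n w 0 i @[n --> \oo] --> (0 : R).
  rewrite -(gauss_mean Zcos mS_psd i).
  apply: (proj2 (cvg_poly_growth bY Zcos mS_psd cf moments (f := fun y => y 0 i) (r := 1) _ _ _)).
  - exact: coord_continuous.
  - move=> x; rewrite expr1; have := coord_mul_le x i i; rewrite -expr2 ger0_norm ?sqr_ge0//; lra.
  - exact: (proj1 Zcos).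
have cvg2 i j : \int[P]_w (Y n w 0 i * Y n w 0 j) @[n --> \oo] --> (m *: S) i j.
  rewrite -(gauss_covariance Zcos mS_psd mS_sym i j).
  apply: (proj2 (cvg_poly_growth bY Zcos mS_psd cf moments
    (f := fun y => y 0 i * y 0 j) (r := 2) _ _ _)).
  - by move=> x; apply: (@continuousM _ _ (fun y : 'rV[R]_s => y 0 i) (fun y => y 0 j));
      exact: coord_continuous.
  - move=> x; have h := coord_mul_le x i j.
    rewrite -(real_normK (num_real (_ * _))) lerXn2r ?nnegrE ?addr_ge0 ?dot_ge0//.
    by rewrite (le_trans h)// lerDr.
  - by apply: measurable_funM; exact: (proj1 Zcos).
have XE n w i : (0 < n)%N -> X n w 0 i = Num.sqrt n%:R * Y n w 0 i + n%:R * m * v1 0 i.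
  move=> n0; rewrite /Y !mxE mulrA mulfV ?mul1r ?subrK//.
  by rewrite gt_eqF// sqrtr_gt0 ltr0n.
have bX n i := bY n (fun y => y 0 i).
split.
- move=> f fc [M fM]; rewrite expectation_Rintegral; last first.
    apply: (@bounded_integrable _ _ _ P' _ M) => //.
    exact: (measurable_continuous_comp (proj1 Zcos) fc fM).
  have := cvg_bounded_continuous bY Zcos mS_psd cf moments fc fM => h.
  under eq_fun do rewrite (expectation_Rintegral (iY _ f)).
  by apply: cvg_EFin => //; exact: nearW.
- move=> alpha; have [iZ h] := cvg_mono alpha.
  rewrite expectation_Rintegral//.
  under eq_fun do rewrite (expectation_Rintegral (iY _ (fun y => \prod_i y 0 i ^+ alpha i))).
  by apply: cvg_EFin => //; exact: nearW.
- move=> i; apply/eqoP => e e0.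
  have /cvgrPdist_le/(_ _ e0) h := cvg1 i.
  near=> n; have n0 : (0 < n)%N by near: n; exact: nbhs_infty_gt.
  have -> : fine 'E_P[fun w => (X n w 0 i)%R]%E - n%:R * m * v1 0 i =
      Num.sqrt n%:R * \int[P]_w Y n w 0 i.
    under [X in 'E_P[X]%E]eq_fun do rewrite XE//.
    have b1 : bounded_rv (fun w => Num.sqrt n%:R * Y n w 0 i).
      by apply: bounded_rvM => //; exact: bounded_rv_cst.
    have bc : bounded_rv (fun _ : T => n%:R * m * v1 0 i) by exact: bounded_rv_cst.
    rewrite expectation_Rintegral; last by apply: bounded_rv_integrable; exact: bounded_rvD.
    rewrite /= RintegralD//; try exact: bounded_rv_integrable.
    rewrite prob_Rintegral_cst addrK RintegralZl//.
    exact: bounded_rv_integrable.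
  rewrite normrM mulrC ler_wpM2r//.
  have : `|0 - \int[P]_w Y n w 0 i| <= e by near: n.
  by rewrite sub0r normrN.
- move=> i j; apply/eqoP => e e0.
  have lim : \int[P]_w (Y n w 0 i * Y n w 0 j) - \int[P]_w Y n w 0 i * \int[P]_w Y n w 0 j
      @[n --> \oo] --> (m *: S) i j.
    rewrite -[X in _ --> X]subr0 -[X in _ - X](mulr0 0).
    by apply: cvgB => //; apply: cvgM.
  have /cvgrPdist_le/(_ _ e0) h := lim.
  near=> n; have n0 : (0 < n)%N by near: n; exact: nbhs_infty_gt.
  have -> : fine (covariance P (fun w => X n w 0 i) (fun w => X n w 0 j)) =
      n%:R * (\int[P]_w (Y n w 0 i * Y n w 0 j) - \int[P]_w Y n w 0 i * \int[P]_w Y n w 0 j).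
    under [X in covariance P X _]eq_fun do rewrite XE//.
    under [X in covariance P _ X]eq_fun do rewrite XE//.
    by rewrite fine_covariance_affine// sqr_sqrtr.
  rewrite -mulrBr normrM mulrC ler_wpM2r//.
  by rewrite distrC; near: n.
Unshelve. all: by end_near. Qed.
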